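(* Let $n\ge 1$, let $\Omega\subset\mathbb{C}^n$ be a domain containing the origin, and let $h\colon\Delta\times S^{2n-1}\to\Omega$ be a $C^1$ singular foliation at $0$ by holomorphic discs, with leaves $S_v=h(\Delta\times\{v\})$, $v\in S^{2n-1}$. Let $f\colon\Omega\to\mathbb{C}$ be a function with $f\in C^\infty(0)$ and $f\in C^1(\Omega)$ such that for every leaf $S_v$ the restriction $f|_{S_v}$ is holomorphic. Then $f$ is holomorphic on $\Omega$.
   Context: $\Delta\subset\mathbb{C}$ is the open unit disc and $S^{2n-1}=\{z\in\mathbb{C}^n : |z_1|^2+\cdots+|z_n|^2=1\}$ is the unit sphere. Let $\Omega$ be a domain in $\mathbb{C}^n$ containing the origin. A $C^1$ singular foliation at $0$ by holomorphic discs (of $\Omega$) is a $C^1$ map $h\colon\Delta\times S^{2n-1}\to\Omega$ such that: (1) for each $v\in S^{2n-1}$, the map $z\in\Delta\mapsto h(z,v)\in\mathbb{C}^n$ is a holomorphic embedding; (2) $h(0,v)=0$ for every $v\in S^{2n-1}$; (3) $h(\Delta\times S^{2n-1})=\Omega$; (4) for each $v\in S^{2n-1}$ there exists $r_v>0$ such that $\frac{\partial h}{\partial z}\big|_{(0,v)}=r_v v$; (5) $h(z,e^{i\theta}v)=h(e^{i\theta}z,v)$ for all $\theta\in\mathbb{R}$, $z\in\Delta$, $v\in S^{2n-1}$. The restriction $f|_{S_v}$ being holomorphic means that $z\mapsto f(h(z,v))$ is holomorphic on $\Delta$. The notation $f\in C^\infty(0)$ means: for every positive integer $k$ there exists a polynomial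 $p_k$ (with complex coefficients, in the variables $z_1,\dots,z_n,\bar z_1,\dots,\bar z_n$) such that $f(z)-p_k(z)=o(|z|^k)$ as $z\to 0$. The notation $f\in C^1(\Omega)$ means $f$ is continuously differentiable on $\Omega$ in the real sense. *)

(* Defs.v *)
From HB Require Import structures.
From mathcomp Require Import all_boot all_order all_algebra.
From mathcomp Require Import complex.
From mathcomp Require mpoly.
From mathcomp Require Import all_classical all_reals all_analysis.

Set Implicit Arguments.
Unset Strict Implicit.
Unset Printing Implicit Defensive.

Import Order.TTheory GRing.Theory Num.Theory.
Import numFieldNormedType.Exports.

Local Open Scope classical_set_scope.
Local Open Scope complex_scope.
Local Open Scope ring_scope.

(* R[i] bundled as a numeric field, so that the library's topology and norm on
   numeric fields apply to it. *)
Definition CC (R : realType) : numClosedFieldType := R[i].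

(* Restriction of scalars: a complex normed space V viewed as a real one, with
   the same underlying set and topology. Differentiability of a map
   realify R V -> realify R W is real (Frechet) differentiability, whereas
   differentiability of a map V -> W is complex differentiability. *)
Definition realify (R : realType) (V : Type) : Type := V.

Section Realify.
Variables (R : realType) (V : normedModType (CC R)).

HB.instance Definition _ := Uniform.on (realify R V).
HB.instance Definition _ := Pointed.on (realify R V).
HB.instance Definition _ := GRing.Zmodule.on (realify R V).

Definition rscale (t : R) (x : realify R V) : realify R V :=
  (t%:C : CC R) *: (x : V).

Lemma rscaleA a b x : rscale a (rscale b x) = rscale (a * b) x.
Proof. by rewrite /rscale scalerA rmorphM. Qed.
Lemma rscale1 : left_id 1 rscale.
Proof. by move=> x; rewrite /rscale scale1r. Qed.
Lemma rscaleDr : right_distributive rscale +%R.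
Proof. by move=> a x y; rewrite /rscale scalerDr. Qed.
Lemma rscaleDl x : {morph rscale^~ x : a b / a + b}.
Proof. by move=> a b; rewrite /rscale rmorphD scalerDl. Qed.

HB.instance Definition _ :=
  GRing.Zmodule_isLmodule.Build R (realify R V) rscaleA rscale1 rscaleDr rscaleDl.

Definition rnorm (x : realify R V) : R := complex.Re (`|(x : V)| : R[i]).

Lemma rnormE x : (rnorm x)%:C = `|(x : V)| :> CC R.
Proof. exact/RRe_real/normr_real. Qed.


Lemma rnormD x y : rnorm (x + y) <= rnorm x + rnorm y.
Proof. by rewrite -lecR rmorphD/= !rnormE; exact: ler_normD. Qed.
Lemma rnorm_eq0 x : rnorm x = 0 -> x = 0.
Proof. by move=> x0; apply: (@normr0_eq0 _ V); rewrite -rnormE x0. Qed.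
Lemma rnormMn x n : rnorm (x *+ n) = rnorm x *+ n.
Proof.
by apply/(@complexI R); rewrite rmorphMn/= !rnormE; exact: (@normrMn _ V).
Qed.
Lemma rnormN x : rnorm (- x) = rnorm x.
Proof. by apply/(@complexI R); rewrite !rnormE; exact: (@normrN _ V). Qed.

HB.instance Definition _ :=
  Num.Zmodule_isNormed.Build R (realify R V) rnormD rnorm_eq0 rnormMn rnormN.

Let rball (x : realify R V) (e : R) (y : realify R V) : Prop :=
  ball_ (fun u : realify R V => `|u|) x e y.

Lemma rballE x e y : rball x e y = ball (x : V) (e%:C : CC R) y.
Proof.
by apply/propext; rewrite /rball -ball_normE /= -[`|_|]/(rnorm (x - y)) -ltcR rnormE.
Qed.

Let rball_center x e : 0 < e -> rball x e x.
Proof. by move=> e0; rewrite rballE; apply: ballxx; rewrite ltcR. Qed.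
Let rball_sym x y e : rball x e y -> rball y e x.
Proof. by rewrite !rballE; exact: ball_sym. Qed.
Let rball_triangle x y z e1 e2 :
  rball x e1 y -> rball y e2 z -> rball x (e1 + e2) z.
Proof. by rewrite !rballE rmorphD/=; exact: ball_triangle. Qed.
Let rentourageE : entourage = entourage_ rball.
Proof.
rewrite -[LHS](@entourage_ballE _ V); apply/seteqP; split => A [e e0 eA].
  have eE : (complex.Re e)%:C = e := RRe_real (gtr0_real e0).
  exists (complex.Re e); first by rewrite /= -ltcR eE.
  by move=> x /= ; rewrite rballE eE; exact: eA.
exists (e%:C); first by rewrite /= ltcR.
by move=> x /= xe; apply: eA; rewrite /= rballE.
Qed.

HB.instance Definition _ := Uniform_isPseudoMetric.Build R (realify R V)
  rball_center rball_sym rball_triangle rentourageE.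
HB.instance Definition _ :=
  NormedZmod_PseudoMetric_eq.Build R (realify R V) erefl.

Let rnormZ (l : R) (x : realify R V) : `|l *: x| = `|l| * `|x|.
Proof.
apply/(@complexI R); rewrite rmorphM/= -[in LHS]/(rnorm _) -/(rnorm x) !rnormE.
by rewrite (@normrZ _ V) normc_def/= expr0n addr0 sqrtr_sqr.
Qed.

HB.instance Definition _ :=
  PseudoMetricNormedZmod_Lmodule_isNormedModule.Build R (realify R V) rnormZ.

End Realify.

Section Calculus.
Variables (R : realType) (V W : normedModType (CC R)).

Definition holomorphic_on (A : set V) (F : V -> W) : Prop :=
  forall x, A x -> differentiable F x.

Definition real_differentiable (F : V -> W) (x : V) : Prop :=
  differentiable (F : realify R V -> realify R W) (x : realify R V).

Definition real_diff (F : V -> W) (x v : V) : W :=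
  'd (F : realify R V -> realify R W) (x : realify R V) v.

(* Meant for open U and finite-dimensional V, where continuity of
   x |-> real_diff F x v for every v amounts to continuity of the derivative in
   operator norm. *)
Definition C1_open (U : set V) (F : V -> W) : Prop :=
  forall x, U x -> real_differentiable F x /\
    forall v, {for x, continuous (fun y => real_diff F y v)}.

(* C^1 maps on a subset that need not be open (here a submanifold): those that
   extend locally to C^1 maps on open sets of the ambient space. *)
Definition C1_on (A : set V) (F : V -> W) : Prop :=
  forall x, A x -> exists U : set V, exists G : V -> W,
    [/\ open U, U x, C1_open U G & forall y, A y -> U y -> F y = G y].

End Calculus.

Section Foliation.
Variables (R : realType) (n : nat).

Definition unit_disc : set (CC R) := [set z | `|z| < 1].

(* The norm of the library on row vectors is the maximum norm, so the Euclidean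
   sphere is spelled out. *)
Definition sphere : set 'rV[CC R]_n :=
  [set v | \sum_(i < n) `|v 0 i| ^+ 2 = 1].

Definition expi (t : R) : CC R := cos t +i* sin t.

(* An injective holomorphic immersion that is a homeomorphism onto its image;
   injectivity is part of the existence of the inverse g'. *)
Definition holomorphic_embedding (A : set (CC R)) (g : CC R -> 'rV[CC R]_n) : Prop :=
  [/\ holomorphic_on A g,
      forall z, A z -> derive1 g z != 0 &
      exists g' : 'rV[CC R]_n -> CC R,
        (forall z, A z -> g' (g z) = z) /\ {within g @` A, continuous g'}].

(* Only the values of h on unit_disc `*` sphere are relevant. *)
Record C1_singular_foliation (Omega : set 'rV[CC R]_n)
    (h : CC R * 'rV[CC R]_n -> 'rV[CC R]_n) : Prop := {
  foliation_C1 : C1_on (unit_disc `*` sphere) h;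
  foliation_embedding : forall v, sphere v ->
    holomorphic_embedding unit_disc (fun z => h (z, v));
  foliation_center : forall v, sphere v -> h (0, v) = 0;
  foliation_image : h @` (unit_disc `*` sphere) = Omega;
  foliation_direction : forall v, sphere v ->
    exists r : R, 0 < r /\ derive1 (fun z => h (z, v)) 0 = (r%:C : CC R) *: v;
  foliation_rotation : forall (t : R) z v, unit_disc z -> sphere v ->
    h (z, expi t *: v) = h (expi t * z, v)
}.

(* The value at (z, conj z) of a polynomial in z_1..z_n, conj z_1..conj z_n. *)
Definition zzbar_eval (p : mpoly.mpoly (n + n) (CC R)) (z : 'rV[CC R]_n) : CC R :=
  mpoly.meval (fun i => row_mx z (map_mx Num.conj z) 0 i) p.

(* The maximum norm is equivalent to the Euclidean one, so using it here does
   not change the meaning of the little-o. *)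
Definition Cinfty_at0 (f : 'rV[CC R]_n -> CC R) : Prop :=
  forall k, (0 < k)%N -> exists p : mpoly.mpoly (n + n) (CC R),
    (fun z => f z - zzbar_eval p z) =o_ (0 : 'rV[CC R]_n) (fun z => `|z| ^+ k).

End Foliation.

(* Main.v *)
Require Import Defs.
From HB Require Import structures.
From mathcomp Require Import all_boot all_order all_algebra.
From mathcomp Require Import complex ring lra.
From mathcomp Require mpoly.
From mathcomp Require Import all_classical all_reals all_analysis.

(** Why the theorem holds.

    By hypothesis every point of Omega is h(z, v) for some z in the disc and v in the sphere.  Fix v
    and write b(z) for the antiholomorphic part of the real differential of f at h(z, v); the claim is
    that b vanishes on the disc.

    The jets of f at 0.  Along each leaf f is holomorphic, so in the Taylor polynomial of f at 0 the
    bihomogeneous terms that contain some conj(z_i) cancel: f is approximated to every order k by a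
    polynomial P_k in z alone ([hol_part_agree]).

    Fields along the leaf.  A curve g in the sphere with g(0) = v and velocity xi gives the field
    H(z) = d/dt h(z, g t) at t = 0 along the leaf.  The difference quotients
    (h(z, g t) - h(z, v)) / t are holomorphic in z and converge uniformly on smaller discs, so H is
    holomorphic.  The same argument for f o h - P_k o h, which on each leaf is holomorphic and
    vanishes beyond order k at z = 0, shows that df(H) - dP_k(H) has these two properties as well
    ([deriv_vord]).  The curve t |-> e^(it) v gives, by the rotation identity, the field i z dh/dz,
    on which df is complex linear because f is holomorphic on the leaf.  Adding complex multiples of
    it to the fields H produces for every vector w a holomorphic field X = rho w z + O(z^2), where
    rho is the radius of the leaf at the origin, such that df(X) - dP_k(X) is holomorphic and
    vanishes beyond order k for every k ([field_exists]).

    Linear algebra.  Let the rows of M(z) be the fields of the basis vectors e_j, and those of N(z)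
    the fields of the vectors i e_j.  With a and b the columns of df, the products
    d = M a + conj(M) b and d' = N a + conj(N) b agree beyond order k with M A_k and N A_k, where A_k
    is the gradient of P_k.  Hence det(M) d' - N adj(M) d is holomorphic and vanishes to infinite
    order at the origin, so it is zero ([adjugate_relation]).  Inserting the definitions of d and d'
    removes a and leaves T b = 0 with T = det(M) conj(N) - N adj(M) conj(M) ([dbar_mx_ker]).  Here
    M ~ rho z and N ~ i rho z, so on a line t |-> t y with t real det T is the restriction of a
    holomorphic function of t with a nonzero leading term.  It is therefore nonzero for a dense set
    of t, where b = 0 ([dbar_zeros_dense]); by continuity b = 0 everywhere ([dzbar_eq0]).

    Holomorphic functions of one variable enter through the predicate [vord r m u]: on the disc
    |z| <= r the function u is a uniform limit of polynomials without terms of degree < m.  All the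
    facts about them that are needed (coefficient bounds, leading terms, flat functions are zero,
    complex differentiability implies membership) come from averages over the N-th roots of unity,
    a discrete form of the Cauchy integral. *)

Set Implicit Arguments.
Unset Strict Implicit.
Unset Printing Implicit Defensive.

Import Order.TTheory GRing.Theory Num.Theory.
Import numFieldNormedType.Exports.

Local Open Scope classical_set_scope.
Local Open Scope ring_scope.

(** * Real-valued norms *)

Section Mag.
Variable R : realType.
Notation K := (CC R).

(** The norm of a complex normed space takes values in the complex numbers; its real part is a real
    number, on which the decision procedures for ordered fields work. *)
Definition mag (V : normedModType K) (x : V) : R := rnorm x.

Variable V : normedModType K.
Implicit Types x y : V.

Lemma magE x : ((mag x)%:C)%C = `|x| :> K.
Proof. exact: rnormE. Qed.

Lemma mag_ge0 x : 0 <= mag x.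
Proof. by rewrite -ler0c magE normr_ge0. Qed.

Lemma mag0 : mag (0 : V) = 0.
Proof. by apply/(@complexI R); rewrite magE normr0. Qed.

Lemma magN x : mag (- x) = mag x.
Proof. exact: rnormN. Qed.

Lemma magD x y : mag (x + y) <= mag x + mag y.
Proof. exact: rnormD. Qed.

Lemma magB x y : mag (x - y) <= mag x + mag y.
Proof. by rewrite -[mag y]magN magD. Qed.

Lemma magBC x y : mag (x - y) = mag (y - x).
Proof. by rewrite -magN opprB. Qed.

Lemma mag_sub x y z : mag (x - z) <= mag (x - y) + mag (y - z).
Proof. by rewrite (_ : x - z = (x - y) + (y - z)) ?magD// addrA subrK. Qed.

Lemma mag_eq0 x : mag x = 0 -> x = 0.
Proof. exact: rnorm_eq0. Qed.

Lemma mag_gt0 x : x != 0 -> 0 < mag x.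
Proof. by move=> x0; rewrite lt0r mag_ge0 andbT; apply: contra_neq x0 => /mag_eq0. Qed.

Lemma magZ (a : K) x : mag (a *: x) = mag a * mag x.
Proof. by apply/(@complexI R); rewrite rmorphM/= !magE normrZ. Qed.

Lemma mag_sum (I : Type) (s : seq I) (P : pred I) (F : I -> V) :
  mag (\sum_(i <- s | P i) F i) <= \sum_(i <- s | P i) mag (F i).
Proof.
elim/big_rec2: _ => [|i y x _ IH]; first by rewrite mag0.
exact: le_trans (magD _ _) (lerD _ _).
Qed.

End Mag.

Section MagC.
Variable R : realType.
Notation K := (CC R).
Implicit Types x y : K.

Lemma magM x y : mag (x * y) = mag x * mag y.
Proof. exact: (@magZ R K). Qed.

Lemma mag1 : mag (1 : K) = 1.
Proof. by apply/(@complexI R); rewrite magE normr1. Qed.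

Lemma magX x n : mag (x ^+ n) = mag x ^+ n.
Proof. by elim: n => [|n IH]; rewrite ?expr0 ?mag1// !exprS magM IH. Qed.

Lemma magV x : mag x^-1 = (mag x)^-1.
Proof. by apply/(@complexI R); rewrite fmorphV/= !magE normfV. Qed.

Lemma mag_real (a : R) : mag (a%:C%C : K) = `|a|.
Proof. by apply/(@complexI R); rewrite magE normc_def/= expr0n addr0 sqrtr_sqr. Qed.

Lemma mag_conj x : mag (Num.conj x) = mag x.
Proof. by apply/(@complexI R); rewrite !magE norm_conjC. Qed.

Lemma mag_nat n : mag (n%:R : K) = n%:R.
Proof. by rewrite -(rmorph_nat (@real_complex_def R (Phant R))) mag_real ger0_norm. Qed.

Lemma mag_sqr x : (mag x) ^+ 2 = (complex.Re x) ^+ 2 + (complex.Im x) ^+ 2.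
Proof. by apply/(@complexI R); rewrite rmorphXn/= magE add_Re2_Im2. Qed.

Lemma mag_ReIm x : mag x <= `|complex.Re x| + `|complex.Im x|.
Proof.
rewrite -(@ler_pXn2r _ 2)// ?nnegrE ?mag_ge0 ?addr_ge0// mag_sqr.
rewrite sqrrD !real_normK ?num_real// -addrA [X in _ <= _ + X]addrC addrA lerDl.
by rewrite mulrn_wge0 ?mulr_ge0.
Qed.

Lemma Re_le_mag x : `|complex.Re x| <= mag x.
Proof.
rewrite -(@ler_pXn2r _ 2)// ?nnegrE ?mag_ge0// mag_sqr real_normK ?num_real//.
by rewrite lerDl sqr_ge0.
Qed.

Lemma Im_le_mag x : `|complex.Im x| <= mag x.
Proof.
rewrite -(@ler_pXn2r _ 2)// ?nnegrE ?mag_ge0// mag_sqr real_normK ?num_real//.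
by rewrite lerDr sqr_ge0.
Qed.

End MagC.

(** * Roots of unity and the discrete mean value formula *)

Section Roots.
Variable R : realType.
Notation K := (CC R).

Lemma expiD (a b : R) : expi (a + b) = expi a * expi b.
Proof.
apply/eqP; rewrite eq_complex/= cosD sinD.
by apply/andP; split; apply/eqP; ring.
Qed.

Lemma expi0 : expi (0 : R) = 1.
Proof. by rewrite /expi cos0 sin0. Qed.

Lemma mag_expi (a : R) : mag (expi a) = 1.
Proof.
apply/eqP; rewrite -(@eqrXn2 _ 2)// ?mag_ge0// expr1n mag_sqr/=.
by rewrite cos2Dsin2.
Qed.

Lemma expiMn (a : R) n : expi (a *+ n) = expi a ^+ n.
Proof. by elim: n => [|n IH]; rewrite ?mulr0n ?expi0// mulrS expiD IH exprS. Qed.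

Lemma expi2pi : expi (pi *+ 2 : R) = 1.
Proof. by rewrite /expi cos2pi sin2pi. Qed.

Lemma expi_neq1 (a : R) : 0 < a < pi *+ 2 -> expi a != 1.
Proof.
move=> /andP[a0 a2]; apply/eqP => /(congr1 (@complex.Re R)) /= ca1.
have s0 : 0 < sin (a / 2).
  by apply: sin_gt0_pi; apply/andP; split; lra.
have e : a = a / 2 + a / 2 by lra.
move: ca1; rewrite [in cos a]e cosD; have := cos2Dsin2 (a / 2); nra.
Qed.

Definition root_unity (N : nat) : K := expi (pi *+ 2 / N%:R).

Lemma root_unity_prim N : (0 < N)%N -> N.-primitive_root (root_unity N).
Proof.
move=> N0; have N0' : 0 < (N%:R : R) by rewrite ltr0n.
have pi0 := pi_gt0 R.
rewrite /primitive_root_of_unity N0 /=; apply/forallP => i.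
rewrite unity_rootE /root_unity -expiMn -[_ *+ i.+1]mulr_natr.
have [->|/eqP iN] := eqVneq i.+1 N.
  by rewrite divfK ?lt0r_neq0// expi2pi eqxx.
apply/eqP; apply/negbTE; apply: expi_neq1; apply/andP; split.
  by rewrite mulr_gt0// ?divr_gt0// mulrn_wgt0.
have iN1 : N%:R^-1 * i.+1%:R < 1 :> R.
  by rewrite mulrC ltr_pdivrMr// mul1r ltr_nat ltn_neqAle (introN eqP iN) ltn_ord.
rewrite -mulrA; move: iN1; set x := _ * _ => x1.
by rewrite gtr_pMr// mulrn_wgt0.
Qed.

Lemma mag_root_unity N : mag (root_unity N) = 1.
Proof. exact: mag_expi. Qed.

Lemma root_unity_near1 (d : R) : 0 < d -> exists N0, forall N, (N0 < N)%N ->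
  mag (root_unity N - 1) < d.
Proof.
move=> d0.
have : (fun n : nat => pi *+ 2 / n.+1%:R : R) @ \oo --> (0 : R).
  rewrite -[X in _ --> X](mulr0 (pi *+ 2)).
  by apply: cvgM; [exact: cvg_cst|exact: cvg_harmonic].
move=> h0.
have hc : (fun n : nat => cos (pi *+ 2 / n.+1%:R : R)) @ \oo --> (1 : R).
  by rewrite -[X in _ --> X]cos0; apply: continuous_cvg h0; exact: continuous_cos.
have hs : (fun n : nat => sin (pi *+ 2 / n.+1%:R : R)) @ \oo --> (0 : R).
  by rewrite -[X in _ --> X]sin0; apply: continuous_cvg h0; exact: continuous_sin.
have d2 : 0 < d / 2 by lra.
have /cvgrPdist_lt /(_ _ d2) [N1 _ H1] := hc.
have /cvgrPdist_lt /(_ _ d2) [N2 _ H2] := hs.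
exists (maxn N1 N2) => -[//|N]; rewrite ltnS geq_max => /andP[/H1 /= h1 /H2 /= h2].
apply: le_lt_trans (mag_ReIm _) _ => /=.
rewrite distrC in h1; rewrite sub0r normrN in h2; rewrite oppr0 addr0.
lra.
Qed.

Lemma sum_root_unity N j : (0 < N)%N ->
  \sum_(k < N) (root_unity N ^+ j) ^+ k = (if (N %| j)%N then N%:R else 0).
Proof.
move=> N0; have pr := root_unity_prim N0.
rewrite (prim_order_dvd pr); case: eqP => [->|/eqP w1].
  by under eq_bigr do rewrite expr1n; rewrite sumr_const card_ord.
apply/eqP; rewrite -(mulrI_eq0 _ (mulfI (_ : root_unity N ^+ j - 1 != 0))) ?subr_eq0//.
by rewrite -subrX1 exprAC (prim_expr_order pr) expr1n subrr.
Qed.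

(** Orthogonality of the characters of Z/N isolates the coefficient of degree m.  The exponent
    N - m stands for -m, the powers of a root of unity being N-periodic. *)
Lemma coef_mean (p : {poly K}) (r : K) (N m : nat) : (size p <= N)%N -> (m < N)%N ->
  \sum_(k < N) p.[r * root_unity N ^+ k] * root_unity N ^+ ((N - m) * k)
    = N%:R * (p`_m * r ^+ m).
Proof.
move=> sp mN; have N0 : (0 < N)%N by exact: leq_trans mN.
under eq_bigr => k _.
  rewrite (horner_coef_wide _ sp) mulr_suml.
  under eq_bigr => i _.
    rewrite exprMn -exprM (mulnC k) -!mulrA -exprD -mulnDl exprM.
    over.
  over.
rewrite exchange_big/=.
under eq_bigr => i _ do rewrite -!mulr_sumr sum_root_unity//.
rewrite (bigD1 (Ordinal mN))//= subnKC 1?ltnW// dvdnn big1 ?addr0; last first.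
  move=> i im; rewrite ifN ?mulr0//; apply: contra im.
  move=> /dvdnP[q]; have iN := ltn_ord i => e.
  apply/eqP/val_inj => /=; move: e; rewrite addnBA 1?ltnW// => e.
  have e' : (i + N = q * N + m)%N by rewrite -e subnK// (leq_trans (ltnW mN)) ?leq_addl.
  have : (i + N = m %[mod N])%N by rewrite e' modnMDl.
  by rewrite modnDr !modn_small.
by rewrite mulrA mulrC.
Qed.

(** The Cauchy estimate, read off from the discrete mean formula at sufficiently many points. *)
Lemma coef_bound (p : {poly K}) (r S : R) m : 0 <= r ->
  (forall z, mag z <= r -> mag p.[z] <= S) -> mag p`_m * r ^+ m <= S.
Proof.
move=> r0 pS.
pose N := maxn (size p) m.+1.
have N0 : (0 < N)%N by rewrite leq_max orbT.
have N0' : 0 < (N%:R : R) by rewrite ltr0n.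
have /(congr1 (@mag R K)) := @coef_mean p (r%:C)%C N m (leq_maxl _ _) (leq_maxr _ _).
rewrite !magM magX mag_nat mag_real ger0_norm// => e.
rewrite -(ler_pM2l N0') -e.
apply: le_trans (mag_sum _ _ _) _.
rewrite mulr_natl -[X in _ *+ X]card_ord -sumr_const.
apply: ler_sum => k _; rewrite magM magX mag_root_unity expr1n mulr1.
by apply: pS; rewrite magM magX mag_root_unity expr1n mulr1 mag_real ger0_norm.
Qed.

Lemma unit_expi (c : K) : mag c = 1 -> exists t, c = expi t.
Proof.
move=> c1; have := mag_sqr c; rewrite c1 expr1n; case: c c1 => x y _ /= xy.
have x1 : -1 <= x <= 1 by apply/andP; split; nra.
have s : sin (acos x) ^+ 2 = y ^+ 2.
  by have := cos2Dsin2 (acos x); rewrite acosK//; lra.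
have /orP[/eqP sy|/eqP sy] : (sin (acos x) == y) || (sin (acos x) == - y) by rewrite -eqf_sqr s.
  by exists (acos x); rewrite /expi acosK// sy.
by exists (- acos x); rewrite /expi cosN sinN acosK// sy opprK.
Qed.

End Roots.

(** * Uniform limits of polynomials and their order at the origin *)

(** Completeness of the reals in the form used below: the intervals of center x n and radius a n
    meet pairwise, so they have a common point, the supremum of the left endpoints. *)
Lemma sup_between (R : realType) (x a : nat -> R) :
  (forall n k, `|x n - x k| <= a n + a k) -> exists c, forall n, `|x n - c| <= a n.
Proof.
move=> H.
pose A := [set y : R | exists n, y = x n - a n].
have ub n : ubound A (x n + a n).
  move=> _ [k ->]; have := H n k; rewrite ler_norml => /andP[]; lra.
have hs : has_sup A by split; [exists (x 0%N - a 0%N), 0%N|exists (x 0%N + a 0%N)].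
exists (sup A) => n.
have h1 : x n - a n <= sup A by apply: ub_le_sup; [exact: hs.2|exists n].
have h2 : sup A <= x n + a n by apply: ge_sup => //; exact: hs.1.
rewrite ler_norml; apply/andP; split; lra.
Qed.

Lemma complex_between (R : realType) (x : nat -> CC R) (a : nat -> R) :
  (forall n k, mag (x n - x k) <= a n + a k) -> exists c, forall n, mag (x n - c) <= a n *+ 2.
Proof.
move=> H.
have [|c1 h1] := @sup_between R (fun n => complex.Re (x n)) a.
  by move=> n k; rewrite -raddfB; apply: le_trans (Re_le_mag _) (H n k).
have [|c2 h2] := @sup_between R (fun n => complex.Im (x n)) a.
  by move=> n k; rewrite -raddfB; apply: le_trans (Im_le_mag _) (H n k).
exists (c1 +i* c2)%C => n.
apply: le_trans (mag_ReIm _) _; rewrite mulr2n.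
have := h1 n; have := h2 n.
by case: (x n) => u v /= *; apply: lerD.
Qed.

Section Vord.
Variable R : realType.
Notation K := (CC R).
Implicit Types (u w : K -> K) (r : R) (m k : nat) (p q : {poly K}).

(** For r > 0, a function that is holomorphic near the disc mag z <= r satisfies [vord r m] exactly
    when it vanishes to order m at the origin.  Polynomial approximation is used instead of power
    series because it is stable under products and uniform limits for trivial reasons. *)
Definition vord r m u : Prop := forall e : R, 0 < e ->
  exists p, (forall j, (j < m)%N -> p`_j = 0) /\
    forall z, mag z <= r -> mag (u z - p.[z]) <= e.

Lemma vord_ext r m u w : (forall z, mag z <= r -> u z = w z) -> vord r m u -> vord r m w.
Proof.
move=> uw H e e0; have [p [p0 pe]] := H e e0.
by exists p; split => // z zr; rewrite -uw// pe.
Qed.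

Lemma vord_poly r m p : (forall j, (j < m)%N -> p`_j = 0) -> vord r m (horner p).
Proof. by move=> p0 e e0; exists p; split => // z _; rewrite subrr mag0 ltW. Qed.

Lemma vord_cst r (c : K) : vord r 0 (fun=> c).
Proof.
apply: (@vord_ext _ _ (horner c%:P)); first by move=> z; rewrite hornerC.
exact: vord_poly.
Qed.

Lemma vord_id r : vord r 1 (fun z => z).
Proof.
apply: (@vord_ext _ _ (horner 'X)); first by move=> z; rewrite hornerX.
by apply: vord_poly => -[|//] _; rewrite coefX.
Qed.

Lemma vord0 r m : vord r m (fun=> 0).
Proof.
apply: (@vord_ext _ _ (horner 0)); first by move=> z; rewrite horner0.
by apply: vord_poly => j _; rewrite coef0.
Qed.

Lemma vord_le r m k u : (m <= k)%N -> vord r k u -> vord r m u.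
Proof.
move=> mk H e e0; have [p [p0 pe]] := H e e0.
by exists p; split => // j jm; rewrite p0// (leq_trans jm).
Qed.

Lemma vordD r m u w : vord r m u -> vord r m w -> vord r m (fun z => u z + w z).
Proof.
move=> Hu Hw e e0; have e2 : 0 < e / 2 by lra.
have [p [p0 pe]] := Hu _ e2; have [q [q0 qe]] := Hw _ e2.
exists (p + q); split => [j jm|z zr]; first by rewrite coefD p0// q0// addr0.
rewrite hornerD opprD addrACA.
apply: le_trans (magD _ _) _; have := pe z zr; have := qe z zr; lra.
Qed.

Lemma horner_bounded r p : exists S : R, 0 < S /\ forall z, mag z <= r -> mag p.[z] <= S.
Proof.
elim/poly_ind: p => [|p c [S [S0 IH]]].
  by exists 1; split => // z _; rewrite horner0 mag0.
exists (S * `|r| + mag c + 1); split.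
  by have := mag_ge0 c; have := normr_ge0 r; nra.
move=> z zr; rewrite hornerMXaddC; apply: le_trans (magD _ _) _; rewrite magM.
have := IH _ zr; have := mag_ge0 p.[z]; have := mag_ge0 z; have := ler_norm r; nra.
Qed.

Lemma vord_bounded r m u : vord r m u ->
  exists S : R, 0 < S /\ forall z, mag z <= r -> mag (u z) <= S.
Proof.
move=> /(_ _ ltr01)[p [_ pe]]; have [S [S0 pS]] := horner_bounded r p.
exists (S + 1); split; first lra.
move=> z zr; have := pe _ zr; have := pS _ zr.
have := magD (u z - p.[z]) p.[z]; rewrite subrK; lra.
Qed.

Lemma vordM r m k u w : vord r m u -> vord r k w -> vord r (m + k) (fun z => u z * w z).
Proof.
move=> Hu Hw e e0.
have [S [S0 uS]] := vord_bounded Hu.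
have [T [T0 wT]] := vord_bounded Hw.
have d0 : 0 < e / (S + T + 1 + e) by rewrite divr_gt0; lra.
set d := e / (S + T + 1 + e) in d0.
have de : d * (S + T + 1 + e) = e by rewrite divfK//; lra.
have d1 : d <= 1 by nra.
have [p [p0 pe]] := Hu _ d0; have [q [q0 qe]] := Hw _ d0.
exists (p * q); split => [j jm|z zr].
  rewrite coefM big1// => i _.
  have [im|mi] := ltnP i m; first by rewrite p0// mul0r.
  rewrite q0 ?mulr0//.
  have ij := ltn_ord i; rewrite ltnS in ij.
  by rewrite ltn_subLR// (leq_trans jm)// leq_add2r.
rewrite hornerM.
have -> : u z * w z - p.[z] * q.[z] =
  u z * (w z - q.[z]) + (u z - p.[z]) * (w z - (w z - q.[z])) by ring.
apply: le_trans (magD _ _) _; rewrite !magM.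
have h1 := uS _ zr; have h2 := wT _ zr; have h3 := pe _ zr; have h4 := qe _ zr.
have h5 := magB (w z) (w z - q.[z]).
have g1 := mag_ge0 (u z); have g2 := mag_ge0 (u z - p.[z]).
have g3 := mag_ge0 (w z - q.[z]); have g4 := mag_ge0 (w z - (w z - q.[z])).
apply: (@le_trans _ _ (S * d + d * (T + 1))); last by nra.
by apply: lerD; apply: ler_pM => //; lra.
Qed.

Lemma vordZ r m (c : K) u : vord r m u -> vord r m (fun z => c * u z).
Proof. by move=> Hu; rewrite -[m]add0n; exact: vordM (vord_cst r c) Hu. Qed.

Lemma vordN r m u : vord r m u -> vord r m (fun z => - u z).
Proof. by move=> /(vordZ (-1)); apply: vord_ext => z _; rewrite mulN1r. Qed.

Lemma vordB r m u w : vord r m u -> vord r m w -> vord r m (fun z => u z - w z).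
Proof. by move=> Hu /vordN; exact: vordD. Qed.

Lemma vord_sum r m (I : Type) (s : seq I) (P : pred I) (F : I -> K -> K) :
  (forall i, P i -> vord r m (F i)) -> vord r m (fun z => \sum_(i <- s | P i) F i z).
Proof.
move=> HF; elim: s => [|i s IH].
  by apply: vord_ext (vord0 r m) => z _; rewrite big_nil.
have [Pi|Pi] := boolP (P i).
  by apply: vord_ext (vordD (HF _ Pi) IH) => z _; rewrite big_cons Pi.
by apply: vord_ext IH => z _; rewrite big_cons (negPf Pi).
Qed.

Lemma vordX r m u k : vord r m u -> vord r (k * m) (fun z => u z ^+ k).
Proof.
move=> Hu; elim: k => [|k IH].
  by rewrite mul0n; apply: vord_ext (vord_cst r 1) => z _; rewrite expr0.
by rewrite mulSn; apply: vord_ext (vordM Hu IH) => z _; rewrite exprS.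
Qed.

Lemma vordZX r m (c : K) : vord r m (fun z => c * z ^+ m).
Proof. by apply: vordZ; rewrite -{1}[m]muln1; apply: vordX; exact: vord_id. Qed.

Lemma vord_lim r m u : (forall e : R, 0 < e -> exists w, vord r m w /\
  forall z, mag z <= r -> mag (u z - w z) <= e) -> vord r m u.
Proof.
move=> H e e0; have e2 : 0 < e / 2 by lra.
have [w [Hw uw]] := H _ e2; have [p [p0 pe]] := Hw _ e2.
exists p; split => // z zr.
by have := mag_sub (u z) (w z) p.[z]; have := uw _ zr; have := pe _ zr; lra.
Qed.

(** Write p = q 'X^m.  By the Cauchy estimate the i-th coefficient of q is at most
    S / r ^+ (i + m), and the factor 1 - mag z / r sums the resulting geometric series. *)
Lemma horner_tail r m p (S : R) : 0 < r -> (forall j, (j < m)%N -> p`_j = 0) ->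
  (forall z, mag z <= r -> mag p.[z] <= S) ->
  forall z, mag z < r -> (1 - mag z / r) * mag p.[z] <= S * (mag z / r) ^+ m.
Proof.
move=> r0 p0 pS z zr.
set t := mag z / r.
have t0 : 0 <= t by rewrite divr_ge0 ?mag_ge0// ltW.
have t1 : t < 1 by rewrite ltr_pdivrMr// mul1r.
have S0 : 0 <= S by apply: le_trans (pS 0 _); rewrite ?mag_ge0// mag0 ltW.
have zt : mag z = t * r by rewrite divfK// lt0r_neq0.
pose q := \poly_(i < size p) p`_(i + m).
have pq : p = q * 'X^m.
  apply/polyP => i; rewrite coefMXn; case: ltnP => im; first exact: p0.
  rewrite coef_poly; case: ltnP => ip; first by rewrite subnK.
  by rewrite nth_default// (leq_trans ip)// leq_subr.
rewrite pq hornerM hornerXn magM magX zt exprMn.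
have qb : (1 - t) * (mag q.[z] * r ^+ m) <= S.
  have h1 : mag q.[z] * r ^+ m <= \sum_(i < size p) S * t ^+ i.
    rewrite horner_poly mulrC; apply: le_trans (ler_wpM2l _ (mag_sum _ _ _)) _;
      first exact: exprn_ge0 (ltW r0).
    rewrite mulr_sumr; apply: ler_sum => i _.
    rewrite magM magX zt exprMn.
    have := @coef_bound R p r S (i + m) (ltW r0) pS.
    rewrite exprD => h; have ti := exprn_ge0 i t0.
    rewrite [leLHS](_ : _ = mag p`_(i + m) * (r ^+ i * r ^+ m) * t ^+ i); last by ring.
    exact: ler_wpM2r.
  have h2 : (1 - t) * \sum_(i < size p) t ^+ i = 1 - t ^+ size p.
    by rewrite -[in RHS](expr1n _ (size p)) -opprB mulNr -subrX1 expr1n opprB.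
  have t1' : 0 <= 1 - t by rewrite subr_ge0 ltW.
  apply: le_trans (ler_wpM2l t1' h1) _; rewrite -mulr_sumr mulrCA h2.
  by rewrite ler_piMr// gerBl exprn_ge0.
have tm := exprn_ge0 m t0.
rewrite [leLHS](_ : _ = (1 - t) * (mag q.[z] * r ^+ m) * t ^+ m); last by ring.
exact: ler_wpM2r.
Qed.

(** A form of the Schwarz lemma.  The factor 1 - mag z / r is the price for deriving it from
    coefficient bounds; it is harmless since only the order in mag z and the limit for large m are
    used. *)
Lemma vord_bound r m u (S : R) : 0 < r -> vord r m u ->
  (forall z, mag z <= r -> mag (u z) <= S) ->
  forall z, mag z < r -> (1 - mag z / r) * mag (u z) <= S * (mag z / r) ^+ m.
Proof.
move=> r0 Hu uS z zr.
have t0 : 0 <= mag z / r by rewrite divr_ge0 ?mag_ge0// ltW.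
have t1 : mag z / r < 1 by rewrite ltr_pdivrMr// mul1r.
have tm0 := exprn_ge0 m t0; have tm1 : (mag z / r) ^+ m <= 1 by apply: exprn_ile1 => //; exact: ltW.
apply/ler_addgt0Pr => e e0.
have e3 : 0 < e / 3 by lra.
have [p [p0 pe]] := Hu _ e3.
have pS z' : mag z' <= r -> mag p.[z'] <= S + e / 3.
  move=> zr'; have := pe _ zr'; have := uS _ zr'.
  by have := magB (u z') (u z' - p.[z']); rewrite opprB addrC subrK; lra.
have := horner_tail r0 p0 pS zr.
have := pe z (ltW zr); have := magD (u z - p.[z]) p.[z]; rewrite subrK.
set tm := _ ^+ m in tm0 tm1 *; set t := mag z / r in t0 t1 *.
move=> h1 h2 h3.
have : (1 - t) * mag (u z) <= (1 - t) * (mag (u z - p.[z]) + mag p.[z])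
  by rewrite ler_wpM2l// subr_ge0 ltW.
have : (1 - t) * mag (u z - p.[z]) <= 1 * (e / 3) by apply: ler_pM;
  rewrite ?mag_ge0// ?subr_ge0 ?(ltW t1)// gerBl.
nra.
Qed.

Lemma vord_bigO r m u : 0 < r -> vord r m u -> exists C : R, 0 < C /\
  forall z, mag z <= r / 2 -> mag (u z) <= C * mag z ^+ m.
Proof.
move=> r0 Hu; have [S [S0 uS]] := vord_bounded Hu.
have rm : 0 < r ^+ m by exact: exprn_gt0.
exists (2 * S / r ^+ m); split; first by rewrite divr_gt0// mulr_gt0.
move=> z zr; have zr' : mag z < r by lra.
have := vord_bound r0 Hu uS zr'; rewrite expr_div_n.
have t1 : mag z / r <= 1 / 2 by rewrite ler_pdivrMr//; lra.
have -> : 2 * S / r ^+ m * mag z ^+ m = 2 * (S * (mag z ^+ m / r ^+ m))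
  by rewrite -!mulrA [_^-1 * _]mulrC.
have := mag_ge0 (u z); nra.
Qed.

(** In [vord_bound] the constant S does not depend on m, while (mag z / r) ^+ m tends to 0. *)
Lemma vord_flat r u : 0 < r -> (forall m, vord r m u) ->
  forall z, mag z < r -> u z = 0.
Proof.
move=> r0 Hu z zr; have [S [S0 uS]] := vord_bounded (Hu 0%N).
have t0 : 0 <= mag z / r by rewrite divr_ge0 ?mag_ge0// ltW.
have t1 : mag z / r < 1 by rewrite ltr_pdivrMr// mul1r.
apply: mag_eq0; apply/eqP; rewrite eq_le mag_ge0 andbT.
apply/ler_addgt0Pr => e e0; rewrite add0r.
set t := mag z / r in t0 t1 *.
have t1' : 0 < 1 - t by rewrite subr_gt0.
have e1 : 0 < e * (1 - t) / S by rewrite divr_gt0// mulr_gt0.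
have /cvgrPdist_lt/(_ _ e1)[m _ Hm] : (fun n => t ^+ n) @ \oo --> (0 : R).
  by apply: cvg_expr; rewrite ger0_norm.
have := Hm m (leqnn _); rewrite /= sub0r normrN ger0_norm ?exprn_ge0// ltr_pdivlMr// => h1.
have := vord_bound r0 (Hu m) uS zr; rewrite -/t => h2.
rewrite -(ler_pM2l t1'); apply: le_trans h2 _; rewrite mulrC; apply: le_trans (ltW h1) _.
by rewrite mulrC.
Qed.

(** u has the leading term c z^m, up to terms of order m + 1; c may be 0. *)
Definition lead r m (c : K) u := vord r m.+1 (fun z => u z - c * z ^+ m).

(** The degree m coefficients of the approximating polynomials form a Cauchy sequence, by the Cauchy
    estimate; c is their limit, and removing that term from each polynomial raises the order. *)
Lemma vord_lead r m u : 0 < r -> vord r m u ->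
  exists c, lead r m c u.
Proof.
move=> r0 Hu.
have a0 n : 0 < (n.+1%:R^-1 : R) by rewrite invr_gt0 ltr0n.
have rm : 0 < r ^+ m by exact: exprn_gt0.
have /choice[p Hp] : forall n : nat, exists p, (forall j, (j < m)%N -> p`_j = 0) /\
    forall z, mag z <= r -> mag (u z - p.[z]) <= n.+1%:R^-1.
  by move=> n; exact: Hu.
have [|c Hc] := @complex_between R (fun n => (p n)`_m) (fun n => n.+1%:R^-1 / r ^+ m).
  move=> n k; rewrite -mulrDl ler_pdivlMr// -coefB.
  apply: coef_bound; first exact: ltW.
  move=> z zr; rewrite hornerD hornerN.
  have := (Hp n).2 _ zr; have := (Hp k).2 _ zr.
  have := mag_sub (p n).[z] (u z) (p k).[z]; rewrite (magBC (p n).[z] (u z)).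
  move: (n.+1%:R^-1) (k.+1%:R^-1) => a b; lra.
exists c => e e0.
pose n := Num.bound (3 / e).
have Hn : 3 / e < n%:R by apply: archi_boundP; rewrite divr_ge0//; lra.
have Hn' : n.+1%:R^-1 *+ 3 <= e.
  rewrite -[_ *+ 3]mulr_natr ler_pdivrMl ?ltr0n//.
  rewrite ltr_pdivrMr// in Hn; apply: ltW; apply: lt_le_trans Hn _.
  by rewrite ler_wpM2r ?ler_nat// ltW.
exists (p n - (p n)`_m *: 'X^m); split => [j jm|z zr].
  rewrite coefB coefZ coefXn; have [->|jm'] := eqVneq j m; first by rewrite mulr1 subrr.
  by rewrite mulr0 subr0 (Hp n).1// ltn_neqAle jm' -ltnS.
rewrite hornerD hornerN hornerZ hornerXn.
have -> : u z - c * z ^+ m - ((p n).[z] - (p n)`_m * z ^+ m) =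
  u z - (p n).[z] + ((p n)`_m - c) * z ^+ m by ring.
apply: le_trans (magD _ _) _; rewrite magM magX.
apply: le_trans Hn'; rewrite mulrS; apply: lerD; first exact: (Hp n).2.
apply: le_trans (_ : n.+1%:R^-1 / r ^+ m *+ 2 * r ^+ m <= _); last first.
  by rewrite mulrnAl divfK// lt0r_neq0.
apply: ler_pM; rewrite ?mag_ge0 ?exprn_ge0 ?mag_ge0//.
by rewrite lerXn2r ?nnegrE ?mag_ge0 ?(ltW r0).
Qed.

(** The smallness of u is required at one point of each neighborhood of 0 only, so the lemma applies
    to functions that are controlled along a ray. *)
Lemma lead_eq0 r m u (c : K) : 0 < r -> lead r m c u ->
  (forall e d : R, 0 < e -> 0 < d -> exists z, z != 0 /\ mag z <= d /\
     mag (u z) <= e * mag z ^+ m) -> c = 0.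
Proof.
move=> r0 Hu H; apply: mag_eq0; apply/eqP; rewrite eq_le mag_ge0 andbT.
apply/ler_addgt0Pr => e e0; rewrite add0r.
have [C [C0 uC]] := vord_bigO r0 Hu.
have e2 : 0 < e / 2 by lra.
have d0 : 0 < Num.min (r / 2) (e / 2 / C).
  by rewrite lt_min divr_gt0//= divr_gt0.
have [z [z0 [zd ze]]] := H _ _ e2 d0.
move: zd; rewrite le_min => /andP[zr]; rewrite ler_pdivlMr// => zC.
have := uC _ zr; have zp := mag_gt0 z0; have zm : 0 < mag z ^+ m by exact: exprn_gt0.
have : mag c * mag z ^+ m <= mag (u z) + mag (u z - c * z ^+ m).
  by rewrite -magX -magM; have := magB (u z) (u z - c * z ^+ m); rewrite opprB addrC subrK.
rewrite exprSr -(ler_pM2r zm).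
set b := mag z ^+ m in zm ze *; set d := mag (_ - _).
move=> h1 h2; rewrite ler_pM2r// in h1.
rewrite -(ler_pM2r zm); nra.
Qed.

(** The Cauchy estimate survives the passage from polynomials to their uniform limits. *)
Lemma lead_bound r m (u : K -> K) (c : K) (S : R) : 0 < r ->
  lead r m c u -> (forall z, mag z <= r -> mag (u z) <= S) ->
  mag c * r ^+ m <= S.
Proof.
move=> r0 Hu uS; apply/ler_addgt0Pr => e e0.
have [p [p0 pe]] := Hu _ e0.
have -> : c = (p + c *: 'X^m)`_m by rewrite coefD coefZ coefXn eqxx mulr1 p0 ?add0r.
apply: coef_bound; first exact: ltW.
move=> z zr; rewrite hornerD hornerZ hornerXn.
have := pe z zr; have := uS z zr; have := magB (u z) (u z - c * z ^+ m - p.[z]).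
have -> : p.[z] + c * z ^+ m = u z - (u z - c * z ^+ m - p.[z]) by ring.
lra.
Qed.

Lemma vord_step r m u : 0 < r -> vord r m u ->
  (forall e d : R, 0 < e -> 0 < d -> exists z, z != 0 /\ mag z <= d /\
     mag (u z) <= e * mag z ^+ m) -> vord r m.+1 u.
Proof.
move=> r0 Hu H; have [c Hc] := vord_lead r0 Hu.
have c0 := lead_eq0 r0 Hc H; move: Hc; rewrite c0.
by apply: vord_ext => z _; rewrite mul0r subr0.
Qed.

Lemma vord_littleo r k u : 0 < r -> vord r 0 u ->
  (forall e : R, 0 < e -> exists d : R, 0 < d /\
     forall z, mag z <= d -> mag (u z) <= e * mag z ^+ k) -> vord r k.+1 u.
Proof.
move=> r0 Hu H.
suff Hm m : (m <= k.+1)%N -> vord r m u by exact: Hm.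
elim: m => // m IH; rewrite ltnS => mk; apply: vord_step => //; first by apply: IH; exact: leqW.
move=> e d e0 d0; have [d' [d'0 Hd]] := H _ e0.
pose t := Num.min 1 (Num.min d d').
have t0 : 0 < t by rewrite !lt_min ltr01 d0 d'0.
have mt : mag (t%:C%C : K) = t by rewrite mag_real ger0_norm// ltW.
exists (t%:C)%C; rewrite mt; split; first by apply/eqP => /complexI t00; rewrite t00 ltxx in t0.
split; first by rewrite /t !ge_min lexx orbT.
apply: le_trans (Hd _ _) _; first by rewrite mt /t !ge_min lexx !orbT.
rewrite mt ler_wpM2l ?(ltW e0)// ler_wiXn2l//; first exact: ltW.
by rewrite /t ge_min lexx.
Qed.

(** Identity theorem: zeros on a real interval starting at 0 raise the order indefinitely. *)
Lemma vord_zeros r u (eta : R) : 0 < r -> 0 < eta -> vord r 0 u ->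
  (forall t : R, 0 < t -> t < eta -> u (t%:C)%C = 0) ->
  forall z, mag z < r -> u z = 0.
Proof.
move=> r0 eta0 Hu H; apply: vord_flat => //.
elim=> // m IH; apply: vord_step => // e d e0 d0.
pose t := Num.min (eta / 2) d.
have t0 : 0 < t by rewrite !lt_min d0 andbT; lra.
have mt : mag (t%:C%C : K) = t by rewrite mag_real ger0_norm// ltW.
exists (t%:C)%C; rewrite mt; split; first by apply/eqP => /complexI t00; rewrite t00 ltxx in t0.
split; first by rewrite /t !ge_min lexx orbT.
rewrite H// ?mag0 ?mulr_ge0 ?exprn_ge0 ?(ltW e0) ?(ltW t0)//.
by rewrite /t gt_min; apply/orP; left; lra.
Qed.

Lemma vord_shift r r' (c : K) u : mag c + r' <= r -> vord r 0 u ->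
  vord r' 0 (fun z => u (c + z)).
Proof.
move=> cr Hu e e0; have [p [_ pe]] := Hu e e0.
exists (p \Po ('X + c%:P)); split => // z zr.
rewrite horner_comp !hornerE [z + c]addrC; apply: pe.
by have := magD c z; lra.
Qed.

Lemma vord_dilate r r' m (l : K) u : mag l * r' <= r -> vord r m u ->
  vord r' m (fun z => u (l * z)).
Proof.
move=> lr Hu e e0; have [p [p0 pe]] := Hu e e0.
exists (\poly_(i < size p) (p`_i * l ^+ i)); split => [j jm|z zr].
  by rewrite coef_poly; case: ifP => // _; rewrite p0// mul0r.
rewrite (_ : _.[z] = p.[l * z]); last first.
  by rewrite horner_poly horner_coef; apply: eq_bigr => i _; rewrite exprMn mulrA.
by apply: pe; rewrite magM; have := mag_ge0 l; nra.
Qed.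

Lemma vord_conj r m u : vord r m u -> vord r m (fun z => Num.conj (u (Num.conj z))).
Proof.
move=> Hu e e0; have [p [p0 pe]] := Hu e e0.
exists (map_poly Num.conj p); split => [j jm|z zr].
  by rewrite coef_map/= p0// conjC0.
rewrite -{2}[z]conjCK horner_map -rmorphB mag_conj; apply: pe.
by rewrite mag_conj.
Qed.

End Vord.

(** * Complex differentiable functions are uniform limits of polynomials *)

Section Disc.
Variable R : realType.
Notation K := (CC R).

(** Compactness of the closed disc: a property that holds locally with some radius holds with one
    common radius. *)
Lemma disc_uniform (rho : R) (P : R -> K -> Prop) :
  (forall d d' w, d' <= d -> P d w -> P d' w) ->
  (forall w0, mag w0 <= rho -> exists d, 0 < d /\ forall w, mag (w - w0) < d -> P d w) ->
  exists d, 0 < d /\ forall w, mag w <= rho -> P d w.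
Proof.
move=> Pd Ploc.
pose A : set (R * R) := `[- rho, rho]%classic `*` `[- rho, rho]%classic.
have cA : compact A by apply: compact_setX; exact: segment_compact.
pose Q (d : R) (x : R * R) := 0 < d /\ (mag ((x.1 +i* x.2)%C : K) <= rho -> P d (x.1 +i* x.2)%C).
have cov : forall x, A x -> \forall x' \near x & d \near (0 : R)^'+, Q d x'.
  move=> [x0 y0] _; pose w0 : K := (x0 +i* y0)%C.
  suff [d [d0 Hd]] : exists d, 0 < d /\ forall w, mag (w - w0) < d -> mag w <= rho -> P d w.
    exists (ball (x0, y0) (d / 2), [set d' | 0 < d' < d]) => /=.
      split; first by apply: nbhsx_ballx; lra.
      near=> d'; apply/andP; split; near: d'; first exact: nbhs_right_gt.
      exact: nbhs_right_lt.
    move=> [[x y] d'] /= [[bx bypf] /andP[d'0 d'd]]; split => // wr.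
    apply: (@Pd d); first exact: ltW.
    apply: Hd => //; apply: le_lt_trans (mag_ReIm _) _ => /=.
    move: bx bypf; rewrite /ball /= => bx bypf.
    by rewrite (splitr d) [`|x - _|]distrC [`|y - _|]distrC; exact: ltrD.
  have [w0r|w0r] := leP (mag w0) rho.
    by have [d [d0 Hd]] := Ploc _ w0r; exists d; split => // w /Hd.
  exists (mag w0 - rho); split; first lra.
  move=> w wd wr; have := magD (w0 - w) w; rewrite subrK magBC; lra.
have cov' : \forall d \near (0 : R)^'+, A `<=` Q d.
  by move/compact_near_coveringP: cA; apply.
have [d Hd] : exists d, A `<=` Q d by exact: (@filter_ex _ ((0 : R)^'+) _ _ cov').
have Ad (w : K) : mag w <= rho -> A (complex.Re w, complex.Im w).
  move=> wr; split; rewrite /= in_itv/= -ler_norml; apply: le_trans wr.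
    exact: Re_le_mag.
  exact: Im_le_mag.
have [r0|r0] := leP 0 rho; last first.
  by exists 1; split => // w wr; have := mag_ge0 w; lra.
have d0 : 0 < d by apply: (Hd _ (Ad 0 _)).1; rewrite mag0.
exists d; split => // w wr.
by have [_] := Hd _ (Ad _ wr); case: w wr => x y /= wr /(_ wr).
Unshelve. all: by end_near. Qed.

(** Complex differentiability at all points of a disc, with one radius d for all of them. *)
Definition udiff (rho : R) (g : K -> K) := forall e : R, 0 < e -> exists d : R, 0 < d /\
  forall w, mag w <= rho -> exists a : K, forall w', mag (w' - w) < d ->
    mag (g w' - g w - a * (w' - w)) <= e * mag (w' - w).

(** The polynomial of degree < N that interpolates g at the points rc om^k of the circle of radius
    rho is close to g inside the circle.  Its value at z is, up to the factor (1 - q^N) / N, the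
    discrete Cauchy integral [phi 1], while the value of g itself corresponds to [phi 0]: between
    them, the nodes move along segments from z to the circle.  The derivative of [phi] in s is
    the sum of g'(W s k) rc om^k, which is proportional to a Riemann sum for the integral of dg over a
    closed curve and so almost telescopes to 0.  This is the homotopy proof of Cauchy's formula with
    integrals replaced by sums over roots of unity. *)
Section Interp.
Variables (g : K -> K) (rho : R) (N : nat).
Hypothesis rho0 : 0 < rho.
Hypothesis N1 : (1 < N)%N.
Local Notation om := (root_unity R N).
Let rc : K := (rho%:C)%C.

Let N0 : (0 < N)%N. Proof. exact: ltnW. Qed.
Let prim : N.-primitive_root om. Proof. exact: root_unity_prim. Qed.
Let omN0 : om != 0. Proof. by apply: contraTneq isT => o0; have := mag_root_unity R N;
  rewrite o0 mag0 => /esym/eqP; rewrite oner_eq0. Qed.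
Let om1 : om - 1 != 0.
Proof. by rewrite subr_eq0 -[om]expr1 -(prim_order_dvd prim) dvdn1 neq_ltn N1 orbT. Qed.
Let rcm : mag rc = rho. Proof. by rewrite mag_real ger0_norm// ltW. Qed.
Let rc0 : rc != 0. Proof. by apply: contraTneq rho0 => r0; rewrite -rcm r0 mag0 ltxx. Qed.

Definition interp_poly : {poly K} := \poly_(m < N)
   (N%:R^-1 * \sum_(k < N) g (rc * om ^+ k) * om ^+ ((N - m) * k) * rc ^- m).

Variable z : K.
Hypothesis zr : mag z < rho.

Let b k := rc * om ^+ k - z.
Let W (s : R) k := z + (s%:C)%C * b k.
Let phi s := \sum_(k < N) g (W s k) * (rc * om ^+ k / b k).
Let q := z / rc.

Let b0 k : b k != 0.
Proof.
rewrite subr_eq0; apply: contraTneq zr => <-.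
by rewrite magM magX mag_root_unity expr1n mulr1 rcm ltxx.
Qed.

Let bmag k : mag (b k) <= 2 * rho.
Proof.
apply: le_trans (magB _ _) _; rewrite magM magX mag_root_unity expr1n mulr1 rcm.
by have := zr; lra.
Qed.

Let Wdisc s k : 0 <= s <= 1 -> mag (W s k) <= rho.
Proof.
move=> /andP[s0 s1].
have -> : W s k = ((1 - s)%:C)%C * z + (s%:C)%C * (rc * om ^+ k).
  by rewrite /W /b rmorphB rmorph1; ring.
apply: le_trans (magD _ _) _; rewrite !magM magX mag_root_unity expr1n mulr1 rcm.
rewrite !mag_real !ger0_norm//; last by rewrite subr_ge0.
have : (1 - s) * mag z <= (1 - s) * rho by apply: ler_wpM2l; [rewrite subr_ge0|exact: ltW].
lra.
Qed.

(** The finite geometric series of ratio q / om^k. *)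
Let kernel_sum k : (1 - q ^+ N) * (rc * om ^+ k / b k)
  = \sum_(m < N) q ^+ m * om ^+ ((N - m) * k).
Proof.
pose y := om ^+ k.
have y0 : y != 0 by rewrite expf_neq0.
have yN : y ^+ N = 1 by rewrite /y exprAC (prim_expr_order prim) expr1n.
under eq_bigr => m _.
  have -> : q ^+ m * om ^+ ((N - m) * k) = (q / y) ^+ m.
    rewrite [(_ * k)%N]mulnC exprM -/y [in RHS]expr_div_n expfB_cond ?yN ?mul1r//.
    by rewrite (negPf y0)/= add0n ltnW.
  over.
rewrite -/y; apply: (mulIf (b0 k)); rewrite mulrA divfK ?b0//.
have -> : b k = rc * y * (1 - q / y).
  by rewrite /b -/y /q; field; rewrite rc0 y0.
rewrite [RHS]mulrC -mulrA [RHS](_ : _ = (1 - (q / y) ^+ N) * (rc * y)); last first.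
  by rewrite -[in RHS]opprB subrX1; ring.
by rewrite [in RHS]expr_div_n yN divr1.
Qed.

Let interp_eval : N%:R * (interp_poly).[z] = (1 - q ^+ N) * phi 1.
Proof.
rewrite /phi mulr_sumr /interp_poly horner_poly mulr_sumr.
under [RHS]eq_bigr => k _.
  rewrite mulrCA kernel_sum mulr_sumr /W rmorph1 mul1r /b [z + _]addrC subrK; over.
rewrite exchange_big/=; apply: eq_bigr => m _.
rewrite !mulrA divff ?pnatr_eq0 -?lt0n// mul1r mulr_suml.
apply: eq_bigr => k _; rewrite /q expr_div_n; ring.
Qed.

Let phi0 : (1 - q ^+ N) * phi 0 = N%:R * g z.
Proof.
rewrite /phi mulr_sumr.
under eq_bigr => k _ do rewrite mulrCA kernel_sum /W rmorph0 mul0r addr0.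
rewrite -mulr_sumr exchange_big/= mulrC; congr (_ * _).
under eq_bigr => m _ do rewrite -mulr_sumr.
rewrite (bigD1 (Ordinal N0))//= subn0 expr0 mul1r [X in _ + X]big1 ?addr0.
  under eq_bigr => k _ do rewrite exprM (prim_expr_order prim) expr1n.
  by rewrite sumr_const card_ord.
move=> m m0; under eq_bigr => k _ do rewrite exprM.
rewrite sum_root_unity// ifN ?mulr0//.
apply/negP => /dvdn_leq; rewrite subn_gt0 ltn_ord => /(_ isT).
have mN := ltn_ord m; have : (0 < m)%N by rewrite lt0n; apply: contra m0 => /eqP m0;
  apply/eqP/val_inj.
by rewrite [(N <= _)%N]leqNgt ltn_subrL N0 => ->.
Qed.

Variables (e d : R).
Hypothesis Hd : forall w, mag w <= rho -> exists a : K, forall w', mag (w' - w) < d ->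
    mag (g w' - g w - a * (w' - w)) <= e * mag (w' - w).
Hypothesis Nd : rho * mag (om - 1) < d.

(** Two successive nodes W s k and W s k.+1 are within d of each other, so the sum of the a k times
    their differences telescopes up to an error e; this bounds the sum that multiplies s' - s in the
    increment of [phi].  The hypothesis 0 < s is needed to divide by s. *)
Let phi_step s s' : 0 < s <= 1 -> `|s' - s| * (2 * rho) < d ->
  mag (phi s' - phi s) <= `|s' - s| * (N%:R * (2 * e * rho)).
Proof.
move=> /andP[s0 s1] ss'.
have sc0 : mag ((s%:C)%C : K) = s by rewrite mag_real ger0_norm// ltW.
have /choice[a Ha] : forall k : nat, exists a, forall w', mag (w' - W s k) < d ->
    mag (g w' - g (W s k) - a * (w' - W s k)) <= e * mag (w' - W s k).
  by move=> k; apply: Hd; rewrite Wdisc// (ltW s0).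
have asum : mag (\sum_(k < N) a k * (rc * om ^+ k)) <= N%:R * (e * rho).
  have dW k : W s k.+1 - W s k = (s%:C)%C * (rc * om ^+ k) * (om - 1).
    by rewrite /W /b exprS; ring.
  have mdW k : mag (W s k.+1 - W s k) = s * rho * mag (om - 1).
    by rewrite dW !magM magX mag_root_unity expr1n mulr1 rcm sc0.
  pose E k := g (W s k.+1) - g (W s k) - a k * (W s k.+1 - W s k).
  have hE k : mag (E k) <= e * (s * rho * mag (om - 1)).
    rewrite -(mdW k); apply: Ha; rewrite mdW; apply: le_lt_trans Nd.
    by rewrite -mulrA ler_piMl// mulr_ge0 ?mag_ge0// ltW.
  (* The increments of g cancel around the closed polygon, which leaves the sum of the a k. *)
have tele : \sum_(k < N) E k = - ((s%:C)%C * (om - 1)) * \sum_(k < N) a k * (rc * om ^+ k).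
    rewrite sumrB -(big_mkord xpredT (fun k => g (W s k.+1) - g (W s k))) telescope_sumr//.
    rewrite /W /b (prim_expr_order prim) expr0 subrr sub0r mulr_sumr -sumrN.
    by apply: eq_bigr => k _; rewrite dW; ring.
  have p0 : 0 < s * mag (om - 1) by rewrite mulr_gt0// mag_gt0.
  rewrite -(ler_pM2l p0).
  have := congr1 (@mag R K) tele; rewrite magM magN magM sc0 => <-.
  apply: le_trans (mag_sum _ _ _) _.
  apply: (@le_trans _ _ (\sum_(k < N) e * (s * rho * mag (om - 1)))).
    by apply: ler_sum => k _; exact: hE.
  by rewrite sumr_const card_ord -[_ *+ N]mulr_natl le_eqVlt; apply/orP; left; apply/eqP; ring.
pose F k := g (W s' k) - g (W s k) - a k * (W s' k - W s k).
have dW k : W s' k - W s k = ((s' - s)%:C)%C * b k by rewrite /W rmorphB/=; ring.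
have mdW k : mag (W s' k - W s k) = `|s' - s| * mag (b k) by rewrite dW magM mag_real.
have hF k : mag (F k * (rc * om ^+ k / b k)) <= e * `|s' - s| * rho.
  have bk0 := mag_gt0 (b0 k).
  rewrite !magM magX mag_root_unity expr1n mulr1 rcm magV mulrA -ler_pdivlMr ?invr_gt0//.
  rewrite invrK -!mulrA [rho * _]mulrC mulrA mulrA ler_wpM2r// ?(ltW rho0)// -mulrA -mdW.
  apply: Ha; rewrite mdW; apply: le_lt_trans ss'.
  by rewrite ler_wpM2l.
have -> : phi s' - phi s = ((s' - s)%:C)%C * \sum_(k < N) a k * (rc * om ^+ k)
    + \sum_(k < N) F k * (rc * om ^+ k / b k).
  rewrite mulr_sumr -big_split/= -sumrB; apply: eq_bigr => k _.
  by rewrite /F dW; field; exact: b0.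
apply: le_trans (magD _ _) _; rewrite magM mag_real.
have := mag_sum (index_enum 'I_N) xpredT (fun k => F k * (rc * om ^+ k / b k)).
have : \sum_(k < N) mag (F k * (rc * om ^+ k / b k)) <= N%:R * (e * `|s' - s| * rho).
  rewrite mulr_natl -[X in _ *+ X]card_ord -sumr_const.
  by apply: ler_sum => k _; exact: hF.
have : `|s' - s| * mag (\sum_(k < N) a k * (rc * om ^+ k)) <= `|s' - s| * (N%:R * (e * rho)).
  exact: ler_wpM2l.
lra.
Qed.

(** Subdivision of [0, 1] into steps to which [phi_step] applies.  The steps go down, from
    j.+1 / M to j / M, because [phi_step] starts at a positive s. *)
Let phi_total : 0 < d -> mag (phi 1 - phi 0) <= N%:R * (2 * e * rho).
Proof.
move=> d0.
pose M := (Num.bound (2 * rho / d)).+1.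
have HM : 2 * rho / d < M%:R.
  apply: lt_le_trans (archi_boundP _) _; first by rewrite divr_ge0//; have := rho0; lra.
  by rewrite ler_nat.
have M0 : 0 < (M%:R : R) by rewrite ltr0n.
have step : 1 / M%:R * (2 * rho) < d.
  by rewrite mul1r mulrC ltr_pdivrMr// [d * _]mulrC -ltr_pdivrMr.
suff H j : (j <= M)%N -> mag (phi (j%:R / M%:R) - phi 0) <= j%:R / M%:R * (N%:R * (2 * e * rho)).
  by have := H M (leqnn _); rewrite divff ?lt0r_neq0// mul1r.
elim: j => [_|j IH jM]; first by rewrite !mul0r subrr mag0.
have dj : j%:R / M%:R - j.+1%:R / M%:R = - (1 / M%:R) :> R by rewrite -mulrBl -addn1 natrD; field;
  rewrite lt0r_neq0.
have := @phi_step (j.+1%:R / M%:R) (j%:R / M%:R).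
rewrite dj normrN ger0_norm ?divr_ge0 ?(ltW M0)//.
have -> : 0 < (j.+1%:R / M%:R : R) <= 1.
  by rewrite divr_gt0 ?ltr0n//= ler_pdivrMr// mul1r ler_nat.
move=> /(_ isT step).
move=> h1; have h2 := IH (ltnW jM).
have h3 := mag_sub (phi (j.+1%:R / M%:R)) (phi (j%:R / M%:R)) (phi 0).
rewrite [X in _ <= X * _](_ : _ = 1 / M%:R + j%:R / M%:R); last by move: dj; lra.
rewrite mulrDl; apply: le_trans (lerD h1 h2).
by rewrite [mag (phi (j%:R / M%:R) - phi (j.+1%:R / _))]magBC.
Qed.

Lemma interp_close : 0 < d -> mag (g z - (interp_poly).[z]) <= 4 * e * rho.
Proof.
move=> d0; have NR : 0 < (N%:R : R) by rewrite ltr0n.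
rewrite -(ler_pM2l NR) -[N%:R in leLHS](mag_nat R) -magM mulrBr interp_eval -phi0 -mulrBr magM
  [mag (phi 0 - _)]magBC.
have := phi_total d0; have := mag_ge0 (phi 1 - phi 0).
have q1 : mag q <= 1 by rewrite /q magM magV rcm ler_pdivrMr ?mul1r ?ltW.
have : mag (1 - q ^+ N) <= 2.
  apply: le_trans (magB _ _) _; rewrite mag1 magX.
  have : mag q ^+ N <= 1 by apply: exprn_ile1 => //; exact: mag_ge0.
  lra.
have := mag_ge0 (1 - q ^+ N); nra.
Qed.

End Interp.

Lemma udiff_vord (r rho : R) g : 0 < r -> r < rho -> udiff rho g -> vord r 0 g.
Proof.
move=> r0 rrho Hg e e0.
have rho0 : 0 < rho by lra.
have e1 : 0 < e / (4 * rho) by rewrite divr_gt0//; lra.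
have [d [d0 Hd]] := Hg _ e1.
have [|N0 HN] := @root_unity_near1 R (d / rho); first by rewrite divr_gt0.
exists (interp_poly g rho (maxn N0 1).+1); split => // z zr.
have -> : e = 4 * (e / (4 * rho)) * rho by field; rewrite lt0r_neq0.
have N1 : (1 < (maxn N0 1).+1)%N by rewrite ltnS leq_max leqnn orbT.
have Nd : rho * mag (root_unity R (maxn N0 1).+1 - 1) < d.
  by rewrite mulrC -ltr_pdivlMr// HN// ltnS leq_maxl.
exact: (interp_close rho0 N1 (le_lt_trans zr rrho) Hd Nd d0).
Qed.

(** Strict differentiability: both endpoints vary.  Plain differentiability would not give one
    radius for all points of a neighborhood. *)
Definition strict_cdiff (g : K -> K) (w0 : K) := exists a : K,
  forall e : R, 0 < e -> exists d : R, 0 < d /\ forall w w',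
  mag (w - w0) < d -> mag (w' - w0) < d -> mag (g w' - g w - a * (w' - w)) <= e * mag (w' - w).

Lemma strict_udiff rho g : (forall w0, mag w0 <= rho -> strict_cdiff g w0) -> udiff rho g.
Proof.
move=> H e e0.
apply: (@disc_uniform rho (fun d w => exists a : K, forall w', mag (w' - w) < d ->
    mag (g w' - g w - a * (w' - w)) <= e * mag (w' - w))).
  by move=> d d' w dd' [a Ha]; exists a => w' w'd; apply: Ha; exact: lt_le_trans dd'.
move=> w0 /H[a /(_ _ e0)[d [d0 Hd]]]; exists (d / 2); split; first lra.
move=> w ww; exists a => w' w'w; apply: Hd; first lra.
by have := mag_sub w' w w0; lra.
Qed.

End Disc.

(** * Differentiability in terms of real-valued norms *)

Section DiffEps.
Variables (K0 : numFieldType) (V W : normedModType K0).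

Lemma diff_near (f : V -> W) x : differentiable f x -> forall e, 0 < e ->
  \forall h \near (0 : V), `|f (h + x) - f x - 'd f x h| <= e * `|h|.
Proof.
move=> /diff_locally /eqaddoP df e e0; have := df _ e0.
by apply: filterS => h /=; rewrite opprD addrA.
Qed.

(** The converse of [diff_near] for a candidate differential that is known to be linear and
    continuous. *)
Lemma near_diff (f : V -> W) x (df : {linear V -> W}) : continuous df ->
  (forall e, 0 < e -> \forall h \near (0 : V), `|f (h + x) - f x - df h| <= e * `|h|) ->
  differentiable f x.
Proof.
move=> dfc H.
have E : f \o shift x = cst (f x) + df +o_ 0 id.
  apply/eqaddoP => e e0; have := H _ e0.
  by apply: filterS => h /=; rewrite opprD addrA.
by apply/diff_locallyP; rewrite (diff_unique dfc E).
Qed.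

End DiffEps.

Lemma mag_lt (R : realType) (V : normedModType (CC R)) (x : V) (e : R) :
  (mag x < e) = (`|x| < (e%:C)%C :> CC R).
Proof. by rewrite -magE ltcR. Qed.

Section MagTop.
Variable R : realType.
Notation K := (CC R).
Variables (V W : normedModType K).

Lemma Re_gt0 (e : K) : 0 < e -> 0 < complex.Re e /\ e = ((complex.Re e)%:C)%C.
Proof.
move=> e0; have E : ((complex.Re e)%:C)%C = e := RRe_real (gtr0_real e0).
by split => //; rewrite -ltcR E.
Qed.

Lemma near0_mag (P : V -> Prop) : (\forall h \near (0 : V), P h) <->
  exists d : R, 0 < d /\ forall h, mag h < d -> P h.
Proof.
split.
  move=> /nbhs_norm0P[e /= e0 H]; have [r0 er] := Re_gt0 e0.
  by exists (complex.Re e); split => // h hr; apply: H; rewrite /= er -mag_lt.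
move=> [d [d0 H]]; apply/nbhs_norm0P; exists (d%:C)%C => /=; first by rewrite ltcR.
by move=> h /=; rewrite -mag_lt => /H.
Qed.

Lemma near_mag (P : V -> Prop) x : (\forall y \near x, P y) <->
  exists d : R, 0 < d /\ forall y, mag (y - x) < d -> P y.
Proof.
split.
  move=> /nbhs_normP[e /= e0 H]; have [r0 er] := Re_gt0 e0.
  exists (complex.Re e); split => // h hr; apply: H.
  by rewrite /= er -mag_lt magBC.
move=> [d [d0 H]]; apply/nbhs_normP; exists (d%:C)%C => /=; first by rewrite ltcR.
by move=> h /=; rewrite -mag_lt magBC => /H.
Qed.

Lemma near0_realify (P : V -> Prop) : (\forall h \near (0 : realify R V), P h) <->
  exists d : R, 0 < d /\ forall h, mag h < d -> P h.
Proof.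
split.
  by move=> /nbhs_norm0P[e /= e0 H]; exists e; split => // h he; apply: H.
by move=> [d [d0 H]]; apply/nbhs_norm0P; exists d.
Qed.

Lemma open_mag (U : set V) x : open U -> U x ->
  exists d : R, 0 < d /\ forall y, mag (y - x) < d -> U y.
Proof. by move=> oU Ux; apply/near_mag; exact: open_nbhs_nbhs. Qed.

Lemma continuous_mag (g : V -> W) x : {for x, continuous g} <->
  forall e : R, 0 < e -> exists d : R, 0 < d /\ forall y, mag (y - x) < d -> mag (g y - g x) < e.
Proof.
split.
  move=> /cvgrPdist_lt gx e e0.
  have /near_mag[d [d0 H]] := gx (e%:C)%C ltac:(by rewrite ltcR).
  by exists d; split => // y /H; rewrite -mag_lt magBC.
move=> H; apply/cvgrPdist_lt => e e0; have [r0 er] := Re_gt0 e0.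
apply/near_mag; have [d [d0 Hd]] := H _ r0.
by exists d; split => // y /Hd; rewrite er -mag_lt magBC.
Qed.

Lemma cdiff_mag (f : V -> W) x : differentiable f x -> forall e : R, 0 < e ->
  exists d : R, 0 < d /\ forall h, mag h < d -> mag (f (h + x) - f x - 'd f x h) <= e * mag h.
Proof.
move=> fx e e0; have := diff_near fx (_ : 0 < (e%:C)%C);
  rewrite ltcR => /(_ e0) /near0_mag[d [d0 H]].
exists d; split => // h /H; rewrite -!magE -rmorphM lecR; exact.
Qed.

Lemma rdiff_mag (f : V -> W) x : real_differentiable f x -> forall e : R, 0 < e ->
  exists d : R, 0 < d /\ forall h, mag h < d ->
    mag (f (h + x) - f x - real_diff f x h) <= e * mag h.
Proof.
move=> fx e e0; have /near0_realify[d [d0 H]] := diff_near fx e0.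
by exists d; split => // h /H.
Qed.

Lemma real_diffD (f : V -> W) x a b :
  real_diff f x (a + b) = real_diff f x a + real_diff f x b.
Proof. by rewrite /real_diff; exact: linearD. Qed.

Lemma real_diffZ (f : V -> W) x (a : R) b :
  real_diff f x (((a%:C)%C : K) *: b) = ((a%:C)%C : K) *: real_diff f x b.
Proof. exact: (linearZ_LR ('d (f : realify R V -> realify R W) (x : realify R V)) a b). Qed.

Lemma real_diffB (f : V -> W) x a b :
  real_diff f x (a - b) = real_diff f x a - real_diff f x b.
Proof. by rewrite /real_diff; exact: linearB. Qed.

Lemma real_diff0 (f : V -> W) x : real_diff f x 0 = 0.
Proof. by rewrite /real_diff; exact: linear0. Qed.

End MagTop.

Section Coordinates.
Variable R : realType.
Notation K := (CC R).

Lemma mag_rV_lt n (x : 'rV[K]_n) (e : R) : 0 < e ->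
  (mag x < e <-> forall i, mag (x 0 i) < e).
Proof.
move=> e0; have ec0 : 0 < (e%:C)%C :> K by rewrite ltcR.
have E : ball (0 : 'rV[K]_n) ((e%:C)%C : K) x <-> mag x < e.
  by rewrite mx_norm_ball /ball_ /= sub0r normrN mag_lt.
rewrite -E; split.
  move=> [_ H] i; have := H 0 i; rewrite mxE -ball_normE /= sub0r normrN mag_lt; exact.
move=> H; split => // i j; rewrite mxE -ball_normE /= sub0r normrN -mag_lt ord1; exact: H.
Qed.

Lemma mag_coord n (x : 'rV[K]_n) i : mag (x 0 i) <= mag x.
Proof.
apply/ler_addgt0Pr => e e0.
have h : 0 < mag x + e by have := mag_ge0 x; lra.
by apply: ltW; apply: (mag_rV_lt x h).1; lra.
Qed.

Lemma mag_rV_le n (x : 'rV[K]_n) (B : R) : 0 <= B -> (forall i, mag (x 0 i) <= B) -> mag x <= B.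
Proof.
move=> B0 H; apply/ler_addgt0Pr => e e0.
have h : 0 < B + e by lra.
by apply/ltW/(mag_rV_lt x h).2 => i; have := H i; lra.
Qed.

Lemma mag_pair_lt (V W : normedModType K) (x : V * W) (e : R) :
  (mag x < e <-> mag x.1 < e /\ mag x.2 < e).
Proof.
have E : ball (0 : V * W) ((e%:C)%C : K) x <-> mag x < e.
  by rewrite ball_prod_normE /ball_ /= sub0r normrN mag_lt.
rewrite -E; split.
  by move=> [/=]; rewrite -!ball_normE /= !sub0r !normrN -!mag_lt.
by move=> [a b]; split; rewrite -!ball_normE /= !sub0r !normrN -!mag_lt.
Qed.

Lemma mag_fst (V W : normedModType K) (x : V * W) : mag x.1 <= mag x.
Proof.
apply/ler_addgt0Pr => e e0.
have [|h _] := (mag_pair_lt x (mag x + e)).1; first by lra.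
exact: ltW.
Qed.

Lemma mag_snd (V W : normedModType K) (x : V * W) : mag x.2 <= mag x.
Proof.
apply/ler_addgt0Pr => e e0.
have [|_ h] := (mag_pair_lt x (mag x + e)).1; first by lra.
exact: ltW.
Qed.

(** Finite dimension over the reals, as a finite spanning family with linearly bounded
    coordinates. *)
Definition real_frame (V : normedModType K) := exists (I : finType) (b : I -> V)
  (c : I -> V -> R) (C : R), 0 < C /\ (forall v, v = \sum_i ((c i v)%:C)%C *: b i) /\
  (forall i v, `|c i v| <= C * mag v).

(** Finite dimension over the reals of a target space, as finitely many real functionals of norm at
    most 1 that control the norm; the mean value theorem is applied to each of them. *)
Definition real_coframe (W : normedModType K) := exists (I : finType) (l : I -> W -> R)
  (C : R), 0 < C /\ [/\ (forall i u v, l i (u + v) = l i u + l i v),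
  (forall i (a : R) v, l i (((a%:C)%C : K) *: v) = a * l i v),
  (forall i v, `|l i v| <= mag v) &
  (forall v (B : R), 0 <= B -> (forall i, `|l i v| <= B) -> mag v <= C * B)].

Lemma complex_ReIm (x : K) : x = ((complex.Re x)%:C)%C + ((complex.Im x)%:C)%C * ('i)%C.
Proof. by rewrite [LHS]complexE mulrC. Qed.

Lemma coframe_K : real_coframe K.
Proof.
exists bool, (fun b x => if b then complex.Re x else complex.Im x), 2; split => //; split.
- by move=> [] [? ?] [? ?].
- by move=> [] a [x y] /=; rewrite mul0r ?subr0 ?addr0.
- by move=> [] v; [exact: Re_le_mag|exact: Im_le_mag].
- move=> v B B0 H; apply: le_trans (mag_ReIm v) _.
  by have := H true; have := H false; lra.
Qed.

Lemma coframe_rV n : real_coframe 'rV[K]_n.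
Proof.
exists ('I_n * bool)%type,
  (fun b (x : 'rV[K]_n) => if b.2 then complex.Re (x 0 b.1) else complex.Im (x 0 b.1)), 2;
    split => //; split.
- by move=> [i []] u v /=; rewrite mxE raddfD.
- by move=> [i []] a u; rewrite mxE /=; case: (u 0 i) => x y /=; rewrite mul0r ?subr0 ?addr0.
- by move=> [i []] v; apply: le_trans (mag_coord v i); [exact: Re_le_mag|exact: Im_le_mag].
- move=> v B B0 H; apply: mag_rV_le; first lra.
  move=> i; apply: le_trans (mag_ReIm _) _.
  by have := H (i, true); have := H (i, false); rewrite /=; lra.
Qed.

Lemma frame_K : real_frame K.
Proof.
exists bool, (fun b => if b then 1 else 'i%C : K),
  (fun b x => if b then complex.Re x else complex.Im x), 1; split => //; split.
  by move=> v; rewrite big_bool/= {1}[v]complex_ReIm; congr (_ + _); rewrite [RHS]mulr1.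
by move=> [] v; rewrite mul1r; [exact: Re_le_mag|exact: Im_le_mag].
Qed.

Lemma frame_rV n : real_frame 'rV[K]_n.
Proof.
exists ('I_n * bool)%type, (fun b => (if b.2 then 1 else 'i%C : K) *: delta_mx 0 b.1),
  (fun b (x : 'rV[K]_n) => if b.2 then complex.Re (x 0 b.1) else complex.Im (x 0 b.1)), 1;
    split => //; split.
  move=> v; rewrite -(pair_bigA _ (fun (i : 'I_n) (b : bool) =>
    (((if b then complex.Re (v 0 i) else complex.Im (v 0 i))%:C)%C : K) *:
      ((if b then 1 else 'i%C : K) *: delta_mx 0 i)))/=.
  rewrite {1}[v]row_sum_delta; apply: eq_bigr => i _.
  by rewrite big_bool/= !scalerA -scalerDl mulr1 -complex_ReIm.
move=> [i []] v; rewrite mul1r; apply: le_trans (mag_coord v i);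
  [exact: Re_le_mag|exact: Im_le_mag].
Qed.

Lemma frame_pair (V W : normedModType K) : real_frame V -> real_frame W -> real_frame (V * W)%type.
Proof.
move=> [I [b [c [C [C0 [cb cC]]]]]] [J [b' [c' [C' [C'0 [cb' cC']]]]]].
exists (I + J)%type, (fun i => match i with inl i => (b i, 0) | inr j => (0, b' j) end),
  (fun i v => match i with inl i => c i v.1 | inr j => c' j v.2 end), (C + C'); split; first lra.
split.
  move=> [v w]; rewrite big_sumType/=.
  have -> : \sum_i (((c i v)%:C)%C : K) *: ((b i, 0) : V * W) = (v, 0).
    rewrite {2}[v]cb; elim/big_rec2: _ => // i y1 y2 _ ->.
    by rewrite [LHS]surjective_pairing /= ?scaler0 ?addr0.
  have -> : \sum_i (((c' i w)%:C)%C : K) *: ((0, b' i) : V * W) = (0, w).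
    rewrite {2}[w]cb'; elim/big_rec2: _ => // i y1 y2 _ ->.
    by rewrite [LHS]surjective_pairing /= ?scaler0 ?addr0.
  by rewrite [RHS]surjective_pairing /= addr0 add0r.
move=> [i|j] v.
  apply: le_trans (cC _ _) _; have := mag_fst v; have := mag_ge0 v; nra.
apply: le_trans (cC' _ _) _; have := mag_snd v; have := mag_ge0 v; nra.
Qed.

End Coordinates.

(** * Strict differentiability of C^1 maps *)

Section MeanValue.
Variable R : realType.
Notation K := (CC R).

Lemma is_derive_eps (phi : R -> R) t l :
  (forall e : R, 0 < e -> exists d : R, 0 < d /\ forall h, `|h| < d ->
    `|phi (h + t) - phi t - h * l| <= e * `|h|) -> is_derive t 1 phi l.
Proof.
move=> H.
have cv : h^-1 *: (phi (h *: 1 + t) - phi t) @[h --> 0^'] --> l.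
  apply/cvgrPdist_le => e e0; have [d [d0 Hd]] := H _ e0.
  near=> h; have h0 : h != 0 by near: h; exact: nbhs_dnbhs_neq.
  have hd : `|h| < d by near: h; exact: dnbhs0_lt.
  rewrite -(ler_pM2l (_ : 0 < `|h|)) ?normr_gt0// -normrM mulrC [leRHS]mulrC.
  rewrite mulrBl distrC /GRing.scale/= mulrAC mulVf// mul1r mulr1 [l * h]mulrC.
  exact: Hd.
by apply: DeriveDef; [exact: cvgP cv|exact: cvg_lim cv].
Unshelve. all: by end_near. Qed.

Variables V W : normedModType K.

Lemma mean_value_functional (F : V -> W) (lam : W -> R) (y d : V) :
  (forall u v, lam (u + v) = lam u + lam v) ->
  (forall (a : R) v, lam (((a%:C)%C : K) *: v) = a * lam v) ->
  (forall v, `|lam v| <= mag v) ->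
  (forall t : R, 0 <= t <= 1 -> real_differentiable F (y + ((t%:C)%C : K) *: d)) ->
  exists c : R, 0 <= c <= 1 /\
    lam (F (y + d) - F y) = lam (real_diff F (y + ((c%:C)%C : K) *: d) d).
Proof.
move=> lamD lamZ lamb Fd.
have lamN v : lam (- v) = - lam v.
  by have := lamZ (-1) v; rewrite rmorphN rmorph1 scaleN1r mulN1r.
pose phi t := lam (F (y + ((t%:C)%C : K) *: d)).
pose dphi t := lam (real_diff F (y + ((t%:C)%C : K) *: d) d).
have D (t : R) : 0 <= t <= 1 -> is_derive t 1 phi (dphi t).
  move=> t01; apply: is_derive_eps => e e0.
  have md := mag_ge0 d.
  have e1 : 0 < e / (mag d + 1) by rewrite divr_gt0//; lra.
  have [dl [dl0 H]] := rdiff_mag (Fd t t01) e1.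
  exists (dl / (mag d + 1)); split; first by rewrite divr_gt0//; lra.
  move=> h; rewrite ltr_pdivlMr; last lra.
  move=> hd.
  have mh : mag (((h%:C)%C : K) *: d) = `|h| * mag d by rewrite magZ mag_real.
  have {}H := H (((h%:C)%C : K) *: d).
  have lt : mag (((h%:C)%C : K) *: d) < dl.
    by rewrite mh; apply: le_lt_trans hd; rewrite ler_wpM2l//; lra.
  have {}H := H lt.
  have -> : phi (h + t) - phi t - h * dphi t =
    lam (F (((h%:C)%C : K) *: d + (y + ((t%:C)%C : K) *: d))
     - F (y + ((t%:C)%C : K) *: d) - real_diff F (y + ((t%:C)%C : K) *: d) (((h%:C)%C : K) *: d)).
    rewrite !lamD !lamN real_diffZ lamZ /phi rmorphD scalerDl.
    by rewrite addrCA.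
  apply: le_trans (lamb _) _; apply: le_trans H _; rewrite mh.
  rewrite mulrCA [leRHS]mulrC ler_wpM2l// mulrAC ler_pdivrMr; last lra.
  by rewrite ler_wpM2l// ?(ltW e0)//; lra.
have [c c01 E] : exists2 c, c \in `[0%R, 1%R] & phi 1 - phi 0 = dphi c * (1 - 0).
  apply: MVT_segment => //.
    by move=> t; rewrite in_itv/= => /andP[t0 t1]; apply: D; rewrite !ltW.
  apply: derivable_within_continuous => t; rewrite in_itv/= => t01.
  by have [] := D t t01.
exists c; split; first by move: c01; rewrite in_itv.
move: E; rewrite /phi /dphi subr0 mulr1 rmorph1 rmorph0 scale1r scale0r addr0 => <-.
by rewrite lamD lamN.
Qed.

Definition strict_rdiff (F : V -> W) x (L : V -> W) := forall e : R, 0 < e ->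
  exists d : R, 0 < d /\ forall y y', mag (y - x) < d -> mag (y' - x) < d ->
    mag (F y' - F y - L (y' - y)) <= e * mag (y' - y).

(** Expanding a direction in the frame reduces continuity of the differential in operator norm to
    its continuity in the finitely many directions of the frame. *)
Lemma real_diff_opnorm_continuous (U : set V) (F : V -> W) x : real_frame V -> C1_open U F -> U x ->
  forall e : R, 0 < e -> exists d : R, 0 < d /\ forall y, mag (y - x) < d ->
    forall w, mag (real_diff F y w - real_diff F x w) <= e * mag w.
Proof.
move=> [I [b [c [C [C0 [cb cC]]]]]] CF Ux e e0.
pose N : R := (#|I|%:R + 1) * C.
have N0 : 0 < N by rewrite mulr_gt0// ltr_wpDl.
have e1 : 0 < e / N by rewrite divr_gt0.
have : \forall y \near x, forall i, mag (real_diff F y (b i) - real_diff F x (b i)) <= e / N.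
  apply: filter_forall => i; apply/near_mag.
  have /continuous_mag/(_ _ e1)[d [d0 H]] := (CF x Ux).2 (b i).
  by exists d; split => // y /H/ltW.
move/near_mag => [d [d0 H]]; exists d; split => // y /H Hi w.
have -> : real_diff F y w - real_diff F x w =
    \sum_i ((c i w)%:C)%C *: (real_diff F y (b i) - real_diff F x (b i)).
  have E z : real_diff F z w = \sum_i ((c i w)%:C)%C *: real_diff F z (b i).
    rewrite {1}[w]cb.
    elim/big_rec2: _ => [|i u v _ <-]; first by rewrite real_diff0.
    by rewrite real_diffD real_diffZ.
  by rewrite !E -sumrB; apply: eq_bigr => i _; rewrite scalerBr.
apply: le_trans (mag_sum _ _ _) _.
apply: (@le_trans _ _ (\sum_(i : I) C * mag w * (e / N))).
  apply: ler_sum => i _; rewrite magZ mag_real; apply: ler_pM => //; exact: mag_ge0.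
rewrite sumr_const -mulr_natl.
have -> : e * mag w = N * (mag w * (e / N)) by field; rewrite lt0r_neq0.
set T := mag w * (e / N).
have T0 : 0 <= T by rewrite mulr_ge0 ?mag_ge0// ltW.
have -> : C * mag w * (e / N) = C * T by rewrite /T -mulrA.
by rewrite /N -[leRHS]mulrA ler_wpM2r ?lerDl// mulr_ge0// ltW.
Qed.

(** The mean value theorem, applied to each functional of the coframe on the segment from y to
    y'. *)
Lemma C1_strict (U : set V) (F : V -> W) x : real_frame V -> real_coframe W ->
  open U -> C1_open U F -> U x -> strict_rdiff F x (real_diff F x).
Proof.
move=> fV [I [l [C [C0 [lD lZ lb lB]]]]] oU CF Ux e e0.
have e1 : 0 < e / C by rewrite divr_gt0.
have [d1 [d10 H1]] := real_diff_opnorm_continuous fV CF Ux e1.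
have [d2 [d20 H2]] := open_mag oU Ux.
exists (Num.min d1 d2); split; first by rewrite lt_min d10.
move=> y y'; rewrite !lt_min => /andP[y1 y2] /andP[y1' y2'].
pose d := y' - y.
have seg (t : R) : 0 <= t <= 1 -> forall d0, mag (y - x) < d0 -> mag (y' - x) < d0 ->
    mag (y + ((t%:C)%C : K) *: d - x) < d0.
  move=> /andP[t0 t1] d0 a b.
  have -> : y + ((t%:C)%C : K) *: d - x =
    (((1 - t)%:C)%C : K) *: (y - x) + ((t%:C)%C : K) *: (y' - x).
    have E : y' - x - (y - x) = d by rewrite opprB addrA subrK.
    rewrite -E scalerBr rmorphB rmorph1 scalerBl scale1r addrAC -[RHS]addrA.
    by congr (_ + _); rewrite addrC.
  apply: le_lt_trans (magD _ _) _; rewrite !magZ !mag_real !ger0_norm//; last lra.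
  move: a b; set m1 := mag _; set m2 := mag _ => a b.
  have M : Num.max m1 m2 < d0 by rewrite gt_max a b.
  have M1 : m1 <= Num.max m1 m2 by rewrite le_max lexx.
  have M2 : m2 <= Num.max m1 m2 by rewrite le_max lexx orbT.
  apply: le_lt_trans M; nra.
rewrite (_ : e = C * (e / C)); last by rewrite mulrCA divff ?mulr1// lt0r_neq0.
rewrite -mulrA; apply: lB; first by rewrite mulr_ge0 ?mag_ge0// ltW.
move=> i.
have lN v : l i (- v) = - l i v.
  by have := lZ i (-1) v; rewrite rmorphN rmorph1 scaleN1r mulN1r.
have [|c [c01]] := @mean_value_functional F (l i) y d (lD i) (lZ i) (lb i).
  by move=> t t01; apply: (CF _ _).1; apply: H2; exact: seg.
have -> : y + d = y' by rewrite addrC subrK.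
move=> E; rewrite lD E -lD.
by apply: le_trans (lb _ _) _; apply: H1; apply: seg.
Qed.

End MeanValue.

Section StrictOn.
Variable R : realType.
Notation K := (CC R).

Definition rlinear (V W : normedModType K) (L : V -> W) :=
  (forall u v, L (u + v) = L u + L v) /\
  (forall (a : R) v, L (((a%:C)%C : K) *: v) = ((a%:C)%C : K) *: L v).

Lemma rlinear0 (V W : normedModType K) (L : V -> W) : rlinear L -> L 0 = 0.
Proof. by move=> [_ LZ]; rewrite -(scale0r (0 : V)) -(rmorph0 (@real_complex_def R (Phant R))) LZ
  rmorph0 scale0r. Qed.

Lemma rlinearN (V W : normedModType K) (L : V -> W) v : rlinear L -> L (- v) = - L v.
Proof. by move=> [_ LZ]; have := LZ (-1) v; rewrite rmorphN rmorph1 !scaleN1r. Qed.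

Lemma rlinearB (V W : normedModType K) (L : V -> W) u v : rlinear L -> L (u - v) = L u - L v.
Proof. by move=> L_; rewrite L_.1 rlinearN. Qed.

Lemma rlinear_sum (V W : normedModType K) (L : V -> W) (I : Type) (s : seq I) (F : I -> V) :
  rlinear L -> L (\sum_(i <- s) F i) = \sum_(i <- s) L (F i).
Proof.
move=> L_; elim/big_rec2: _ => [|i u v _ <-]; first exact: rlinear0.
by rewrite L_.1.
Qed.

Lemma rlinear_comp (V W X : normedModType K) (L : V -> W) (M : W -> X) :
  rlinear L -> rlinear M -> rlinear (M \o L).
Proof.
by move=> [LD LZ] [MD MZ]; split => [u v|a v] /=; rewrite ?LD ?LZ ?MD ?MZ.
Qed.

Lemma real_diff_rlinear (V W : normedModType K) (F : V -> W) x : rlinear (real_diff F x).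
Proof. by split => [u v|a v]; rewrite ?real_diffD ?real_diffZ. Qed.

Lemma rlinear_bounded (V W : normedModType K) (L : V -> W) : real_frame V -> rlinear L ->
  exists C : R, 0 < C /\ forall v, mag (L v) <= C * mag v.
Proof.
move=> [I [b [c [C [C0 [cb cC]]]]]] L_.
pose B := \sum_i mag (L (b i)).
have B0 : 0 <= B by apply: sumr_ge0 => i _; exact: mag_ge0.
exists (C * B + 1); split; first by have := mulr_ge0 (ltW C0) B0; lra.
move=> v; rewrite {1}[v]cb rlinear_sum//.
apply: le_trans (mag_sum _ _ _) _.
apply: (@le_trans _ _ (\sum_i C * mag v * mag (L (b i)))).
  by apply: ler_sum => i _; rewrite L_.2 magZ mag_real ler_wpM2r ?mag_ge0.
by rewrite -mulr_sumr -/B; have := mag_ge0 v; nra.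
Qed.

(** Strict differentiability relative to A.  The main example of A is the product of the disc and the
    sphere; it has empty interior, so the values of F on A do not determine a differential in the
    transversal directions, and L is any real linear map that works. *)
Definition strict_on (V W : normedModType K) (A : set V) (F : V -> W) (x : V) (L : V -> W) :=
  rlinear L /\ forall e : R, 0 < e ->
  exists d : R, 0 < d /\ forall y y', A y -> A y' -> mag (y - x) < d -> mag (y' - x) < d ->
    mag (F y' - F y - L (y' - y)) <= e * mag (y' - y).

Lemma strict_on_comp (V W X : normedModType K) (A : set V) (B : set W)
    (F : V -> W) (G : W -> X) x L M :
  real_frame V -> real_frame W -> A x -> (forall y, A y -> B (F y)) ->
  strict_on A F x L -> strict_on B G (F x) M -> strict_on A (G \o F) x (M \o L).
Proof.
move=> fV fW Ax AB [L_ HL] [M_ HM]; split; first exact: rlinear_comp.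
move=> e e0.
have [C [C0 LC]] := rlinear_bounded fV L_.
have [D [D0 MD]] := rlinear_bounded fW M_.
have e1 : 0 < e / (2 * (C + 1)) by rewrite divr_gt0//; lra.
have e2 : 0 < Num.min 1 (e / (2 * D)) by rewrite lt_min ltr01 divr_gt0//; lra.
have [d1 [d10 H1]] := HM _ e1.
have [d2 [d20 H2]] := HL _ e2.
have C1 : 0 < C + 1 by lra.
exists (Num.min d2 (d1 / (C + 1))); split; first by rewrite lt_min d20 divr_gt0.
have lip y y' : A y -> A y' -> mag (y - x) < d2 -> mag (y' - x) < d2 ->
    mag (F y' - F y) <= (C + 1) * mag (y' - y).
  move=> Ay Ay' yx yx'; have := H2 _ _ Ay Ay' yx yx'.
  have := LC (y' - y); have := magD (F y' - F y - L (y' - y)) (L (y' - y)); rewrite subrK.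
  have : Num.min 1 (e / (2 * D)) <= 1 by rewrite ge_min lexx.
  have := mag_ge0 (y' - y); nra.
move=> y y' Ay Ay'; rewrite !lt_min => /andP[y2 y1] /andP[y2' y1'].
have x2 : mag (x - x) < d2 by rewrite subrr mag0.
have Fx y0 : A y0 -> mag (y0 - x) < d2 -> mag (y0 - x) < d1 / (C + 1) -> mag (F y0 - F x) < d1.
  move=> Ay0 a; rewrite ltr_pdivlMr// mulrC; apply: le_lt_trans; exact: lip.
have h1 := H1 _ _ (AB _ Ay) (AB _ Ay') (Fx _ Ay y2 y1) (Fx _ Ay' y2' y1').
have h2 := lip _ _ Ay Ay' y2 y2'.
have h3 := H2 _ _ Ay Ay' y2 y2'.
have h4 := MD (F y' - F y - L (y' - y)).
rewrite /=; have -> : G (F y') - G (F y) - M (L (y' - y)) =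
   (G (F y') - G (F y) - M (F y' - F y)) + M (F y' - F y - L (y' - y)).
  by rewrite (rlinearB _ (L (y' - y)) M_) addrA subrK.
apply: le_trans (magD _ _) _.
have m0 := mag_ge0 (y' - y).
have e3 : Num.min 1 (e / (2 * D)) <= e / (2 * D) by rewrite ge_min lexx orbT.
have h5 : e / (2 * (C + 1)) * mag (F y' - F y) <= e / (2 * (C + 1)) * ((C + 1) * mag (y' - y)).
  by rewrite ler_wpM2l// ltW.
have E5 : e / (2 * (C + 1)) * ((C + 1) * mag (y' - y)) = e / 2 * mag (y' - y).
  by field; lra.
have h6 : D * mag (F y' - F y - L (y' - y)) <= D * (e / (2 * D) * mag (y' - y)).
  by apply: ler_wpM2l; [exact: ltW|apply: le_trans h3 _; exact: ler_wpM2r].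
have E6 : D * (e / (2 * D) * mag (y' - y)) = e / 2 * mag (y' - y) by field; lra.
lra.
Qed.

Lemma subBB (V : zmodType) (a b c d : V) : (a - b) - (c - d) = (a - c) - (b - d).
Proof. by rewrite !opprD !opprK addrACA. Qed.

Lemma strict_onB (V W : normedModType K) (A : set V) (F G : V -> W) x L M :
  strict_on A F x L -> strict_on A G x M ->
  strict_on A (fun y => F y - G y) x (fun y => L y - M y).
Proof.
move=> [L_ HL] [M_ HM]; split.
  split => [u v|a v]; first by rewrite L_.1 M_.1 opprD addrACA.
  by rewrite L_.2 M_.2 scalerBr.
move=> e e0; have e2 : 0 < e / 2 by lra.
have [d1 [d10 H1]] := HL _ e2; have [d2 [d20 H2]] := HM _ e2.
exists (Num.min d1 d2); split; first by rewrite lt_min d10.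
move=> y y' Ay Ay'; rewrite !lt_min => /andP[y1 y2] /andP[y1' y2'].
have := H1 _ _ Ay Ay' y1 y1'; have := H2 _ _ Ay Ay' y2 y2'.
set a := F y' - F y - _; set b := G y' - G y - _.
have -> : F y' - G y' - (F y - G y) - (L (y' - y) - M (y' - y)) = a - b.
  by rewrite (subBB (F y')) (subBB (F y' - F y)).
have := magB a b; lra.
Qed.

Lemma strict_on_coord (V : normedModType K) n (A : set V) (F : V -> 'rV[K]_n) x L i :
  strict_on A F x L -> strict_on A (fun y => F y 0 i) x (fun y => L y 0 i : K).
Proof.
move=> [L_ HL]; split; first by split => [u v|a v]; rewrite ?L_.1 ?L_.2 mxE.
move=> e /HL[d [d0 H]]; exists d; split => // y y' Ay Ay' yd yd'.
apply: le_trans (H _ _ Ay Ay' yd yd').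
by apply: le_trans (mag_coord _ i); rewrite !mxE.
Qed.

Lemma C1_open_strict (V W : normedModType K) (U : set V) (F : V -> W) x :
  real_frame V -> real_coframe W -> open U -> C1_open U F -> U x ->
  strict_on setT F x (real_diff F x).
Proof.
move=> fV fW oU CF Ux; split; first exact: real_diff_rlinear.
move=> e e0; have [d [d0 H]] := C1_strict fV fW oU CF Ux e0.
by exists d; split => // y y' _ _; exact: H.
Qed.

Lemma C1_on_strict (V W : normedModType K) (A : set V) (F : V -> W) x :
  real_frame V -> real_coframe W -> C1_on A F -> A x -> exists L, strict_on A F x L.
Proof.
move=> fV fW CF Ax; have [U [G [oU Ux CG FG]]] := CF x Ax.
have [L_ HL] := C1_open_strict fV fW oU CG Ux.
exists (real_diff G x); split => // e e0.
have [d1 [d10 H1]] := HL _ e0; have [d2 [d20 H2]] := open_mag oU Ux.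
exists (Num.min d1 d2); split; first by rewrite lt_min d10.
move=> y y' Ay Ay'; rewrite !lt_min => /andP[y1 y2] /andP[y1' y2'].
by rewrite !FG//; [exact: H1|exact: H2|exact: H2].
Qed.

Lemma strict_on_continuous (V W : normedModType K) (A : set V) (F : V -> W) x L :
  real_frame V -> A x -> strict_on A F x L -> forall e : R, 0 < e ->
  exists d : R, 0 < d /\ forall y, A y -> mag (y - x) < d -> mag (F y - F x) < e.
Proof.
move=> fV Ax [L_ HL] e e0.
have [d [d0 H]] := HL _ ltr01.
have [C [C0 LC]] := rlinear_bounded fV L_.
have C1 : 0 < C + 1 by lra.
exists (Num.min d (e / (C + 1))); split; first by rewrite lt_min d0 divr_gt0.
move=> y Ay; rewrite lt_min ltr_pdivlMr// => /andP[yd ye].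
have := H x y Ax Ay; rewrite subrr mag0 => /(_ d0 yd).
have := LC (y - x); have := magD (F y - F x - L (y - x)) (L (y - x)); rewrite subrK.
lra.
Qed.

Lemma strict_onD (V W : normedModType K) (A : set V) (F G : V -> W) x L M :
  strict_on A F x L -> strict_on A G x M ->
  strict_on A (fun y => F y + G y) x (fun y => L y + M y).
Proof.
move=> SF [M_ HM]; have SN : strict_on A (fun y => - G y) x (fun y => - M y).
  split; first by split => [u v|a v]; rewrite ?M_.1 ?M_.2 ?opprD ?scalerN.
  move=> e /HM[d [d0 Hd]]; exists d; split => // y y' Ay Ay' yd yd'.
  by rewrite -!opprD magN; exact: Hd.
have E (f g : V -> W) : (fun y => f y + g y) = (fun y => f y - - g y).
  by apply/funext => y; rewrite opprK.
by rewrite (E F G) (E L M); exact: strict_onB.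
Qed.

Lemma strict_on_eq (V W : normedModType K) (A : set V) (F : V -> W) x L M :
  strict_on A F x L -> L =1 M -> strict_on A F x M.
Proof. by move=> H /funext <-. Qed.

Lemma strict_onM (V : normedModType K) (F G : V -> K) x (L M : V -> K) : real_frame V ->
  strict_on setT F x L -> strict_on setT G x M ->
  strict_on setT (fun y => F y * G y) x (fun w => F x * M w + G x * L w).
Proof.
move=> fr SF SG; have [L_ HL] := SF; have [M_ HM] := SG.
split.
  split => [u v|a v]; rewrite ?L_.1 ?M_.1 ?L_.2 ?M_.2 /GRing.scale/=; ring.
move=> e e0.
have [C [C0 LC]] := rlinear_bounded fr L_; have [D [D0 MD]] := rlinear_bounded fr M_.
have f0 := mag_ge0 (F x); have g0 := mag_ge0 (G x).
pose a : R := mag (F x) + 1; pose b : R := mag (G x) + 1.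
have a0 : 0 < a by rewrite /a; lra.
have b0 : 0 < b by rewrite /b; lra.
have e1 : 0 < e / (4 * b) by rewrite divr_gt0//; lra.
have e2 : 0 < e / (4 * a) by rewrite divr_gt0//; lra.
have e3 : 0 < Num.min 1 (e / (4 * C)) by rewrite lt_min ltr01 divr_gt0//; lra.
have e4 : 0 < Num.min 1 (e / (4 * D)) by rewrite lt_min ltr01 divr_gt0//; lra.
have [d1 [d10 H1]] := HL _ e1; have [d2 [d20 H2]] := HM _ e2.
have [d3 [d30 H3]] := strict_on_continuous fr Logic.I SG e3.
have [d4 [d40 H4]] := strict_on_continuous fr Logic.I SF e4.
exists (Num.min (Num.min d1 d2) (Num.min d3 d4)); split; first by rewrite !lt_min d10 d20 d30 d40.
move=> y y' _ _; rewrite !lt_min => /andP[/andP[y1 y2] /andP[y3 y4]]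
  /andP[/andP[y1' y2'] /andP[y3' y4']].
have h1 := H1 _ _ Logic.I Logic.I y1 y1'; have h2 := H2 _ _ Logic.I Logic.I y2 y2'.
have := H3 _ Logic.I y3'; rewrite lt_min => /andP[g1 g2].
have := H4 _ Logic.I y4; rewrite lt_min => /andP[k1 k2].
set w := y' - y in h1 h2 *; have w0 := mag_ge0 w.
have -> : F y' * G y' - F y * G y - (F x * M w + G x * L w) =
  (F y' - F y - L w) * G y' + L w * (G y' - G x) + F y * (G y' - G y - M w) + (F y - F x) * M w
    by ring.
apply: le_trans (magD _ _) _; apply: le_trans (lerD (magD _ _) (lexx _)) _.
apply: le_trans (lerD (lerD (magD _ _) (lexx _)) (lexx _)) _; rewrite !magM.
have Gy : mag (G y') <= b by rewrite -[G y'](subrK (G x)) /b addrC;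
  apply: le_trans (magD _ _) (lerD (lexx _) (ltW g1)).
have Fy : mag (F y) <= a by rewrite -[F y](subrK (F x)) /a addrC;
  apply: le_trans (magD _ _) (lerD (lexx _) (ltW k1)).
have t1 : mag (F y' - F y - L w) * mag (G y') <= e / 4 * mag w.
  have -> : e / 4 * mag w = (e / (4 * b) * mag w) * b by field; exact: lt0r_neq0.
  by apply: ler_pM; rewrite ?mag_ge0.
have t2 : mag (L w) * mag (G y' - G x) <= e / 4 * mag w.
  have -> : e / 4 * mag w = (C * mag w) * (e / (4 * C)) by field; exact: lt0r_neq0.
  by apply: ler_pM; rewrite ?mag_ge0// ltW.
have t3 : mag (F y) * mag (G y' - G y - M w) <= e / 4 * mag w.
  have -> : e / 4 * mag w = a * (e / (4 * a) * mag w) by field; exact: lt0r_neq0.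
  by apply: ler_pM; rewrite ?mag_ge0.
have t4 : mag (F y - F x) * mag (M w) <= e / 4 * mag w.
  have -> : e / 4 * mag w = (e / (4 * D)) * (D * mag w) by field; exact: lt0r_neq0.
  by apply: ler_pM; rewrite ?mag_ge0// ltW.
have -> : e * mag w = e / 4 * mag w + e / 4 * mag w + e / 4 * mag w + e / 4 * mag w by field.
exact: lerD (lerD (lerD t1 t2) t3) t4.
Qed.

End StrictOn.

(** * Derivatives at 0 of functions of a real variable *)

Section Rderiv.
Variable R : realType.
Notation K := (CC R).

Definition rderiv0 (W : normedModType K) (g : R -> W) (c : W) := forall e : R, 0 < e ->
  exists d : R, 0 < d /\ forall t, `|t| < d -> mag (g t - g 0 - ((t%:C)%C : K) *: c) <= e * `|t|.

Lemma rderiv0_coord n (g : R -> 'rV[K]_n) c i : rderiv0 g c ->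
  rderiv0 (fun t => g t 0 i : K) (c 0 i : K).
Proof.
move=> H e /H[d [d0 Hd]]; exists d; split => // t /Hd; apply: le_trans.
by apply: le_trans (mag_coord _ i); rewrite !mxE.
Qed.

Lemma rderiv0_bound (W : normedModType K) (g : R -> W) a : rderiv0 g a ->
  exists C d : R, [/\ 0 < C, 0 < d & forall t, `|t| < d -> mag (g t - g 0) <= C * `|t|].
Proof.
move=> /(_ _ ltr01)[d [d0 Hd]]; exists (1 + mag a), d; split => //.
  by have := mag_ge0 a; lra.
move=> t /Hd h; have := magD (g t - g 0 - ((t%:C)%C : K) *: a) (((t%:C)%C : K) *: a).
rewrite subrK magZ mag_real; lra.
Qed.

Lemma rderiv0_ext (W : normedModType K) (g h : R -> W) a : (forall t, g t = h t) -> rderiv0 g a ->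
  rderiv0 h a.
Proof. by move=> gh H e /H[d [d0 Hd]]; exists d; split => // t; rewrite -!gh; exact: Hd. Qed.

Lemma rderiv0B (g h : R -> K) a b : rderiv0 g a -> rderiv0 h b ->
  rderiv0 (fun t => g t - h t) (a - b).
Proof.
move=> Hg Hh e e0; have e2 : 0 < e / 2 by lra.
have [d1 [d10 H1]] := Hg _ e2; have [d2 [d20 H2]] := Hh _ e2.
exists (Num.min d1 d2); split; first by rewrite lt_min d10.
move=> t; rewrite lt_min => /andP[/H1 h1 /H2 h2].
rewrite (_ : _ - _ = (g t - g 0 - ((t%:C)%C : K) *: (a : K)) -
  (h t - h 0 - ((t%:C)%C : K) *: (b : K))); last first.
  by rewrite /GRing.scale/=; ring.
by apply: le_trans (magB _ _) _; lra.
Qed.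

Lemma rderiv0M (g h : R -> K) (a b : K) : rderiv0 g a -> rderiv0 h b ->
  rderiv0 (fun t => g t * h t) (a * h 0 + g 0 * b).
Proof.
move=> Hg Hh e e0.
have [C [d1 [C0 d10 Hg1]]] := rderiv0_bound Hg.
have [D [d2 [D0 d20 Hh1]]] := rderiv0_bound Hh.
have m0 := mag_ge0 (h 0); have m1 := mag_ge0 (g 0).
have e1 : 0 < e / (3 * (mag (h 0) + 1)) by rewrite divr_gt0//; lra.
have e2 : 0 < e / (3 * (mag (g 0) + 1)) by rewrite divr_gt0//; lra.
have e3 : 0 < e / (3 * (C * D)) by rewrite divr_gt0// mulr_gt0// mulr_gt0.
have [d3 [d30 Hg2]] := Hg _ e1.
have [d4 [d40 Hh2]] := Hh _ e2.
exists (Num.min (Num.min d1 d2) (Num.min (Num.min d3 d4) (e / (3 * (C * D))))).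
split; first by rewrite !lt_min d10 d20 d30 d40.
move=> t; rewrite !lt_min => /andP[/andP[/Hg1 g1 /Hh1 h1] /andP[/andP[/Hg2 g2 /Hh2 h2] te]].
have -> : g t * h t - g 0 * h 0 - ((t%:C)%C : K) *: (a * h 0 + g 0 * b : K) =
  (g t - g 0 - ((t%:C)%C : K) *: a) * h 0 + g 0 * (h t - h 0 - ((t%:C)%C : K) *: b)
   + (g t - g 0) * (h t - h 0) by rewrite /GRing.scale/=; ring.
apply: le_trans (magD _ _) _; apply: le_trans (lerD (magD _ _) (lexx _)) _.
rewrite !magM; set T := `|t| in g1 h1 g2 h2 te *.
have T0 : 0 <= T by exact: normr_ge0.
have k1 : mag (g t - g 0 - ((t%:C)%C : K) *: a) * mag (h 0) <= e / 3 * T.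
  apply: le_trans (ler_wpM2r m0 g2) _.
  have -> : e / (3 * (mag (h 0) + 1)) * T * mag (h 0) = e / 3 * T * (mag (h 0) / (mag (h 0) + 1)).
    by field; lra.
  by rewrite ler_piMr ?mulr_ge0 ?divr_ge0 ?(ltW e0)// ler_pdivrMr; lra.
have k2 : mag (g 0) * mag (h t - h 0 - ((t%:C)%C : K) *: b) <= e / 3 * T.
  apply: le_trans (ler_wpM2l m1 h2) _.
  have -> : mag (g 0) * (e / (3 * (mag (g 0) + 1)) * T) = e / 3 * T * (mag (g 0) / (mag (g 0) + 1)).
    by field; lra.
  by rewrite ler_piMr ?mulr_ge0 ?divr_ge0 ?(ltW e0)// ler_pdivrMr; lra.
have k3 : mag (g t - g 0) * mag (h t - h 0) <= e / 3 * T.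
  apply: (@le_trans _ _ ((C * T) * (D * T))); first by apply: ler_pM; rewrite ?mag_ge0.
  have -> : C * T * (D * T) = T * (C * D) * T by ring.
  rewrite ler_wpM2r//.
  have CD : 0 < C * D by exact: mulr_gt0.
  have -> : e / 3 = e / (3 * (C * D)) * (C * D) by field; lra.
  by rewrite ler_wpM2r// ltW.
lra.
Qed.

Lemma rderiv0_cst (g : R -> K) c : rderiv0 g c -> (forall t, g t = 0) -> c = 0.
Proof.
move=> H g0; apply/mag_eq0/eqP; rewrite eq_le mag_ge0 andbT; apply/ler_addgt0Pr => e e0.
rewrite add0r; have [d [d0 Hd]] := H _ e0.
have := Hd (d / 2); rewrite !g0 subr0 sub0r magN magZ mag_real ger0_norm; last lra.
have d2 : 0 < d / 2 by lra.
by rewrite [leRHS]mulrC ler_pM2l//; apply; lra.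
Qed.

Lemma rderiv0_unique (g : R -> K) a b : rderiv0 g a -> rderiv0 g b -> a = b.
Proof.
move=> Ha Hb; apply/eqP; rewrite -subr_eq0; apply/eqP.
by apply: (rderiv0_cst (rderiv0B Ha Hb)) => t; rewrite subrr.
Qed.

Lemma rderiv0Z (c : K) (g : R -> K) a : rderiv0 g a -> rderiv0 (fun t => c * g t) (c * a).
Proof.
move=> H e e0; have m := mag_ge0 c.
have e1 : 0 < e / (mag c + 1) by rewrite divr_gt0//; lra.
have [d [d0 Hd]] := H _ e1; exists d; split => // t /Hd h.
have -> : c * g t - c * g 0 - ((t%:C)%C : K) *: (c * a : K) =
  c * (g t - g 0 - ((t%:C)%C : K) *: (a : K)).
  by rewrite /GRing.scale/=; ring.
rewrite magM; apply: le_trans (ler_wpM2l m h) _.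
have -> : mag c * (e / (mag c + 1) * `|t|) = e * `|t| * (mag c / (mag c + 1)) by field; lra.
by rewrite ler_piMr ?mulr_ge0 ?(ltW e0)// ler_pdivrMr; lra.
Qed.

(** Chain rule for a path in A.  It determines L on the velocity vectors of such paths. *)
Lemma strict_on_path (V W : normedModType K) (B : set V) (F : V -> W) x L (p : R -> V) p' :
  real_frame V -> strict_on B F x L -> (forall t, B (p t)) -> p 0 = x -> rderiv0 p p' ->
  rderiv0 (fun t => F (p t)) (L p').
Proof.
move=> fV [L_ HL] Bp p0 Hp e e0.
have [C [C0 LC]] := rlinear_bounded fV L_.
pose X : R := mag p' + 1; have X0 : 0 < X by have := mag_ge0 p'; rewrite /X; lra.
have e1 : 0 < e / (2 * X) by rewrite divr_gt0//; lra.
have e2 : 0 < Num.min 1 (e / (2 * C)) by rewrite lt_min ltr01 divr_gt0//; lra.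
have [d1 [d10 H1]] := HL _ e1; have [d2 [d20 H2]] := Hp _ e2.
exists (Num.min d2 (d1 / X)); split; first by rewrite lt_min d20 divr_gt0.
move=> t; rewrite lt_min ltr_pdivlMr// => /andP[/H2 h2 tX].
have at0 := normr_ge0 t.
have m1 : Num.min 1 (e / (2 * C)) <= 1 by rewrite ge_min lexx.
have m2 : Num.min 1 (e / (2 * C)) <= e / (2 * C) by rewrite ge_min lexx orbT.
have pX : mag (p t - p 0) <= X * `|t|.
  have h3 := magD (p t - p 0 - ((t%:C)%C : K) *: p') (((t%:C)%C : K) *: p'); rewrite subrK in h3.
  have h4 : Num.min 1 (e / (2 * C)) * `|t| <= 1 * `|t| by rewrite ler_wpM2r.
  by apply: le_trans h3 _; rewrite magZ mag_real /X mulrDl addrC mulrC lerD2l; exact: le_trans h4.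
have hx : mag (p 0 - x) < d1 by rewrite p0 subrr mag0.
have hx' : mag (p t - x) < d1 by rewrite -p0; apply: le_lt_trans pX _; rewrite mulrC.
have h1 := H1 _ _ (Bp 0) (Bp t) hx hx'.
have -> : F (p t) - F (p 0) - ((t%:C)%C : K) *: L p' =
  (F (p t) - F (p 0) - L (p t - p 0)) + L (p t - p 0 - ((t%:C)%C : K) *: p').
  by rewrite (rlinearB (p t - p 0) (((t%:C)%C : K) *: p') L_) L_.2 addrA subrK.
apply: le_trans (magD _ _) _.
have -> : e * `|t| = e / (2 * X) * (X * `|t|) + C * (e / (2 * C) * `|t|) by field;
  rewrite !lt0r_neq0.
apply: lerD; first by apply: le_trans h1 _; rewrite ler_wpM2l// ltW.
apply: le_trans (LC _) _; rewrite ler_wpM2l ?(ltW C0)//; apply: le_trans h2 _.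
by rewrite ler_wpM2r.
Qed.

Lemma rderiv0_pair (V W : normedModType K) (p : R -> V) (q : R -> W) p' q' :
  rderiv0 p p' -> rderiv0 q q' -> rderiv0 (fun t => (p t, q t)) (p', q').
Proof.
move=> Hp Hq e e0; have [d1 [d10 H1]] := Hp _ e0; have [d2 [d20 H2]] := Hq _ e0.
exists (Num.min d1 d2); split; first by rewrite lt_min d10.
move=> t; rewrite lt_min => /andP[/H1 h1 /H2 h2].
apply/ler_addgt0Pr => e1 e10; apply/ltW/mag_pair_lt => /=; split; lra.
Qed.

Lemma rderiv0_const (V : normedModType K) (c : V) : rderiv0 (fun=> c) 0.
Proof.
move=> e e0; exists 1; split => // t _.
by rewrite subrr scaler0 subr0 mag0 mulr_ge0// ltW.
Qed.

End Rderiv.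

(** * Families of holomorphic functions parametrized by the sphere *)

Section Families.
Variable R : realType.
Notation K := (CC R).
Variable n : nat.
Notation disc := (@unit_disc R).
Notation sph := (@sphere R n).
Notation A := (disc `*` sph).

Lemma discP (z : K) : disc z <-> mag z < 1.
Proof. by rewrite mag_lt. Qed.

Variable Phi : K * 'rV[K]_n -> K.
Hypothesis Phi_hol : forall v, sph v -> holomorphic_on disc (fun z => Phi (z, v)).
Variable L : K -> 'rV[K]_n -> K * 'rV[K]_n -> K.
Hypothesis Phi_strict : forall z v, disc z -> sph v -> strict_on A Phi (z, v) (L z v).

(** On the tangent directions of the disc, L is forced to be the complex derivative. *)
Lemma leaf_derivative z v : disc z -> sph v -> forall zeta,
  L z v (zeta, 0) = 'd (fun z => Phi (z, v)) z zeta.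
Proof.
move=> zd vs zeta; apply/eqP; rewrite -subr_eq0; apply/eqP/mag_eq0.
apply/eqP; rewrite eq_le mag_ge0 andbT; apply/ler_addgt0Pr => e e0; rewrite add0r.
pose M : R := mag zeta + 1; have M0 : 0 < M by have := mag_ge0 zeta; rewrite /M; lra.
have e1 : 0 < e / (2 * M) by rewrite divr_gt0//; lra.
have [L_ HL] := Phi_strict zd vs.
have [d1 [d10 H1]] := HL _ e1.
have [d2 [d20 H2]] := cdiff_mag (Phi_hol vs zd) e1.
have z1 := (discP z).1 zd.
pose d := Num.min d1 (Num.min d2 (1 - mag z)).
have d0 : 0 < d by rewrite !lt_min d10 d20 subr_gt0.
pose t := d / (2 * M); have t0 : 0 < t by rewrite divr_gt0//; lra.
pose th : K := ((t%:C)%C : K) *: zeta.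
have mth : mag th = t * mag zeta by rewrite magZ mag_real ger0_norm// ltW.
have tM : t * M = d / 2 by rewrite /t; field; rewrite lt0r_neq0.
have thd : mag th < d.
  have : t * mag zeta <= t * M by rewrite ler_wpM2l ?(ltW t0)// /M; lra.
  rewrite mth tM; lra.
have [th1 th2 th3] : [/\ mag th < d1, mag th < d2 & mag th < 1 - mag z].
  by move: thd; rewrite !lt_min => /andP[? /andP[? ?]].
have pairE : (th + z, v) - (z, v) = (th, 0) :> K * 'rV[K]_n.
  by rewrite [LHS]surjective_pairing /= addrK subrr.
have mpair : mag ((th, 0) : K * 'rV[K]_n) <= mag th.
  apply/ler_addgt0Pr => e' e'0; apply/ltW/mag_pair_lt => /=; rewrite mag0.
  by have := mag_ge0 th; lra.
have := H1 (z, v) (th + z, v); rewrite pairE subrr mag0.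
have Az : A (z, v) by split.
have Az' : A (th + z, v) by split => //=; apply/discP; have := magD th z; lra.
move=> /(_ Az Az' d10 (le_lt_trans mpair th1)) h1.
have h2 := H2 _ th2.
have LE : L z v (th, 0) = (t%:C)%C * L z v (zeta, 0).
  rewrite (_ : (th, 0) = ((t%:C)%C : K) *: ((zeta, 0) : K * 'rV[K]_n)); first exact: L_.2.
  by rewrite [RHS]surjective_pairing /= scaler0.
have dE : 'd (fun z => Phi (z, v)) z th = (t%:C)%C * 'd (fun z => Phi (z, v)) z zeta.
  by rewrite /th linearZ.
have := mag_sub (L z v (th, 0)) (Phi (th + z, v) - Phi (z, v)) ('d (fun z => Phi (z, v)) z th).
rewrite [mag (L z v (th, 0) - (Phi _ - _))]magBC {1}LE {1}dE -mulrBr magM mag_real ger0_norm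
  ?(ltW t0)//.
move=> h3; rewrite -(ler_pM2l t0); apply: le_trans h3 _.
have h4 : e / (2 * M) * mag ((th, 0) : K * 'rV[K]_n) <= e / (2 * M) * mag th.
  by rewrite ler_wpM2l// ltW.
have h5 : e / (2 * M) * mag th <= e / (2 * M) * (t * M).
  by rewrite ler_wpM2l ?(ltW e1)// mth ler_wpM2l ?(ltW t0)// /M; lra.
have E5 : e / (2 * M) * (t * M) = t * e / 2 by field; lra.
lra.
Qed.

Lemma leaf_strict_cdiff z v : disc z -> sph v -> strict_cdiff (fun z => Phi (z, v)) z.
Proof.
move=> zd vs; exists ('d (fun z => Phi (z, v)) z 1) => e e0.
have [L_ HL] := Phi_strict zd vs.
have [d [d0 H]] := HL _ e0; have z1 := (discP z).1 zd.
exists (Num.min d (1 - mag z)); split; first by rewrite lt_min d0 subr_gt0.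
move=> w w'; rewrite !lt_min => /andP[w1 w2] /andP[w1' w2'].
have mpair (a : K) : mag ((a, 0) : K * 'rV[K]_n) <= mag a.
  apply/ler_addgt0Pr => e' e'0; apply/ltW/mag_pair_lt => /=; rewrite mag0.
  by have := mag_ge0 a; lra.
have dsc a : mag (a - z) < 1 - mag z -> disc a.
  by move=> az; apply/discP; have := magD (a - z) z; rewrite subrK; lra.
have pairE a b : (a, v) - (b, v) = (a - b, 0) :> K * 'rV[K]_n.
  by rewrite [LHS]surjective_pairing /= subrr.
have := H (w, v) (w', v); rewrite !pairE leaf_derivative//.
have -> : 'd (fun z => Phi (z, v)) z (w' - w) = 'd (fun z => Phi (z, v)) z 1 * (w' - w).
  by rewrite -[w' - w]mulr1 [in LHS]linearZ /= mulrC mulr1.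
move=> /(_ _ _ _ _)/le_trans; apply.
- by split => //; exact: dsc.
- by split => //; exact: dsc.
- by apply: le_lt_trans w1; exact: mpair.
- by apply: le_lt_trans w1'; exact: mpair.
- by rewrite ler_wpM2l// ltW.
Qed.

Lemma leaf_vord r v : 0 < r -> r < 1 -> sph v -> vord r 0 (fun z => Phi (z, v)).
Proof.
move=> r0 r1 vs; apply: (@udiff_vord _ _ ((1 + r) / 2)) => //; first lra.
by apply: strict_udiff => w0 w0r; apply: leaf_strict_cdiff => //; apply/discP; lra.
Qed.

Variables (g : R -> 'rV[K]_n) (v xi : 'rV[K]_n).
Hypothesis g_sph : forall t, sph (g t).
Hypothesis g0 : g 0 = v.
Hypothesis g_deriv : rderiv0 g xi.

Let vs : sph v. Proof. by rewrite -g0. Qed.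

Definition diff_quot (t : R) z : K := ((t^-1)%:C)%C * (Phi (z, g t) - Phi (z, v)).

(** Strict differentiability at (w0, v) controls the difference quotients for all z near w0 at
    once. *)
Lemma diff_quot_local w0 : disc w0 -> forall e : R, 0 < e -> exists d : R, 0 < d /\
  forall z, mag (z - w0) < d -> forall t, t != 0 -> `|t| < d ->
    mag (diff_quot t z - L w0 v (0, xi)) <= e.
Proof.
move=> w0d e e0.
have [L_ HL] := Phi_strict w0d vs.
have [C [C0 LC]] := rlinear_bounded (frame_pair (frame_K R) (frame_rV R n)) L_.
pose X : R := mag xi + 1; have X0 : 0 < X by have := mag_ge0 xi; rewrite /X; lra.
have e1 : 0 < e / (2 * X) by rewrite divr_gt0//; lra.
have e2 : 0 < Num.min 1 (e / (2 * C)) by rewrite lt_min ltr01 divr_gt0//; lra.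
have [d1 [d10 H1]] := HL _ e1; have [d2 [d20 H2]] := g_deriv e2.
have w1 := (discP w0).1 w0d.
exists (Num.min (Num.min d1 (1 - mag w0)) (Num.min d2 (d1 / X))); split.
  by rewrite !lt_min d10 d20 subr_gt0 w1 divr_gt0.
move=> z + t t0; rewrite !lt_min => /andP[/andP[z1 z2] _] /andP[_ /andP[t2 t1]].
have zd : disc z by apply/discP; have := magD (z - w0) w0; rewrite subrK; lra.
have at0 : 0 < `|t| by rewrite normr_gt0.
have h2 := H2 _ t2; rewrite g0 in h2.
have gv : mag (g t - v) <= X * `|t|.
  have := magD (g t - v - ((t%:C)%C : K) *: xi) (((t%:C)%C : K) *: xi); rewrite subrK.
  rewrite magZ mag_real /X.
  have : Num.min 1 (e / (2 * C)) <= 1 by rewrite ge_min lexx.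
  nra.
have mpair (a : K) (b : 'rV[K]_n) B : mag a <= B -> mag b <= B -> mag ((a, b) : K * 'rV[K]_n) <= B.
  by move=> aB bB; apply/ler_addgt0Pr => e' e'0; apply/ltW/mag_pair_lt => /=; split; lra.
have pairE a b : (z, a) - (w0, b) = (z - w0, a - b) :> K * 'rV[K]_n by [].
have pairE' a b : (z, a) - (z, b) = (0, a - b) :> K * 'rV[K]_n.
  by rewrite [LHS]surjective_pairing /= subrr.
have mlt (a : K) (b : 'rV[K]_n) (B : R) : mag a < B -> mag b < B -> mag ((a, b) : K * 'rV[K]_n) < B.
  by move=> aB bB; apply/mag_pair_lt.
have := H1 (z, v) (z, g t); rewrite !pairE pairE' subrr.
move=> /(_ _ _ _ _) h1.
have {}h1 : mag (Phi (z, g t) - Phi (z, v) - L w0 v (0, g t - v)) <=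
  e / (2 * X) * mag ((0, g t - v) : K * 'rV[K]_n).
  apply: h1; [by split|by split => //=; exact: g_sph|by apply: mlt => //; rewrite mag0|].
  by apply: mlt => //; apply: le_lt_trans gv _; rewrite mulrC -ltr_pdivlMr.
have h3 : mag ((0, g t - v) : K * 'rV[K]_n) <= X * `|t|.
  by apply: mpair => //; rewrite mag0 mulr_ge0// ltW.
have h4 : mag (L w0 v (0, g t - v) - (t%:C)%C * L w0 v (0, xi)) <=
  C * (Num.min 1 (e / (2 * C)) * `|t|).
  have -> : (t%:C)%C * L w0 v (0, xi) = L w0 v (0, ((t%:C)%C : K) *: xi).
    rewrite -[LHS]L_.2; congr L; by rewrite [LHS]surjective_pairing /= scaler0.
  rewrite -(rlinearB _ _ L_) (_ : _ - _ = (0, g t - v - ((t%:C)%C : K) *: xi)); last first.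
    by rewrite [LHS]surjective_pairing /= subrr.
  apply: le_trans (LC _) _; rewrite ler_wpM2l ?(ltW C0)//.
  apply: mpair => //; by rewrite mag0 mulr_ge0// ltW.
have tc0 : ((t%:C)%C : K) != 0 by apply/eqP => /complexI/eqP; rewrite (negPf t0).
have -> : diff_quot t z - L w0 v (0, xi) = ((t%:C)%C : K)^-1 *
    ((Phi (z, g t) - Phi (z, v) - L w0 v (0, g t - v)) +
      (L w0 v (0, g t - v) - (t%:C)%C * L w0 v (0, xi))).
  by rewrite /diff_quot fmorphV; field.
rewrite magM magV mag_real ler_pdivrMl//.
apply: le_trans (magD _ _) _.
have h5 : e / (2 * X) * mag ((0, g t - v) : K * 'rV[K]_n) <= e / (2 * X) * (X * `|t|)
  by rewrite ler_wpM2l// ltW.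
have E5 : e / (2 * X) * (X * `|t|) = e / 2 * `|t| by field; lra.
have h6 : C * (Num.min 1 (e / (2 * C)) * `|t|) <= C * (e / (2 * C) * `|t|).
  by rewrite ler_wpM2l ?(ltW C0)// ler_wpM2r// ge_min lexx orbT.
have E6 : C * (e / (2 * C) * `|t|) = e / 2 * `|t| by field; lra.
lra.
Qed.

(** Near w0, [diff_quot_local] compares the quotients with L w0 v (0, xi) instead of L z v (0, xi).
    The two values are close since both are close to the quotient for one small parameter s. *)
Lemma diff_quot_uniform r : r < 1 -> forall e : R, 0 < e -> exists d : R, 0 < d /\
  forall z, mag z <= r -> forall t, t != 0 -> `|t| < d ->
    mag (diff_quot t z - L z v (0, xi)) <= e.
Proof.
move=> r1 e e0; apply: (@disc_uniform R r (fun d z => forall t, t != 0 -> `|t| < d ->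
    mag (diff_quot t z - L z v (0, xi)) <= e)).
  by move=> d d' w dd' H t t0 td; apply: H => //; exact: lt_le_trans dd'.
move=> w0 w0r; have w0d : disc w0 by apply/discP; lra.
have e2 : 0 < e / 2 by lra.
have [d [d0 H]] := diff_quot_local w0d e2.
have w1 : mag w0 < 1 by lra.
exists (Num.min d (1 - mag w0)); split; first by rewrite lt_min d0 subr_gt0.
move=> z; rewrite lt_min => /andP[zd z1] t t0; rewrite lt_min => /andP[td _].
have zd' : disc z by apply/discP; have := magD (z - w0) w0; rewrite subrK; lra.
apply/ler_addgt0Pr => e' e'0.
have e3 : 0 < e' by [].
have [d' [d'0 H']] := diff_quot_local zd' e3.
pose s := Num.min d d' / 2.
have s0 : 0 < Num.min d d' by rewrite lt_min d0.
have sp : 0 < s by rewrite /s; lra.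
have sd : s < d by apply: (@lt_le_trans _ _ (Num.min d d')); rewrite /s ?ge_min ?lexx//; lra.
have sd' : s < d' by apply: (@lt_le_trans _ _ (Num.min d d')); rewrite /s ?ge_min ?lexx ?orbT//;
  lra.
have := H _ zd _ (lt0r_neq0 sp); rewrite ger0_norm ?(ltW sp)// => /(_ sd) h1.
have := H' z _ _ (lt0r_neq0 sp); rewrite ger0_norm ?(ltW sp)// subrr mag0 => /(_ d'0 sd') h2.
have h3 := H _ zd _ t0 td.
have k1 := mag_sub (diff_quot t z) (L w0 v (0, xi)) (L z v (0, xi)).
have k2 := mag_sub (L w0 v (0, xi)) (diff_quot s z) (L z v (0, xi)).
rewrite [mag (L w0 v (0, xi) - diff_quot s z)]magBC in k2.
lra.
Qed.

(** The difference quotients are holomorphic in z and of order m, and so is their uniform limit. *)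
Lemma deriv_vord r m : 0 < r -> r < 1 ->
  (forall w, sph w -> vord r m (fun z => Phi (z, w))) ->
  vord r m (fun z => L z v (0, xi)).
Proof.
move=> r0 r1 H; apply: vord_lim => e e0.
have [d [d0 Hd]] := diff_quot_uniform r1 e0.
exists (diff_quot (d / 2)); split; first by apply: vordZ; apply: vordB; exact: H.
move=> z zr; rewrite magBC; apply: Hd => //; first by rewrite lt0r_neq0//; lra.
by rewrite ger0_norm; lra.
Qed.

End Families.

(** * Curves in the sphere *)

Section Curves.
Variable R : realType.
Notation K := (CC R).
Variable n : nat.
Notation sph := (@sphere R n).
Implicit Types v xi : 'rV[K]_n.

(** The real part of the Hermitian product of v and xi vanishes, that is, xi is tangent to the sphere
    at v. *)
Definition real_orth v xi := \sum_i (xi 0 i * Num.conj (v 0 i) + Num.conj (xi 0 i) * v 0 i) =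
  0 :> K.

Definition sqlen xi : R := \sum_i mag (xi 0 i) ^+ 2.

(** Stereographic parametrization: for xi orthogonal to v, the vector
    (4 - t^2 |xi|^2) v + 4 t xi has length 4 + t^2 |xi|^2.  Being rational in t, it is differentiated
    by algebra. *)
Definition sphere_curve v xi (t : R) : 'rV[K]_n :=
  (((4 + t ^+ 2 * sqlen xi)^-1)%:C)%C *:
    ((((4 - t ^+ 2 * sqlen xi)%:C)%C : K) *: v + (((4 * t)%:C)%C : K) *: xi).

Lemma sqlen_ge0 xi : 0 <= sqlen xi.
Proof. by apply: sumr_ge0 => i _; exact: sqr_ge0. Qed.

Lemma sqlenE xi : ((sqlen xi)%:C)%C = \sum_i `|xi 0 i| ^+ 2 :> K.
Proof. by rewrite /sqlen rmorph_sum; apply: eq_bigr => i _; rewrite rmorphXn/= magE. Qed.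

Lemma sphere_curve_den t xi : 0 < 4 + t ^+ 2 * sqlen xi.
Proof. by have := mulr_ge0 (sqr_ge0 t) (sqlen_ge0 xi); lra. Qed.

Lemma sphere_curve0 v xi : sphere_curve v xi 0 = v.
Proof.
rewrite /sphere_curve expr0n /= !mul0r addr0 subr0 mulr0 rmorph0 scale0r addr0 scalerA -rmorphM.
by rewrite mulVf ?rmorph1 ?scale1r.
Qed.

Lemma sphere_curve_sphere v xi t : sph v -> real_orth v xi -> sph (sphere_curve v xi t).
Proof.
rewrite /sphere /= => vs vx.
pose al : K := (((4 + t ^+ 2 * sqlen xi)^-1)%:C)%C.
pose A : K := ((4 - t ^+ 2 * sqlen xi)%:C)%C.
pose B : K := ((4 * t)%:C)%C.
have re (x : R) : Num.conj ((x%:C)%C : K) = (x%:C)%C by apply/CrealP/complex_realP; exists x.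
have E i : `|sphere_curve v xi t 0 i| ^+ 2 = al ^+ 2 * (A ^+ 2 * `|v 0 i| ^+ 2 +
   A * B * (xi 0 i * Num.conj (v 0 i) + Num.conj (xi 0 i) * v 0 i) + B ^+ 2 * `|xi 0 i| ^+ 2).
  rewrite !mxE -/al -/A -/B !normCK !rmorphM rmorphD !rmorphM /= !re -/al -/A -/B.
  ring.
under eq_bigr do rewrite E.
rewrite -mulr_sumr !big_split/= -!mulr_sumr vs vx -sqlenE mulr0 addr0 mulr1.
rewrite /al /A /B -!rmorphXn -rmorphM -rmorphD -rmorphM/=
  -[RHS](rmorph1 (@real_complex_def R (Phant R))).
congr (_%:C)%C; have := sphere_curve_den t xi => den; field; exact: lt0r_neq0.
Qed.

Lemma sphere_curve_deriv v xi : rderiv0 (sphere_curve v xi) xi.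
Proof.
move=> e e0; set q := sqlen xi; have q0 : 0 <= q := sqlen_ge0 xi.
pose M := 2 * q * mag v + q * mag xi + 1.
have mv := mag_ge0 v; have mx := mag_ge0 xi.
have M0 : 0 < M by rewrite /M; have := mulr_ge0 q0 mv; have := mulr_ge0 q0 mx; lra.
exists (Num.min 1 (e / M)); split; first by rewrite lt_min ltr01 divr_gt0.
move=> t; rewrite lt_min ltr_pdivlMr// => /andP[t1 te].
have den : 0 < 4 + t ^+ 2 * q := sphere_curve_den t xi.
have E : sphere_curve v xi t - sphere_curve v xi 0 - ((t%:C)%C : K) *: xi =
  (((4 + t ^+ 2 * q)^-1)%:C)%C *:
    ((((- 2 * t ^+ 2 * q)%:C)%C : K) *: v - (((t ^+ 3 * q)%:C)%C : K) *: xi).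
  rewrite sphere_curve0 /sphere_curve -/q; apply/rowP => i; rewrite !mxE.
  have alD : (((4 + t ^+ 2 * q)^-1)%:C)%C * (((4 + t ^+ 2 * q)%:C)%C) = 1 :> K.
    by rewrite -rmorphM mulVf ?rmorph1// lt0r_neq0.
  have -> : ((4 - t ^+ 2 * q)%:C)%C = ((4 + t ^+ 2 * q)%:C)%C + ((- 2 * t ^+ 2 * q)%:C)%C :> K.
    by rewrite -rmorphD; congr (_%:C)%C; ring.
  have -> : ((4 * t)%:C)%C = (t%:C)%C * ((4 + t ^+ 2 * q)%:C)%C - ((t ^+ 3 * q)%:C)%C :> K.
    by rewrite -rmorphM -rmorphB; congr (_%:C)%C; ring.
  move: alD; set al := (_^-1%:C)%C; set D := ((4 + _)%:C)%C; set P := ((- 2 * _ * _)%:C)%C.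
  set Q := ((_ ^+ 3 * _)%:C)%C; set T := (t%:C)%C => alD.
  rewrite [LHS](_ : _ = (al * D) * (v 0 i + T * xi 0 i) + al * (P * v 0 i - Q * xi 0 i) - v 0 i -
    T * xi 0 i); last by ring.
  by rewrite alD; ring.
rewrite E magZ mag_real ger0_norm ?invr_ge0 ?(ltW den)// ler_pdivrMl//.
apply: le_trans (magB _ _) _; rewrite !magZ !mag_real.
have -> : `|- 2 * t ^+ 2 * q| = 2 * `|t| ^+ 2 * q.
  by rewrite 2!normrM normrN normrX (ger0_norm q0) (@ger0_norm _ 2).
have -> : `|t ^+ 3 * q| = `|t| ^+ 3 * q by rewrite normrM normrX (ger0_norm q0).
set T := `|t| in t1 te *; have T0 : 0 <= T by exact: normr_ge0.
have t2 : 0 <= t ^+ 2 * q by rewrite mulr_ge0// sqr_ge0.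
have qx := mulr_ge0 q0 mx; have qv := mulr_ge0 q0 mv.
have T2 : T ^+ 3 <= T ^+ 2 by rewrite exprSr -[leRHS]mulr1 ler_wpM2l ?sqr_ge0// ltW.
apply: (@le_trans _ _ (T ^+ 2 * M)).
  have : T ^+ 3 * (q * mag xi) <= T ^+ 2 * (q * mag xi) by rewrite ler_wpM2r.
  have := sqr_ge0 T; rewrite /M; nra.
have eT : 0 <= e * T by rewrite mulr_ge0// ltW.
have : T * (T * M) <= T * e by rewrite ler_wpM2l// ltW.
rewrite expr2; nra.
Qed.

Lemma sphere_neq0 v : sph v -> exists i, v 0 i != 0.
Proof.
move=> vs; apply/existsP; apply: contraT => /existsPn H.
move: vs; rewrite /sphere /= big1 => [/esym/eqP|i _]; first by rewrite oner_eq0.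
by have := H i; rewrite negbK => /eqP ->; rewrite normr0 expr0n.
Qed.

End Curves.

(** * Holomorphic polynomials *)

Section HolPoly.
Variable R : realType.
Notation K := (CC R).
Variable n : nat.

(** Polynomial functions in the coordinates without conjugates, as the smallest class closed under
    sums and products; inductions on this predicate replace manipulations of monomials. *)
Inductive holpoly : ('rV[K]_n -> K) -> Prop :=
| holpoly_cst c : holpoly (fun=> c)
| holpoly_coord i : holpoly (fun x => x 0 i)
| holpolyD P Q : holpoly P -> holpoly Q -> holpoly (fun x => P x + Q x)
| holpolyM P Q : holpoly P -> holpoly Q -> holpoly (fun x => P x * Q x).

Lemma holpoly_ext P Q : holpoly P -> P =1 Q -> holpoly Q.
Proof. by move=> HP /funext <-. Qed.

Lemma holpoly_sum (I : Type) (s : seq I) (p : pred I) (P : I -> 'rV[K]_n -> K) :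
  (forall i, p i -> holpoly (P i)) -> holpoly (fun x => \sum_(i <- s | p i) P i x).
Proof.
move=> H; elim: s => [|i s IH].
  by apply: holpoly_ext (holpoly_cst 0) _ => x; rewrite big_nil.
have [pi|pi] := boolP (p i).
  by apply: holpoly_ext (holpolyD (H i pi) IH) _ => x; rewrite big_cons pi.
by apply: holpoly_ext IH _ => x; rewrite big_cons (negPf pi).
Qed.

Lemma holpoly_prod (I : Type) (s : seq I) (P : I -> 'rV[K]_n -> K) :
  (forall i, holpoly (P i)) -> holpoly (fun x => \prod_(i <- s) P i x).
Proof.
move=> H; elim: s => [|i s IH].
  by apply: holpoly_ext (holpoly_cst 1) _ => x; rewrite big_nil.
by apply: holpoly_ext (holpolyM (H i) IH) _ => x; rewrite big_cons.
Qed.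

Lemma holpolyX P k : holpoly P -> holpoly (fun x => P x ^+ k).
Proof.
move=> H; elim: k => [|k IH].
  by apply: holpoly_ext (holpoly_cst 1) _ => x; rewrite expr0.
by apply: holpoly_ext (holpolyM H IH) _ => x; rewrite exprS.
Qed.

Lemma holpoly_vord P r (u : K -> 'rV[K]_n) : holpoly P ->
  (forall i, vord r 0 (fun z => u z 0 i : K)) -> vord r 0 (fun z => P (u z)).
Proof.
move=> HP Hu; elim: HP => [c|i|P1 P2 _ H1 _ H2|P1 P2 _ H1 _ H2].
- exact: vord_cst.
- exact: Hu.
- exact: vordD.
- exact: (@vordM _ _ 0 0).
Qed.

(** The form of the differential of a holomorphic function with gradient G: it is complex
    linear. *)
Definition grad_form (G w : 'rV[K]_n) : K := \sum_i G 0 i * w 0 i.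

Lemma grad_form_rlinear G : rlinear (grad_form G).
Proof.
split => [u v|a v]; rewrite /grad_form.
  by rewrite -big_split; apply: eq_bigr => i _; rewrite mxE mulrDr.
by rewrite scaler_sumr; apply: eq_bigr => i _; rewrite mxE [RHS]mulrCA.
Qed.

Lemma holpoly_strict P x : holpoly P -> exists G, strict_on setT P x (grad_form G).
Proof.
elim=> [c|i|P1 P2 _ [G1 H1] _ [G2 H2]|P1 P2 _ [G1 H1] _ [G2 H2]].
- exists 0; split; first exact: grad_form_rlinear.
  move=> e e0; exists 1; split => // y y' _ _ _ _.
  rewrite /grad_form big1 => [|i _]; last by rewrite mxE mul0r.
  by rewrite !subrr mag0 mulr_ge0 ?mag_ge0// ltW.
- exists (delta_mx 0 i); split; first exact: grad_form_rlinear.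
  move=> e e0; exists 1; split => // y y' _ _ _ _.
  rewrite /grad_form (bigD1 i)//= big1 => [|j ji]; last by rewrite mxE eqxx (negPf ji) mul0r.
  by rewrite !mxE !eqxx mul1r addr0 subrr mag0 mulr_ge0 ?mag_ge0// ltW.
- exists (G1 + G2); apply: strict_on_eq (strict_onD H1 H2) _ => w.
  by rewrite /grad_form -big_split/=; apply: eq_bigr => i _; rewrite mxE mulrDl.
- exists (P1 x *: G2 + P2 x *: G1); apply: strict_on_eq (strict_onM (frame_rV R n) H1 H2) _ => w.
  rewrite /grad_form !mulr_sumr -big_split/=; apply: eq_bigr => i _.
  by rewrite !mxE; ring.
Qed.

End HolPoly.

(** * The jets of f at the origin are holomorphic *)

Section Jets.
Variable R : realType.
Notation K := (CC R).

(** If a holomorphic w is approximated to order M by a polynomial in z and conj z that is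
    homogeneous of degree M and contains conj z in each of its terms, then the coefficients of that
    polynomial sum to 0.  Indeed w = c z^M + O(z^(M+1)), so that c l^M = sum of
    l^a conj(l)^b C for mag l = 1; multiplied by conj(l)^M this reads c = sum of conj(l)^(2b) C.
    Averaging over roots of unity l gives c = 0, and l = 1 then gives the claim. *)
Lemma bihomogeneous_jet (r : R) (w : K -> K) (M : nat) (T : eqType) (s : seq T) (Q : pred T)
    (a b : T -> nat) (C : T -> K) : 0 < r -> vord r 0 w ->
  (forall m, Q m -> (0 < b m)%N /\ (a m + b m = M)%N) ->
  (forall e : R, 0 < e -> exists d : R, 0 < d /\ forall z, mag z <= d ->
    mag (w z - \sum_(m <- s | Q m) z ^+ a m * Num.conj z ^+ b m * C m) <= e * mag z ^+ M) ->
  \sum_(m <- s | Q m) C m = 0.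
Proof.
move=> r0 Hw HQ H.
pose S (z : K) := \sum_(m <- s | Q m) z ^+ a m * Num.conj z ^+ b m * C m.
pose B := \sum_(m <- s | Q m) mag (C m).
have B0 : 0 <= B by apply: sumr_ge0 => m _; exact: mag_ge0.
have SB z : mag (S z) <= B * mag z ^+ M.
  apply: le_trans (mag_sum _ _ _) _; rewrite /B mulr_suml; apply: ler_sum => m Qm.
  have [_ abM] := HQ m Qm.
  by rewrite !magM !magX mag_conj -exprD abM mulrC.
(* w is of order M because the approximating polynomial is homogeneous of degree M. *)
have wM : vord r M w.
  case: M HQ H @S @B B0 SB => [|M] HQ H S B B0 SB //.
  apply: vord_littleo => // e e0.
  have [d [d0 Hd]] := H _ ltr01.
  exists (Num.min d (e / (B + 1))); split; first by rewrite lt_min d0 divr_gt0//; lra.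
  move=> z; rewrite le_min ler_pdivlMr; last lra.
  move=> /andP[/Hd h1 h2].
  have := SB z; have := magD (w z - S z) (S z); rewrite subrK.
  have zM := exprn_ge0 M (mag_ge0 z); rewrite !exprSr mul1r in h1 *.
  move: h1; rewrite -/(S z); nra.
have [c Hc] := vord_lead r0 wM.
have key (l : K) : mag l = 1 -> c * l ^+ M = S l.
  move=> l1; apply/eqP; rewrite -subr_eq0; apply/eqP/mag_eq0.
  apply/eqP; rewrite eq_le mag_ge0 andbT; apply/ler_addgt0Pr => e e0; rewrite add0r.
  have [D [D0 HD]] := vord_bigO r0 Hc.
  have e2 : 0 < e / 2 by lra.
  have [d [d0 Hd]] := H _ e2.
  pose t := Num.min (r / 2) (Num.min d (e / 2 / D)).
  have t0 : 0 < t by rewrite !lt_min d0 !divr_gt0.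
  have [t1 t2 t3] : [/\ t <= r / 2, t <= d & t <= e / 2 / D].
    by rewrite /t !ge_min !lexx !orbT.
  pose tc : K := (t%:C)%C; have tcJ : Num.conj tc = tc by apply/CrealP/complex_realP; exists t.
  have mtc : mag tc = t by rewrite mag_real ger0_norm// ltW.
  have mtl : mag (tc * l) = t by rewrite magM l1 mulr1.
  have := HD (tc * l); have := Hd (tc * l); rewrite !mtl => /(_ t2) h1 /(_ t1) h2.
  have St : S (tc * l) = tc ^+ M * S l.
    rewrite /S mulr_sumr; apply: eq_bigr => m Qm; have [_ <-] := HQ m Qm.
    have -> : Num.conj (tc * l) = tc * Num.conj l by rewrite -{2}tcJ; exact: rmorphM.
    by rewrite !exprMn exprD; ring.
  have tM : 0 < t ^+ M by exact: exprn_gt0.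
  rewrite -/(S _) St in h1; rewrite exprMn in h2.
  rewrite -(ler_pM2l tM).
  have -> : t ^+ M * mag (c * l ^+ M - S l) = mag ((w (tc * l) - tc ^+ M * S l) -
     (w (tc * l) - c * (tc ^+ M * l ^+ M))).
    by rewrite -{1}mtc -magX -magM; congr mag; ring.
  apply: le_trans (magB _ _) _; apply: le_trans (lerD h1 h2) _.
  rewrite ler_pdivlMr// in t3; rewrite exprSr; nra.
have key2 (l : K) : mag l = 1 -> c = \sum_(m <- s | Q m) Num.conj l ^+ (2 * b m) * C m.
  move=> l1; have ll : l * Num.conj l = 1 by rewrite -normCK -magE l1 rmorph1 expr1n.
  rewrite -[LHS]mulr1 -(expr1n _ M) -ll exprMn mulrA key// /S mulr_suml; apply: eq_bigr => m Qm.
  have [_ <-] := HQ m Qm.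
  rewrite exprD mul2n -addnn exprD -[RHS]mul1r -(expr1n _ (a m)) -ll exprMn; ring.
(* N exceeds all the exponents 2 * b m > 0, so none of them is divisible by N. *)
pose N := (\max_(m <- s | Q m) (2 * b m)).+1.
have c0 : c = 0.
  have : N%:R * c = 0.
    rewrite mulr_natl -[in LHS](card_ord N) -sumr_const.
    rewrite (eq_bigr (fun k :
      'I_N => \sum_(m <- s | Q m) Num.conj (root_unity R N ^+ k) ^+ (2 * b m) * C m)).
      rewrite exchange_big/= big1_seq// => m /andP[Qm ms].
      rewrite -mulr_suml (eq_bigr (fun k : 'I_N => Num.conj ((root_unity R N ^+ (2 * b m)) ^+ k))).
        rewrite -rmorph_sum sum_root_unity// ifN ?rmorph0 ?mul0r//.
        apply/negP => /dvdn_leq; rewrite muln_gt0/= (HQ m Qm).1 => /(_ isT).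
        by apply/negP; rewrite -ltnNge /N ltnS (@leq_bigmax_seq _ s Q (fun m => (2 * b m)%N)).
      by move=> k _; rewrite !rmorphXn -!exprM mulnC.
    by move=> k _; apply: key2; rewrite magX mag_root_unity expr1n.
  by move/eqP; rewrite mulf_eq0 pnatr_eq0 /= => /eqP.
rewrite -[RHS]c0 [RHS](key2 1 (mag1 R)); apply: eq_bigr => m _.
by rewrite rmorph1 expr1n mul1r.
Qed.

Variable n : nat.
Notation sph := (@sphere R n).

(** f - P = o(|x|^k) at the origin. *)
Definition agree (k : nat) (f P : 'rV[K]_n -> K) := forall e : R, 0 < e ->
  exists d : R, 0 < d /\ forall x, mag x <= d -> mag (f x - P x) <= e * mag x ^+ k.

Lemma conj_continuous (x : K) : {for x, continuous (Num.conj : K -> K)}.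
Proof.
apply/continuous_mag => e e0; exists e; split => // y.
by rewrite -rmorphB mag_conj.
Qed.

Lemma continuous_prod (I : Type) (s : seq I) (F : I -> 'rV[K]_n -> K) x :
  (forall i, {for x, continuous (F i)}) -> {for x, continuous (fun y => \prod_(i <- s) F i y)}.
Proof.
move=> HF; elim: s => [|i s IH].
  have -> : (fun y => \prod_(i <- [::]) F i y) = cst 1 by apply/funext => y; rewrite big_nil.
  exact: cst_continuous.
have -> : (fun y => \prod_(j <- i :: s) F j y) = (fun y => F i y * \prod_(j <- s) F j y).
  by apply/funext => y; rewrite big_cons.
exact: (cvgM (HF i) IH).
Qed.

Lemma continuousX (F : 'rV[K]_n -> K) k x :
  {for x, continuous F} -> {for x, continuous (fun y => F y ^+ k)}.
Proof.
move=> HF; have -> : (fun y => F y ^+ k) = (fun y => \prod_(i < k) F y).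
  by apply/funext => y; rewrite prodr_const card_ord.
exact: continuous_prod.
Qed.

Lemma prodX_sum (S : comNzRingType) (I : finType) (c : S) (e : I -> nat) :
  \prod_i c ^+ e i = c ^+ (\sum_i e i)%N.
Proof. by elim/big_rec2: _ => // i a b _ ->; rewrite exprD. Qed.

Section Term.
Variable p : mpoly.mpoly (n + n) K.
Notation N := (size (mpoly.msupp p)).
Implicit Types m : 'I_N.
Definition monom m := tnth (in_tuple (mpoly.msupp p)) m.
Definition mexp m := mpoly.fun_of_multinom (monom m).

Definition hdeg m := (\sum_(i < n) mexp m (lshift n i))%N.
Definition adeg m := (\sum_(i < n) mexp m (rshift n i))%N.
Definition zterm m (x : 'rV[K]_n) : K := mpoly.mcoeff (monom m) p *
  ((\prod_(i < n) x 0 i ^+ mexp m (lshift n i)) *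
    (\prod_(i < n) Num.conj (x 0 i) ^+ mexp m (rshift n i))).

Lemma zzbar_evalE x : zzbar_eval p x = \sum_(m : 'I_N) zterm m x.
Proof.
rewrite /zzbar_eval mpoly.mevalE big_tnth; apply: eq_bigr => m _; rewrite /zterm big_split_ord/=.
congr (_ * (_ * _)); apply: eq_bigr => i _; first by rewrite row_mxEl.
by rewrite row_mxEr mxE.
Qed.

Lemma zterm_scale m (c : K) x : zterm m (c *: x) = c ^+ hdeg m * Num.conj c ^+ adeg m * zterm m x.
Proof.
rewrite /zterm /hdeg /adeg -!prodX_sum.
have -> : \prod_(i < n) (c *: x) 0 i ^+ mexp m (lshift n i) =
   (\prod_i c ^+ mexp m (lshift n i)) * \prod_i x 0 i ^+ mexp m (lshift n i).
  by rewrite -big_split; apply: eq_bigr => i _; rewrite mxE exprMn.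
have -> : \prod_(i < n) Num.conj ((c *: x) 0 i) ^+ mexp m (rshift n i) =
   (\prod_i Num.conj c ^+ mexp m (rshift n i)) * \prod_i Num.conj (x 0 i) ^+ mexp m (rshift n i).
  by rewrite -big_split; apply: eq_bigr => i _; rewrite mxE rmorphM exprMn.
ring.
Qed.

Lemma zterm_continuous m y : {for y, continuous (zterm m)}.
Proof.
apply: continuousM; first exact: cst_continuous.
apply: continuousM; apply: continuous_prod => i; apply: continuousX.
  exact: coord_continuous.
apply: (@continuous_comp _ _ _ (fun x : 'rV[K]_n => x 0 i : K) (Num.conj : K -> K)).
  exact: coord_continuous.
exact: conj_continuous.
Qed.

Lemma zterm_equicontinuous (y : 'rV[K]_n) (e : R) : 0 < e ->
  exists d : R, 0 < d /\ forall x, mag (x - y) < d -> forall m, mag (zterm m x - zterm m y) <= e.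
Proof.
move=> e0; pose P (m : 'I_N) x : Prop := mag (zterm m x - zterm m y) <= e.
suff H m : \forall x \near y, P m x by apply/near_mag; exact: (@filter_forall _ _ P (nbhs y) _ H).
apply/near_mag; have /continuous_mag/(_ _ e0)[d [d0 H]] := @zterm_continuous m y.
by exists d; split => // x /H/ltW.
Qed.

Lemma mag_prod (I : Type) (s : seq I) (F : I -> K) : mag (\prod_(i <- s) F i) =
  \prod_(i <- s) mag (F i).
Proof. by elim/big_rec2: _ => [|i a b _ <-]; rewrite ?mag1 ?magM. Qed.

Lemma zterm_bound m x : mag (zterm m x) <=
  mag (mpoly.mcoeff (monom m) p) * mag x ^+ (hdeg m + adeg m).
Proof.
have H (e : 'I_n -> nat) (F : 'I_n -> K) : (forall i, mag (F i) <= mag x) ->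
    mag (\prod_i F i ^+ e i) <= mag x ^+ (\sum_i e i)%N.
    move=> HF; rewrite mag_prod -prodX_sum; apply: ler_prod => i _.
    by rewrite magX exprn_ge0 ?mag_ge0//= lerXn2r// nnegrE mag_ge0.
rewrite /zterm !magM exprD ler_wpM2l ?mag_ge0//; apply: ler_pM; rewrite ?mag_ge0//.
  by apply: H => i; exact: mag_coord.
by apply: H => i; rewrite mag_conj; exact: mag_coord.
Qed.

Lemma zterm_holpoly m : adeg m = 0%N -> holpoly (zterm m).
Proof.
move=> /eqP; rewrite /adeg sum_nat_eq0 => /forallP a0.
apply: holpolyM; first exact: holpoly_cst.
apply: (@holpoly_ext _ _ (fun x => \prod_(i < n) x 0 i ^+ mexp m (lshift n i))).
  by apply: holpoly_prod => i; apply: holpolyX; exact: holpoly_coord.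
move=> x; rewrite [X in _ * X]big1 ?mulr1// => i _.
by have /eqP -> := a0 i; rewrite expr0.
Qed.

Definition hol_part (x : 'rV[K]_n) : K := \sum_(m : 'I_N | adeg m == 0%N) zterm m x.

Lemma hol_part_holpoly : holpoly hol_part.
Proof. by apply: holpoly_sum => m /eqP; exact: zterm_holpoly. Qed.

Variables (f : 'rV[K]_n -> K) (k : nat) (r : R).
Hypothesis fp : agree k f (zzbar_eval p).
Hypothesis r0 : 0 < r.
Variables (U : 'rV[K]_n -> K -> 'rV[K]_n) (rho : 'rV[K]_n -> R).
Hypothesis rho0 : forall v, sph v -> 0 < rho v.
Hypothesis U_vord : forall v i, sph v -> vord r 0 (fun z => U v z 0 i : K).
Hypothesis fU_vord : forall v, sph v -> vord r 0 (fun z => f (U v z)).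
Hypothesis U_deriv : forall v, sph v -> forall e : R, 0 < e -> exists d : R, 0 < d /\
  forall z, mag z <= d -> mag (U v z - z *: (((rho v)%:C)%C *: v)) <= e * mag z.

(** Along the leaf of v, f minus the holomorphic part of its jet is holomorphic, and by the induction
    hypothesis it agrees to order M with the terms of degree M that contain a conjugate.  Since
    U v z = z y + o(z), these are the terms z^hdeg conj(z)^adeg zterm(y), so that
    [bihomogeneous_jet] applies. *)
Lemma term_sum_sphere M v : (M <= k)%N -> sph v ->
  (forall y, \sum_(m : 'I_N | (0 < adeg m)%N && (hdeg m + adeg m < M)%N) zterm m y = 0) ->
  \sum_(m : 'I_N | (0 < adeg m)%N && (hdeg m + adeg m == M)%N)
     zterm m ((((rho v)%:C)%C : K) *: v) = 0.
Proof.
move=> Mk vs IH; set y := _ *: v; 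
apply: (@bihomogeneous_jet r (fun z => f (U v z) - hol_part (U v z)) M _ (index_enum 'I_N)
  (fun m => (0 < adeg m)%N && (hdeg m + adeg m == M)%N) hdeg adeg (fun m => zterm m y)) => //.
- apply: vordB; first exact: fU_vord.
  by apply: holpoly_vord; [exact: hol_part_holpoly|move=> i; exact: U_vord].
- by move=> m /andP[a0 /eqP].
move=> e e0.
pose Y : R := mag y + 1; have Y0 : 0 < Y by have := mag_ge0 y; rewrite /Y; lra.
pose B := \sum_(m : 'I_N) mag (mpoly.mcoeff (monom m) p) * Y ^+ (hdeg m + adeg m).
have B0 : 0 <= B by apply: sumr_ge0 => m _; rewrite mulr_ge0 ?mag_ge0 ?exprn_ge0// ltW.
have Yk : 0 < Y ^+ k by exact: exprn_gt0.
have e1 : 0 < e / 3 / Y ^+ k by rewrite !divr_gt0.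
have sz : 0 < N%:R + 1 :> R by rewrite ltr_wpDl.
have e2 : 0 < e / 3 / (N%:R + 1) by rewrite !divr_gt0.
have [d1 [d10 H1]] := fp e1.
have [d2 [d20 H2]] : exists d, 0 < d /\ forall x, mag (x - y) < d ->
    forall m, mag (zterm m x - zterm m y) <= e / 3 / (N%:R + 1).
  exact: zterm_equicontinuous.
have d31 : 0 < Num.min (d2 / 2) 1 by rewrite lt_min ltr01 andbT; lra.
have [d3 [d30 H3]] := U_deriv vs d31.
exists (Num.min (Num.min 1 d3) (Num.min (d1 / Y) (e / 3 / (B + 1)))); split.
  by rewrite !lt_min ltr01 d30 !divr_gt0//; lra.
move=> z; rewrite !le_min => /andP[/andP[z1 z3] /andP[]].
rewrite ler_pdivlMr// => zd1; rewrite ler_pdivlMr; last lra.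
move=> zB; have mz := mag_ge0 z.
pose q := if z == 0 then y else z^-1 *: U v z.
have h3 := H3 _ z3.
have Uq : U v z = z *: q.
  rewrite /q; case: eqP => [z0|/eqP z0]; last by rewrite scalerA divff// scale1r.
  by move: h3; rewrite z0 !scale0r subr0 mag0 mulr0 => h; apply: mag_eq0; apply/eqP;
    rewrite eq_le h mag_ge0.
have qy : mag (q - y) <= Num.min (d2 / 2) 1.
  rewrite /q; case: eqP => [_|/eqP z0]; first by rewrite subrr mag0 ltW.
  have -> : z^-1 *: U v z - y = z^-1 *: (U v z - z *: y).
    by rewrite scalerBr scalerA mulVf// scale1r.
  by rewrite magZ magV ler_pdivrMl ?mag_gt0// mulrC.
have qd2 : mag (q - y) < d2.
  by apply: (@le_lt_trans _ _ (d2 / 2)); [apply: le_trans qy _; rewrite ge_min lexx|lra].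
have qY : mag q <= Y.
  rewrite -[q](subrK y) /Y [leRHS]addrC; apply: le_trans (magD _ _) (lerD _ (lexx _)).
  by apply: le_trans qy _; rewrite ge_min lexx orbT.
have UY : mag (U v z) <= mag z * Y by rewrite Uq magZ ler_wpM2l.
have h1 := H1 _ (le_trans UY zd1).
rewrite zzbar_evalE in h1.
pose T1 := f (U v z) - \sum_(m : 'I_N) zterm m (U v z).
pose T2 := \sum_(m : 'I_N | (0 < adeg m)%N && (hdeg m + adeg m == M)%N)
   z ^+ hdeg m * Num.conj z ^+ adeg m * (zterm m q - zterm m y).
pose T3 := \sum_(m : 'I_N | (0 < adeg m)%N && (M < hdeg m + adeg m)%N) zterm m (U v z).
have -> : f (U v z) - hol_part (U v z) -
  \sum_(m : 'I_N | (0 < adeg m)%N && (hdeg m + adeg m == M)%N)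
    z ^+ hdeg m * Num.conj z ^+ adeg m * zterm m y = T1 + T2 + T3.
  have -> : T2 = \sum_(m : 'I_N | (0 < adeg m)%N && (hdeg m + adeg m == M)%N) zterm m (U v z)
     - \sum_(m : 'I_N | (0 < adeg m)%N && (hdeg m + adeg m == M)%N) z ^+ hdeg m *
       Num.conj z ^+ adeg m * zterm m y.
    rewrite /T2 -sumrB; apply: eq_bigr => m _.
    have -> : zterm m (U v z) = z ^+ hdeg m * Num.conj z ^+ adeg m * zterm m q.
      by rewrite {1}Uq zterm_scale.
    exact: mulrBr.
  have E : \sum_(m : 'I_N) zterm m (U v z) = hol_part (U v z) +
     (\sum_(m : 'I_N | (0 < adeg m)%N && (hdeg m + adeg m == M)%N) zterm m (U v z) + T3).
    rewrite (bigID (fun m => adeg m == 0%N))/=; congr (_ + _).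
    under eq_bigl do rewrite -lt0n.
    rewrite (bigID (fun m => (hdeg m + adeg m < M)%N))/= IH add0r.
    rewrite (bigID (fun m => (hdeg m + adeg m == M)%N))/=; congr (_ + _); apply: eq_bigl => m.
      by case: (0 < adeg m)%N => //=; rewrite -leqNgt; case: ltngtP.
    by case: (0 < adeg m)%N => //=; rewrite -leqNgt; case: ltngtP.
  have aux (a1 a2 a3 a4 a5 : K) : a1 - a2 - a3 = a1 - (a2 + (a5 + a4)) + (a5 - a3) + a4 by ring.
  by rewrite /T1 E; exact: aux.
have zM0 := exprn_ge0 M mz.
have b1 : mag T1 <= e / 3 * mag z ^+ M.
  apply: le_trans h1 _.
  have -> : e / 3 * mag z ^+ M = e / 3 / Y ^+ k * (Y ^+ k * mag z ^+ M).
    by rewrite mulrA divfK// lt0r_neq0.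
  rewrite ler_wpM2l ?(ltW e1)//.
  apply: le_trans (_ : (mag z * Y) ^+ k <= _).
    by apply: lerXn2r => //; rewrite nnegrE ?mulr_ge0 ?mag_ge0// ltW.
  by rewrite exprMn mulrC ler_wpM2l ?(ltW Yk)// ler_wiXn2l.
have b2 : mag T2 <= e / 3 * mag z ^+ M.
  apply: le_trans (mag_sum _ _ _) _.
  apply: (@le_trans _ _ (\sum_(m : 'I_N) e / 3 / (N%:R + 1) * mag z ^+ M)).
    rewrite big_mkcond/=; apply: ler_sum => m _.
    case: ifP => [/andP[_ /eqP dM]|_]; last by rewrite mulr_ge0// ltW.
    rewrite !magM !magX mag_conj -exprD dM mulrC ler_wpM2r//.
    exact: H2.
  rewrite sumr_const card_ord -[leLHS]mulr_natl.
  have -> : e / 3 * mag z ^+ M = (N%:R + 1) * (e / 3 / (N%:R + 1) * mag z ^+ M).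
    by rewrite [RHS]mulrA [_ * (e / 3 / _)]mulrC divfK// lt0r_neq0.
  by rewrite ler_wpM2r ?lerDl// mulr_ge0// ltW.
have b3 : mag T3 <= e / 3 * mag z ^+ M.
  apply: le_trans (mag_sum _ _ _) _.
  apply: (@le_trans _ _ (mag z ^+ M.+1 * B)).
    rewrite /B mulr_sumr [leRHS](bigID (fun m => (0 < adeg m)%N && (M < hdeg m + adeg m)%N))/=.
    apply: ler_wpDr.
      by apply: sumr_ge0 => m _; rewrite !mulr_ge0 ?exprn_ge0 ?mag_ge0// ltW.
    apply: ler_sum => m /andP[_ dM]; apply: le_trans (zterm_bound m _) _.
    rewrite mulrCA ler_wpM2l ?mag_ge0//.
    apply: le_trans (_ : (mag z * Y) ^+ (hdeg m + adeg m) <= _).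
      by apply: lerXn2r => //; rewrite nnegrE ?mulr_ge0 ?mag_ge0// ltW.
    by rewrite exprMn ler_wpM2r ?exprn_ge0 ?(ltW Y0)// ler_wiXn2l.
  rewrite exprSr -mulrA mulrC ler_wpM2r//.
  nra.
apply: le_trans (magD _ _) _; apply: le_trans (lerD (magD _ _) (lexx _)) _.
have -> : e * mag z ^+ M = e / 3 * mag z ^+ M + e / 3 * mag z ^+ M + e / 3 * mag z ^+ M by field.
exact: lerD (lerD b1 b2) b3.
Qed.

(** Each nonzero vector is a positive multiple of some rho(v) v, and the terms are homogeneous. *)
Lemma term_sum_eq0 M : (M <= k.+1)%N -> forall y,
  \sum_(m : 'I_N | (0 < adeg m)%N && (hdeg m + adeg m < M)%N) zterm m y = 0.
Proof.
elim: M => [_ y|M IH Mk y].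
  by rewrite big1// => m; rewrite ltn0 andbF.
rewrite (bigID (fun m => (hdeg m + adeg m < M)%N))/=.
rewrite (eq_bigl (fun m => (0 < adeg m)%N && (hdeg m + adeg m < M)%N)) ?IH ?add0r; last first.
- by move=> m; case: (0 < adeg m)%N => //=; rewrite ltnS; case: ltngtP.
- exact: ltnW.
rewrite (eq_bigl (fun m => (0 < adeg m)%N && (hdeg m + adeg m == M)%N)); last first.
  by move=> m; case: (0 < adeg m)%N => //=; rewrite ltnS -leqNgt; case: ltngtP.
have [->|y0] := eqVneq y 0.
  apply: big1 => m /andP[a0 _].
  by rewrite -(scale0r 0) zterm_scale rmorph0 [0 ^+ adeg m]expr0n eqn0Ngt a0 mulr0 mul0r.
pose S : R := Num.sqrt (sqlen y).
have S0 : 0 < S.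
  rewrite sqrtr_gt0 lt0r sqlen_ge0 andbT; apply: contraNneq y0 => q0.
  apply/eqP/rowP => i; rewrite mxE; apply: mag_eq0.
  move/eqP: q0; rewrite /sqlen psumr_eq0; last by move=> j _; exact: sqr_ge0.
  by move=> /allP/(_ i); rewrite mem_index_enum => /(_ isT)/= /eqP/eqP; rewrite expf_eq0 => /eqP.
pose v : 'rV[K]_n := (((S^-1)%:C)%C : K) *: y.
have vs : sph v.
  rewrite /sphere /=.
  under eq_bigr do rewrite mxE normrM exprMn.
  rewrite -mulr_sumr -sqlenE -magE mag_real -rmorphXn -rmorphM
    -[RHS](rmorph1 (@real_complex_def R (Phant R))).
  congr (_%:C)%C; rewrite ger0_norm ?invr_ge0 ?(ltW S0)// -(sqr_sqrtr (sqlen_ge0 y)) -/S.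
  by rewrite -exprMn mulVf ?expr1n// lt0r_neq0.
have rv := rho0 vs.
pose c : K := ((S / rho v)%:C)%C.
have yE : y = c *: (((rho v)%:C)%C *: v).
  rewrite /c /v !scalerA -!rmorphM divfK ?lt0r_neq0// mulfV ?lt0r_neq0//.
  by rewrite rmorph1 scale1r.
have cJ : Num.conj c = c by apply/CrealP/complex_realP; exists (S / rho v).
rewrite yE.
rewrite (eq_bigr (fun m => c ^+ M * zterm m (((rho v)%:C)%C *: v))); last first.
  by move=> m /andP[_ /eqP <-]; rewrite zterm_scale cJ exprD.
by rewrite -mulr_sumr term_sum_sphere ?mulr0//; apply: IH; exact: ltnW.
Qed.

Lemma hol_part_agree : agree k f hol_part.
Proof.
move=> e e0.
pose B := \sum_(m : 'I_N) mag (mpoly.mcoeff (monom m) p).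
have B0 : 0 <= B by apply: sumr_ge0 => m _; exact: mag_ge0.
have e2 : 0 < e / 2 by lra.
have [d [d0 Hd]] := fp e2.
exists (Num.min (Num.min 1 d) (e / 2 / (B + 1))); split.
  by rewrite !lt_min ltr01 d0 divr_gt0//; lra.
move=> x; rewrite !le_min => /andP[/andP[x1 /Hd h1]]; rewrite ler_pdivlMr; last lra.
move=> xB; have mx := mag_ge0 x.
pose T3 := \sum_(m : 'I_N | (0 < adeg m)%N && (k < hdeg m + adeg m)%N) zterm m x.
have -> : f x - hol_part x = (f x - zzbar_eval p x) + T3.
  have -> : zzbar_eval p x = hol_part x + T3.
    rewrite zzbar_evalE (bigID (fun m => adeg m == 0%N))/=; congr (_ + _).
    under eq_bigl do rewrite -lt0n.
    rewrite (bigID (fun m => (hdeg m + adeg m < k.+1)%N))/= term_sum_eq0// add0r.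
    by apply: eq_bigl => m; rewrite ltnS -ltnNge.
  by ring.
have xk := exprn_ge0 k mx.
have b3 : mag T3 <= e / 2 * mag x ^+ k.
  apply: le_trans (mag_sum _ _ _) _.
  apply: (@le_trans _ _ (mag x ^+ k.+1 * B)).
    rewrite /B mulr_sumr [leRHS](bigID (fun m => (0 < adeg m)%N && (k < hdeg m + adeg m)%N))/=.
    apply: ler_wpDr.
      by apply: sumr_ge0 => m _; rewrite !mulr_ge0 ?exprn_ge0 ?mag_ge0.
    apply: ler_sum => m /andP[_ dM]; apply: le_trans (zterm_bound m _) _.
    by rewrite mulrC ler_wpM2r ?mag_ge0// ler_wiXn2l.
  rewrite exprSr -mulrA mulrC ler_wpM2r//.
  nra.
apply: le_trans (magD _ _) _.
have -> : e * mag x ^+ k = e / 2 * mag x ^+ k + e / 2 * mag x ^+ k by field.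
exact: lerD h1 b3.
Qed.

End Term.

End Jets.

(** * Leading terms of scalar and matrix functions *)

Section Lead.
Variable R : realType.
Notation K := (CC R).
Implicit Types (r : R) (u w : K -> K).

Lemma lead_vord r m c u : lead r m c u -> vord r m u.
Proof.
move=> /(vord_le (leqnSn m)) H.
by apply: vord_ext (vordD H (vordZX r m c)) => z _; rewrite subrK.
Qed.

Lemma lead_ext r m c u w : (forall z, mag z <= r -> u z = w z) -> lead r m c u -> lead r m c w.
Proof. by move=> uw; apply: vord_ext => z zr; rewrite uw. Qed.

(** The leading terms multiply; the error terms are of order a + b + 1. *)
Lemma leadM r a b c d u w : lead r a c u -> lead r b d w ->
  lead r (a + b) (c * d) (fun z => u z * w z).
Proof.
move=> Hu Hw.
have H1 := vordM Hu (lead_vord Hw); have H2 := vordM (vordZX r a c) Hw.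
rewrite addnS in H2.
apply: vord_ext (vordD H1 H2) => z _; rewrite exprD; ring.
Qed.

Lemma leadD r m c d u w : lead r m c u -> lead r m d w -> lead r m (c + d) (fun z => u z + w z).
Proof. by move=> Hu Hw; apply: vord_ext (vordD Hu Hw) => z _; ring. Qed.

Lemma lead_cst r c : lead r 0 c (fun=> c).
Proof. by apply: vord_ext (vord0 r 1) => z _; rewrite expr0 mulr1 subrr. Qed.

Lemma lead_sum r m (I : Type) (s : seq I) (P : pred I) (c : I -> K) (u : I -> K -> K) :
  (forall i, P i -> lead r m (c i) (u i)) ->
  lead r m (\sum_(i <- s | P i) c i) (fun z => \sum_(i <- s | P i) u i z).
Proof.
move=> H; apply: vord_ext (@vord_sum R r m.+1 I s P (fun i z => u i z - c i * z ^+ m) H) => z _.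
by rewrite sumrB mulr_suml.
Qed.

Lemma lead_prod r m n (c : 'I_n -> K) (u : 'I_n -> K -> K) : (forall i, lead r m (c i) (u i)) ->
  lead r (n * m) (\prod_i c i) (fun z => \prod_i u i z).
Proof.
elim: n c u => [|n IH] c u H.
  rewrite mul0n big_ord0; apply: lead_ext (lead_cst r 1) => z _; by rewrite big_ord0.
rewrite mulSn big_ord_recl.
have := leadM (H ord0) (IH _ _ (fun i => H (lift ord0 i))).
by apply: lead_ext => z _; rewrite big_ord_recl.
Qed.

Lemma lead_unique r m c d u : 0 < r -> lead r m c u -> lead r m d u -> c = d.
Proof.
move=> r0 Hc Hd; apply/eqP; rewrite -subr_eq0; apply/eqP.
apply: (@lead_eq0 _ r m (fun=> 0) _ r0).
  by apply: vord_ext (vordB Hc Hd) => z _; ring.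
move=> e d' e0 d'0; exists ((d'%:C)%C); split; first by apply/eqP => /complexI d00;
  rewrite d00 ltxx in d'0.
by rewrite mag0 mag_real ger0_norm ?(ltW d'0)// mulr_ge0// ?exprn_ge0 ?(ltW d'0) ?(ltW e0).
Qed.

Lemma vord_det r n (F : K -> 'M[K]_n) : (forall i j, vord r 0 (fun z => F z i j)) ->
  vord r 0 (fun z => \det (F z)).
Proof.
move=> H; apply: vord_sum => s _; apply: vordZ.
suff P m (u : 'I_m -> K -> K) : (forall i, vord r 0 (u i)) -> vord r 0 (fun z => \prod_i u i z).
  by apply: P => i; exact: H.
elim: m u => [|m IH] u Hu.
  by apply: vord_ext (vord_cst r 1) => z _; rewrite big_ord0.
by apply: vord_ext (@vordM _ _ 0 0 _ _ (Hu ord0) (IH _ (fun i => Hu (lift ord0 i)))) => z _;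
  rewrite big_ord_recl.
Qed.

Definition mvord r m (p q : nat) (F : K -> 'M[K]_(p, q)) := forall i j, vord r m (fun z => F z i j).
Definition mlead r m (p q : nat) (C : 'M[K]_(p, q)) (F : K -> 'M[K]_(p, q)) :=
  forall i j, lead r m (C i j) (fun z => F z i j).

Lemma mvord_mul r a b p q s (F : K -> 'M[K]_(p, q)) (G : K -> 'M[K]_(q, s)) :
  mvord r a F -> mvord r b G -> mvord r (a + b) (fun z => F z *m G z).
Proof.
move=> HF HG i j; apply: (@vord_ext _ _ _ (fun z => \sum_k F z i k * G z k j)).
  by move=> z _; rewrite mxE.
by apply: vord_sum => k _; exact: vordM.
Qed.

Lemma mvord_scale r a b p q (u : K -> K) (F : K -> 'M[K]_(p, q)) :
  vord r a u -> mvord r b F -> mvord r (a + b) (fun z => u z *: F z).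
Proof.
move=> Hu HF i j; apply: vord_ext (vordM Hu (HF i j)) => z _; by rewrite mxE.
Qed.

Lemma mvordB r m p q (F G : K -> 'M[K]_(p, q)) :
  mvord r m F -> mvord r m G -> mvord r m (fun z => F z - G z).
Proof. by move=> HF HG i j; apply: vord_ext (vordB (HF i j) (HG i j)) => z _; rewrite !mxE. Qed.

Lemma mvord_adj r n (F : K -> 'M[K]_n) : mvord r 0 F -> mvord r 0 (fun z => \adj (F z)).
Proof.
move=> H i j; apply: (@vord_ext _ _ _ (fun z => (-1) ^+ (j + i) * \det (row' j (col' i (F z))))).
  by move=> z _; rewrite mxE.
apply: vordZ; apply: vord_det => k l.
by apply: vord_ext (H (lift j k) (lift i l)) => z _; rewrite !mxE.
Qed.

Lemma mlead_mul r a b p q s (C : 'M[K]_(p, q)) (D : 'M[K]_(q, s)) F G :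
  mlead r a C F -> mlead r b D G -> mlead r (a + b) (C *m D) (fun z => F z *m G z).
Proof.
move=> HF HG i j; rewrite mxE; apply: (@lead_ext _ _ _ (fun z => \sum_k F z i k * G z k j)).
  by move=> z _; rewrite mxE.
by apply: lead_sum => k _; exact: leadM.
Qed.

Lemma mlead_scale r a b p q c (u : K -> K) (C : 'M[K]_(p, q)) F :
  lead r a c u -> mlead r b C F -> mlead r (a + b) (c *: C) (fun z => u z *: F z).
Proof.
move=> Hu HF i j; rewrite mxE; apply: lead_ext (leadM Hu (HF i j)) => z _; by rewrite mxE.
Qed.

Lemma mleadB r m p q (C D : 'M[K]_(p, q)) F G :
  mlead r m C F -> mlead r m D G -> mlead r m (C - D) (fun z => F z - G z).
Proof.
move=> HF HG i j; rewrite !mxE.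
have := leadD (HF i j) (leadM (lead_cst r (-1)) (HG i j)).
by rewrite mulN1r; apply: lead_ext => z _; rewrite !mxE mulN1r.
Qed.

Lemma lead_det r m n (C : 'M[K]_n) F : mlead r m C F ->
  lead r (n * m) (\det C) (fun z => \det (F z)).
Proof.
move=> H; apply: lead_sum => s _.
apply: (@leadM r 0 (n * m)); first exact: lead_cst.
by apply: lead_prod => i; exact: H.
Qed.

Lemma mlead_adj r m n (C : 'M[K]_n) F : mlead r m C F ->
  mlead r (n.-1 * m) (\adj C) (fun z => \adj (F z)).
Proof.
move=> H i j; rewrite mxE;
  apply: (@lead_ext _ _ _ (fun z => (-1) ^+ (j + i) * \det (row' j (col' i (F z))))).
  by move=> z _; rewrite mxE.
have := leadM (lead_cst r ((-1) ^+ (j + i)))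
  (@lead_det r m _ (row' j (col' i C)) (fun z => row' j (col' i (F z))) _).
rewrite add0n; apply => k l; rewrite !mxE.
by apply: lead_ext (H (lift j k) (lift i l)) => z _; rewrite !mxE.
Qed.

Lemma mlead_conj r m p q (C : 'M[K]_(p, q)) F : mlead r m C F ->
  mlead r m (map_mx Num.conj C) (fun z => map_mx Num.conj (F (Num.conj z))).
Proof.
move=> H i j; rewrite mxE; apply: vord_ext (vord_conj (H i j)) => z _.
by rewrite mxE rmorphB rmorphM rmorphXn; congr (_ - _ * _ ^+ _); exact: conjCK.
Qed.

Lemma mlead_dilate r r' m p q (y : K) (C : 'M[K]_(p, q)) F : mag y * r' <= r -> mlead r m C F ->
  mlead r' m (y ^+ m *: C) (fun z => F (y * z)).
Proof.
move=> yr H i j; rewrite mxE; apply: vord_ext (vord_dilate yr (H i j)) => z _.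
by rewrite exprMn; ring.
Qed.

(** Zeros on an interval to the right of c propagate, by the identity theorem, to the disc of radius
    d centered at c; repeating this with c - d / 4 reaches the origin in N steps. *)
Lemma zeros_to_origin (d : R) (k : K -> K) : 0 < d -> vord (1 + d) 0 k ->
  forall N (c eta : R), 0 <= c -> c <= 1 -> c <= N%:R * (d / 4) -> 0 < eta ->
  (forall t, c < t -> t < c + eta -> k (t%:C)%C = 0) ->
  exists eta', 0 < eta' /\ forall t, 0 < t -> t < eta' -> k (t%:C)%C = 0.
Proof.
move=> d0 Hk; elim=> [|N IH] c eta c0 c1 cN eta0 H.
  exists eta; split => // t t0 te; apply: H; lra.
have Hc : forall z : K, mag z < d -> k ((c%:C)%C + z) = 0.
  apply: (@vord_zeros _ d (fun z => k ((c%:C)%C + z)) eta d0 eta0).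
    by apply: vord_shift Hk; rewrite mag_real ger0_norm//; lra.
  by move=> t t0 te; rewrite -rmorphD; apply: H; lra.
pose c' := Num.max 0 (c - d / 4).
have c'0 : 0 <= c' by rewrite le_max lexx.
have cc' : c - d / 4 <= c' by rewrite le_max lexx orbT.
have c'c : c' <= c by rewrite ge_max c0/=; lra.
apply: (IH c' (d / 4)) => //; [lra| |lra|].
  rewrite ge_max mulr_ge0/= ?divr_ge0 ?(ltW d0)//; move: cN; rewrite -natr1 mulrDl mul1r; lra.
move=> t t1 t2.
have -> : ((t%:C)%C : K) = (c%:C)%C + ((t - c)%:C)%C by rewrite -rmorphD; congr (_%:C)%C; ring.
by apply: Hc; rewrite mag_real ltr_norml; apply/andP; split; lra.
Qed.

(** A function with a nonzero leading term is not identically zero near the origin. *)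
Lemma dense_nonzero (d : R) (k : K -> K) m (C : K) : 0 < d -> lead (1 + d) m C k -> C != 0 ->
  forall c eta : R, 0 <= c -> c <= 1 -> 0 < eta ->
  exists t, [/\ c < t, t < c + eta & k (t%:C)%C != 0].
Proof.
move=> d0 Hk C0 c eta c0 c1 eta0; apply/not_existsP => H.
have {}H t : c < t -> t < c + eta -> k (t%:C)%C = 0.
  by move=> ct te; apply/eqP; apply/negPn/negP => kt; apply: (H t).
pose N := Num.bound (c / (d / 4)).
have HN : c <= N%:R * (d / 4).
  by rewrite -ler_pdivrMr; [apply: ltW; apply: archi_boundP; rewrite divr_ge0//|]; lra.
have [e [e0 He]] := zeros_to_origin d0 (vord_le (leq0n m) (lead_vord Hk)) c0 c1 HN eta0 H.
have : C = 0; last by move/eqP; rewrite (negPf C0).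
apply: (lead_eq0 _ Hk); first lra.
move=> e1 d1 e10 d10; pose t := Num.min (e / 2) d1.
have t0 : 0 < t by rewrite lt_min d10 andbT; lra.
have te : t < e by apply: (@le_lt_trans _ _ (e / 2)); rewrite ?ge_min ?lexx//; lra.
exists ((t%:C)%C); split; first by apply/eqP => /complexI t00; rewrite t00 ltxx in t0.
rewrite He// mag0 mag_real ger0_norm ?(ltW t0)//; split; first by rewrite ge_min lexx orbT.
by rewrite mulr_ge0 ?exprn_ge0 ?(ltW e10) ?(ltW t0).
Qed.

End Lead.

(** * The linear system satisfied by the antiholomorphic part *)

Section DbarLinear.
Variable R : realType.
Notation K := (CC R).
Variable n : nat.
Hypothesis n0 : (0 < n)%N.

Variables (r : R) (M N : K -> 'M[K]_n) (d d' a b : K -> 'cV[K]_n) (A : nat -> K -> 'cV[K]_n)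
  (rho : K).
Hypothesis r0 : 0 < r.
Hypothesis rho0 : rho != 0.
Hypothesis M_lead : mlead r 1 (rho%:M) M.
Hypothesis N_lead : mlead r 1 (('i%C * rho)%:M) N.
Hypothesis d_jet : forall k, mvord r k (fun z => d z - M z *m A k z).
Hypothesis d'_jet : forall k, mvord r k (fun z => d' z - N z *m A k z).
Hypothesis dE : forall z, mag z < r -> d z = M z *m a z + map_mx Num.conj (M z) *m b z.
Hypothesis d'E : forall z, mag z < r -> d' z = N z *m a z + map_mx Num.conj (N z) *m b z.

Let M0 : mvord r 0 M. Proof. by move=> i j; apply: vord_le (lead_vord (M_lead i j)). Qed.
Let N0 : mvord r 0 N. Proof. by move=> i j; apply: vord_le (lead_vord (N_lead i j)). Qed.

(** Modulo terms of order k, d = M A_k and d' = N A_k, so that det(M) d' - N adj(M) d is of order k,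
    for each k.  The adjugate is used instead of the inverse since det M vanishes at 0. *)
Lemma adjugate_relation z : mag z < r -> \det (M z) *: d' z = N z *m \adj (M z) *m d z.
Proof.
move=> zr; apply/eqP; rewrite -subr_eq0; apply/eqP/colP => i; rewrite [RHS]mxE.
have flat k : mvord r k (fun z => \det (M z) *: d' z - N z *m \adj (M z) *m d z).
  have H1 := @mvord_scale _ r 0 k _ _ _ _ (vord_det M0) (d'_jet k).
  have H2 := @mvord_mul _ r 0 k _ _ _ _ _ (@mvord_mul _ r 0 0 _ _ _ _ _ N0 (mvord_adj M0))
    (d_jet k).
  rewrite add0n in H1 H2.
  move=> i' j; apply: vord_ext (mvordB H1 H2 i' j) => w _; congr (fun_of_matrix _ _ _).
  rewrite scalerBr mulmxBr -[N w *m _ *m (M w *m _)]mulmxA [\adj _ *m (_ *m _)]mulmxA mul_adj_mx.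
  by rewrite mul_scalar_mx -scalemxAr opprB addrA subrK.
apply: (@vord_flat _ r (fun z => (\det (M z) *: d' z - N z *m \adj (M z) *m d z) i 0)) => // k.
exact: flat.
Qed.

Definition dbar_mx z := \det (M z) *: map_mx Num.conj (N z) -
  N z *m \adj (M z) *m map_mx Num.conj (M z).

(** When d and d' are expressed by a and b in [adjugate_relation], the terms with a cancel because
    N adj(M) M a = det(M) N a. *)
Lemma dbar_mx_ker z : mag z < r -> dbar_mx z *m b z = 0.
Proof.
move=> zr; have := adjugate_relation zr; rewrite dE// d'E// /dbar_mx.
rewrite mulmxDr scalerDr !mulmxA -[N z *m _ *m M z]mulmxA mul_adj_mx mul_mx_scalar -scalemxAl.
move=> /addrI E; rewrite mulmxBl -scalemxAl; apply/eqP; rewrite subr_eq0; apply/eqP.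
by rewrite E.
Qed.

(** For real t, conj(M (t y)) is the value at t of the holomorphic function conj(M (conj(z) y)), so
    that det of [dbar_mx] at t y is a holomorphic function of t.  With M = rho z + ..., and
    N = i rho z + ... its leading coefficient is the determinant of a nonzero multiple of the
    identity: the two products in [dbar_mx] have the factors -i and i and do not cancel. *)
Lemma dbar_zeros_dense (y : K) (c eta : R) : y != 0 -> mag y < r -> 0 <= c -> c <= 1 -> 0 < eta ->
  exists t : R, [/\ c < t, t < c + eta, mag (y * (t%:C)%C) < r & b (y * (t%:C)%C) = 0].
Proof.
move=> y0 yr c0 c1 eta0; have my := mag_gt0 y0.
pose e := r / mag y - 1.
have e0 : 0 < e by rewrite subr_gt0 ltr_pdivlMr// mul1r.
have ye : mag y * (1 + e) <= r by rewrite /e addrC subrK mulrC divfK// lt0r_neq0.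
have iJ : Num.conj ('i%C : K) = - 'i%C by apply/eqP; rewrite eq_complex /= oppr0 !eqxx.
pose My z := M (y * z); pose Ny z := N (y * z).
pose Mb z := map_mx Num.conj (My (Num.conj z)); pose Nb z := map_mx Num.conj (Ny (Num.conj z)).
have HMy := mlead_dilate ye M_lead; have HNy := mlead_dilate ye N_lead.
have HMb := mlead_conj HMy; have HNb := mlead_conj HNy.
pose CM : 'M[K]_n := y ^+ 1 *: rho%:M; pose CMb := map_mx Num.conj CM.
have H2 := mlead_mul (mlead_mul HNy (mlead_adj HMy)) HMb.
rewrite (_ : 1 + n.-1 * 1 + 1 = n * 1 + 1)%N in H2; last by rewrite !muln1 add1n prednK.
have HT := mleadB (mlead_scale (lead_det HMy) HNb) H2.
have CN : y ^+ 1 *: (('i%C * rho)%:M : 'M[K]_n) = ('i%C : K) *: CM.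
  by rewrite /CM !scale_scalar_mx; congr _%:M; ring.
have CNb : map_mx Num.conj (y ^+ 1 *: ('i%C * rho)%:M) = - ('i%C : K) *: CMb.
  by rewrite CN /CMb; apply/matrixP => i j; rewrite !mxE -iJ; exact: rmorphM.
(* The leading coefficient of dbar_mx, by N adj(M) conj(M) ~ i det(M) conj(M). *)
have CE : \det CM *: map_mx Num.conj (y ^+ 1 *: ('i%C * rho)%:M) -
    y ^+ 1 *: ('i%C * rho)%:M *m \adj CM *m CMb = (- 2 * 'i%C * \det CM) *: CMb.
  rewrite CNb CN -scalemxAl mul_mx_adj -scalemxAl mul_scalar_mx !scalerA -scalerBl.
  by congr (_ *: _); ring.
have := lead_det HT; rewrite -/CM -/CMb CE => HD.
have dCM : \det CM != 0.
  by rewrite /CM scale_scalar_mx det_scalar expf_neq0// mulf_neq0// expr1.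
have dC : \det ((- 2 * 'i%C * \det CM) *: CMb) != 0.
  have i0 : 'i%C != 0 :> K by rewrite eq_complex /= oner_eq0 andbF.
  have m2 : - 2 != 0 :> K by rewrite oppr_eq0 pnatr_eq0.
  have CMb0 : \det CMb != 0 by rewrite /CMb det_map_mx fmorph_eq0.
  rewrite detZ; exact: (mulf_neq0 (expf_neq0 _ (mulf_neq0 (mulf_neq0 m2 i0) dCM)) CMb0).
have e1 : 0 < Num.min eta e by rewrite lt_min eta0.
have [t [ct te kt]] := dense_nonzero e0 HD dC c0 c1 e1.
have te1 : t < c + eta by apply: lt_le_trans te _; rewrite lerD2l ge_min lexx.
have te2 : t < 1 + e by apply: lt_le_trans te _; apply: lerD => //; rewrite ge_min lexx orbT.
exists t; have tr : mag (y * (t%:C)%C) < r.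
  rewrite magM mag_real ger0_norm; last by rewrite (le_trans c0)// ltW.
  by apply: lt_le_trans ye; rewrite ltr_pM2l.
split => //.
have tJ : Num.conj ((t%:C)%C : K) = (t%:C)%C by apply/CrealP/complex_realP; exists t.
have T0 : dbar_mx (y * (t%:C)%C) \in unitmx by rewrite unitmxE unitfE; move: kt; rewrite tJ.
by rewrite -[b _](mulKmx T0) dbar_mx_ker// mulmx0.
Qed.

End DbarLinear.

(** * The holomorphic and antiholomorphic parts of a real differential *)

Section Dbar.
Variables (R : realType) (n : nat) (f : 'rV[CC R]_n -> CC R).
Notation K := (CC R).

Definition dz x : 'cV[K]_n :=
  \col_l ((real_diff f x (delta_mx 0 l) - 'i%C * real_diff f x ('i%C *: delta_mx 0 l)) / 2).
Definition dzbar x : 'cV[K]_n :=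
  \col_l ((real_diff f x (delta_mx 0 l) + 'i%C * real_diff f x ('i%C *: delta_mx 0 l)) / 2).

Lemma dzbarE x l : dzbar x l 0 =
  (real_diff f x (delta_mx 0 l) + 'i%C * real_diff f x ('i%C *: delta_mx 0 l)) / 2.
Proof. by rewrite [LHS]mxE. Qed.

(** Expansion of w in the real basis e_l, i e_l. *)
Lemma real_diff_dbar x w :
  real_diff f x w = \sum_l (w 0 l * dz x l 0 + Num.conj (w 0 l) * dzbar x l 0).
Proof.
have {1}-> : w = \sum_l ((((complex.Re (w 0 l))%:C)%C : K) *: delta_mx 0 l +
  (((complex.Im (w 0 l))%:C)%C : K) *: ('i%C *: delta_mx 0 l)).
  rewrite [LHS]row_sum_delta; apply: eq_bigr => l _.
  by rewrite scalerA -scalerDl -complex_ReIm.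
rewrite (rlinear_sum _ _ (real_diff_rlinear f x)); apply: eq_bigr => l _.
rewrite real_diffD !real_diffZ !mxE.
set p := real_diff f x _; set q := real_diff f x _.
have E1 := complex_ReIm (w 0 l).
have E2 : Num.conj (w 0 l) = ((complex.Re (w 0 l))%:C)%C - ((complex.Im (w 0 l))%:C)%C * 'i%C.
  by case: (w 0 l) => a b; apply/eqP; rewrite eq_complex /=; apply/andP; split; apply/eqP; ring.
have ii : 'i%C * 'i%C = -1 :> K by apply/eqP;
  rewrite eq_complex /= !mulr0 !mul0r mulr1 sub0r addr0 oppr0 !eqxx.
have alg (I X Y s t : K) : I * I = -1 -> X * s + Y * t =
  (X + Y * I) * ((s - I * t) / 2) + (X - Y * I) * ((s + I * t) / 2).
  by move=> II; transitivity (X * s - I * I * Y * t); [rewrite II; ring|field].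
by rewrite E2; apply: etrans (alg _ _ _ _ _ ii) _; rewrite -E1.
Qed.

End Dbar.

(** * Fields along the leaves of the foliation *)

Section Main.
Variables (R : realType) (n : nat).
Notation K := (CC R).
Notation disc := (@unit_disc R).
Notation sph := (@sphere R n).
Notation A := (disc `*` sph).
Variables (Omega : set 'rV[K]_n) (h : K * 'rV[K]_n -> 'rV[K]_n) (f : 'rV[K]_n -> K).
Hypothesis Omega_open : open Omega.
Hypothesis h_foliation : C1_singular_foliation Omega h.
Hypothesis f_Cinfty0 : Cinfty_at0 f.
Hypothesis f_C1 : C1_open Omega f.
Hypothesis f_leaves : forall v, sph v -> holomorphic_on disc (fun z => f (h (z, v))).

Let frV := frame_rV R n.
Let frP := frame_pair (frame_K R) (frame_rV R n).

Lemma h_hol v : sph v -> holomorphic_on disc (fun z => h (z, v)).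
Proof. by move=> vs; have [] := foliation_embedding h_foliation vs. Qed.

Lemma h_coord_hol i v : sph v -> holomorphic_on disc (fun z => h (z, v) 0 i : K).
Proof.
move=> vs z zd.
apply: (@differentiable_comp _ _ _ _ (fun z : K => h (z, v)) (fun N : 'rV[K]_n => N 0 i : K)).
  exact: h_hol.
exact: differentiable_coord.
Qed.

Lemma h_strict : exists LH : K -> 'rV[K]_n -> K * 'rV[K]_n -> 'rV[K]_n,
  forall z v, disc z -> sph v -> strict_on A h (z, v) (LH z v).
Proof.
have H : forall p : K * 'rV[K]_n, exists L, A p -> strict_on A h p L.
  move=> p; have [Ap|nAp] := pselect (A p); last by exists (fun=> 0).
  by have [L HL] := C1_on_strict frP (coframe_rV R n) (foliation_C1 h_foliation) Ap; exists L.
have [LH HLH] := choice H.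
by exists (fun z v => LH (z, v)) => z v zd vs; apply: HLH.
Qed.

Lemma h_Omega z v : disc z -> sph v -> Omega (h (z, v)).
Proof. by move=> zd vs; rewrite -(foliation_image h_foliation); exists (z, v). Qed.

Lemma f_strict x : Omega x -> strict_on setT f x (real_diff f x).
Proof. exact: C1_open_strict frV (coframe_K R) Omega_open f_C1. Qed.

Lemma radius_exists v : exists rho : R, sph v -> 0 < rho /\
  derive1 (fun z => h (z, v)) 0 = ((rho%:C)%C : K) *: v.
Proof.
have [vs|nvs] := pselect (sph v); last by exists 1.
by have [rho H] := foliation_direction h_foliation vs; exists rho.
Qed.

Section Radius.
Variable rho : 'rV[K]_n -> R.
Hypothesis rhoP : forall v, sph v -> 0 < rho v /\
  derive1 (fun z => h (z, v)) 0 = ((rho v)%:C)%C *: v.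
Variable LH : K -> 'rV[K]_n -> K * 'rV[K]_n -> 'rV[K]_n.
Hypothesis LHP : forall z v, disc z -> sph v -> strict_on A h (z, v) (LH z v).

Let disc0 : disc 0. Proof. by apply/discP; rewrite mag0. Qed.

Lemma leaf_expansion v : sph v -> forall e : R, 0 < e -> exists d : R, 0 < d /\
  forall z, mag z <= d -> mag (h (z, v) - z *: (((rho v)%:C)%C *: v)) <= e * mag z.
Proof.
move=> vs e e0; have D := h_hol vs disc0.
have [d [d0 H]] := cdiff_mag D e0.
exists (d / 2); split; first lra.
move=> z zd; have := H z; rewrite addr0 (foliation_center h_foliation vs) subr0.
have -> : 'd (fun z => h (z, v)) 0 z = z *: (((rho v)%:C)%C *: v).
  rewrite -(rhoP vs).2 derive1E'// -[in LHS](mulr1 z) -linearZ /=; congr ('d _ _ _).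
by apply; lra.
Qed.

Variables (r : R).
Hypothesis r0 : 0 < r.
Hypothesis r1 : r < 1.

Let hL i z v : K * 'rV[K]_n -> K := fun w => LH z v w 0 i.
Let h_coord_strict i z v : disc z -> sph v -> strict_on A (fun p => h p 0 i : K) (z, v) (hL i z v).
Proof. by move=> zd vs; apply: strict_on_coord; exact: LHP. Qed.

Lemma h_coord_vord i v : sph v -> vord r 0 (fun z => h (z, v) 0 i : K).
Proof.
move=> vs.
exact (leaf_vord (Phi := fun p => h p 0 i : K) (fun v' vs' => h_coord_hol i vs')
  (fun z v' => @h_coord_strict i z v') r0 r1 vs).
Qed.

Lemma h_coord_lead i v : sph v -> lead r 1 ((rho v)%:C%C * v 0 i) (fun z => h (z, v) 0 i : K).
Proof.
move=> vs; apply: vord_littleo => //.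
  by apply: vordB; [exact: h_coord_vord|apply: vord_le (vordZX r 1 _)].
move=> e e0; have [d [d0 H]] := leaf_expansion vs e0.
exists d; split => // z /H; rewrite expr1; apply: le_trans.
by apply: le_trans (mag_coord _ i); rewrite !mxE [_ * z]mulrC.
Qed.

Lemma fh_strict z v : disc z -> sph v ->
  strict_on A (fun p => f (h p)) (z, v) (real_diff f (h (z, v)) \o LH z v).
Proof.
move=> zd vs; apply: (strict_on_comp (B := setT)) => //.
- exact: LHP.
- by apply: f_strict; exact: h_Omega.
Qed.

Lemma fh_vord v : sph v -> vord r 0 (fun z => f (h (z, v))).
Proof.
move=> vs.
exact (leaf_vord (Phi := fun p => f (h p)) f_leaves (fun z v' => @fh_strict z v') r0 r1 vs).
Qed.

(** Dropping the terms with conjugates from the Taylor polynomial keeps the order of approximation. *)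
Lemma holomorphic_jet k : exists P, holpoly P /\ agree k.+1 f P.
Proof.
have [p Hp] := f_Cinfty0 (ltn0Sn k).
have fp : agree k.+1 f (zzbar_eval p).
  move=> e e0; have ec0 : 0 < (e%:C)%C :> K by rewrite ltcR.
  have /eqoP/(_ _ ec0) := Hp.
  move=> /near0_mag[d [d0 H]]; exists (d / 2); split; first lra.
  move=> x xd; have := H x; rewrite normrX normr_id -!magE -rmorphXn -rmorphM lecR; apply; lra.
exists (hol_part p); split; first exact: hol_part_holpoly.
apply: (hol_part_agree fp r0 (U := fun v z => h (z, v)) (rho := rho)).
- by move=> v /rhoP[].
- by move=> v i vs; exact: h_coord_vord.
- by move=> v vs; exact: fh_vord.
- by move=> v vs; exact: leaf_expansion.
Qed.

Lemma fP_vord k P v : holpoly P -> agree k f P -> sph v ->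
  vord r k.+1 (fun z => f (h (z, v)) - P (h (z, v))).
Proof.
move=> HP fP vs; apply: vord_littleo => //.
  apply: vordB; first exact: fh_vord.
  by apply: (holpoly_vord (u := fun z => h (z, v))) HP _ => i; exact: h_coord_vord.
move=> e e0; have rv := (rhoP vs).1.
pose C : R := mag ((((rho v)%:C)%C : K) *: v) + 1.
have C0 : 0 < C by have := mag_ge0 ((((rho v)%:C)%C : K) *: v); rewrite /C; lra.
have Ck : 0 < C ^+ k by exact: exprn_gt0.
have e1 : 0 < e / C ^+ k by rewrite divr_gt0.
have [d1 [d10 H1]] := fP _ e1; have [d2 [d20 H2]] := leaf_expansion vs ltr01.
exists (Num.min d2 (d1 / C)); split; first by rewrite lt_min d20 divr_gt0.
move=> z; rewrite le_min ler_pdivlMr// => /andP[/H2 h2 zC].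
have hC : mag (h (z, v)) <= mag z * C.
  rewrite -[h _](subrK (z *: ((((rho v)%:C)%C : K) *: v))).
  apply: le_trans (magD _ _) _; rewrite magZ /C mulrDr mulr1 addrC lerD2l.
  by rewrite mul1r in h2.
apply: le_trans (H1 _ (le_trans hC zC)) _.
have -> : e * mag z ^+ k = e / C ^+ k * (mag z * C) ^+ k.
  by rewrite exprMn [mag z ^+ k * _]mulrC mulrA divfK// lt0r_neq0.
by rewrite ler_wpM2l ?(ltW e1)// lerXn2r// nnegrE ?mulr_ge0 ?mag_ge0// ltW.
Qed.

Variable v : 'rV[K]_n.
Hypothesis vs : sph v.

Lemma leaf_clinear z (c zeta : K) : disc z -> LH z v (c * zeta, 0) = c *: LH z v (zeta, 0).
Proof.
move=> zd; apply/rowP => i; rewrite mxE.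
have E := leaf_derivative (Phi := fun p => h p 0 i : K) (L := hL i)
  (fun v' vs' => h_coord_hol i vs') (fun z v' => @h_coord_strict i z v') zd vs.
by rewrite -[LHS]/(hL i z v _) -[in RHS]/(hL i z v _) !E -[c * zeta]/(c *: zeta) linearZ.
Qed.

Lemma f_leaf_clinear z (c zeta : K) : disc z ->
  real_diff f (h (z, v)) (c *: LH z v (zeta, 0)) = c * real_diff f (h (z, v)) (LH z v (zeta, 0)).
Proof.
move=> zd; rewrite -leaf_clinear//.
have E := leaf_derivative (Phi := fun p => f (h p))
  (L := fun z v => real_diff f (h (z, v)) \o LH z v)
  f_leaves fh_strict zd vs.
have E1 := E (c * zeta); have E2 := E zeta; rewrite /= in E1 E2.
by rewrite E1 E2 -[c * zeta]/(c *: zeta) linearZ.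
Qed.

Section Curve.
Variables (g : R -> 'rV[K]_n) (xi : 'rV[K]_n).
Hypothesis g_sph : forall t, sph (g t).
Hypothesis g0 : g 0 = v.
Hypothesis g_deriv : rderiv0 g xi.

Lemma field_vord i : vord r 1 (fun z => LH z v (0, xi) 0 i : K).
Proof.
apply: (deriv_vord (Phi := fun p => h p 0 i : K) (L := hL i) _ g_sph g0 g_deriv r0 r1).
  by move=> z v'; exact: h_coord_strict.
by move=> w ws; exact: lead_vord (h_coord_lead i ws).
Qed.

Lemma jet_field_vord k P (G : K -> 'rV[K]_n) : holpoly P -> agree k f P ->
  (forall x, exists G, strict_on setT P x (grad_form G)) ->
  (forall z, strict_on setT P (h (z, v)) (grad_form (G z))) ->
  vord r k.+1 (fun z => real_diff f (h (z, v)) (LH z v (0, xi)) - grad_form (G z) (LH z v (0, xi))).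
Proof.
move=> HP fP PG HG.
have [GG HGG] := choice PG.
(* The gradients are prescribed on the leaf of v; on the other leaves any choice will do. *)
pose LL z w := if w == v then
  (fun p => real_diff f (h (z, w)) (LH z w p) - grad_form (G z) (LH z w p))
  else (fun p => real_diff f (h (z, w)) (LH z w p) - grad_form (GG (h (z, w))) (LH z w p)).
have St z w : disc z -> sph w -> strict_on A (fun p => f (h p) - P (h p)) (z, w) (LL z w).
  move=> zd ws; rewrite /LL; case: eqP => [->|_].
    apply: strict_onB; first exact: fh_strict.
    by apply: (strict_on_comp (B := setT)) => //; exact: LHP.
  apply: strict_onB; first exact: fh_strict.
  by apply: (strict_on_comp (B := setT)) => //; exact: LHP.
have := deriv_vord St g_sph g0 g_deriv r0 r1 (m := k.+1).
rewrite {1}/LL eqxx; apply => w ws; exact: fP_vord.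
Qed.

(** The leading coefficient of h(z, g t) is rho(g t) g t, and the difference quotients in t converge
    uniformly in z; hence so do their leading coefficients, by [lead_bound].  In particular rho o g
    need not be differentiable a priori. *)
Lemma lead_deriv i c : lead r 1 c (fun z => LH z v (0, xi) 0 i : K) ->
  rderiv0 (fun t => ((rho (g t))%:C)%C * g t 0 i : K) (c : K).
Proof.
move=> Hc e e0.
have e1 : 0 < e * r by rewrite mulr_gt0.
have [d [d0 H]] := diff_quot_uniform (Phi := fun p => h p 0 i : K) (L := hL i)
  (fun z v' => @h_coord_strict i z v') g_sph g0 g_deriv r1 e1.
exists d; split => // t td.
have [->|t0] := eqVneq t 0; first by rewrite subrr rmorph0 scale0r subrr mag0 normr0 mulr0.
have tc0 : ((t%:C)%C : K) != 0 by apply/eqP => /complexI/eqP; rewrite (negPf t0).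
have at0 : 0 < `|t| by rewrite normr_gt0.
pose y t : K := ((rho (g t))%:C)%C * g t 0 i.
have Hq : lead r 1 ((t%:C)%C^-1 * (y t - y 0) - c)
    (fun z => diff_quot (fun p => h p 0 i : K) g v t z - LH z v (0, xi) 0 i).
  have H1 := h_coord_lead i (g_sph t); have H2 := h_coord_lead i vs; rewrite -g0 in H2.
  apply: vord_ext (vordB (vordZ (((t%:C)%C : K)^-1) (vordB H1 H2)) Hc) => z _.
  by rewrite /diff_quot /y fmorphV g0; ring.
have := lead_bound r0 Hq (S := e * r); rewrite expr1 ler_pM2r// => /(_ _)/wrap[].
  by move=> z zr; exact: H.
move=> h1; have -> : y t - y 0 - ((t%:C)%C : K) *: c = (t%:C)%C * ((t%:C)%C^-1 * (y t - y 0) - c).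
  by rewrite /GRing.scale/=; field.
by rewrite magM mag_real [leRHS]mulrC ler_pM2l.
Qed.

(** The leading vector rho(g t) g t is parallel to g t.  Differentiating the equations
    y_i g_j = y_j g_i, with y = rho(g) g, shows that the leading vector of the field equals
    rho xi up to a multiple of v. *)
Lemma field_lead : exists s : K, forall i,
  lead r 1 ((rho v)%:C%C * xi 0 i + s * v 0 i) (fun z => LH z v (0, xi) 0 i : K).
Proof.
have /choice[c Hc] : forall i, exists c, lead r 1 c (fun z => LH z v (0, xi) 0 i : K).
  by move=> i; exact: vord_lead r0 (field_vord i).
have [j vj] := sphere_neq0 vs.
have cross i : c i * v 0 j + (rho v)%:C%C * v 0 i * xi 0 j -
  (c j * v 0 i + (rho v)%:C%C * v 0 j * xi 0 i) = 0.
  have D1 := rderiv0M (lead_deriv (Hc i)) (rderiv0_coord j g_deriv).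
  have D2 := rderiv0M (lead_deriv (Hc j)) (rderiv0_coord i g_deriv).
  have := rderiv0_cst (rderiv0B D1 D2); rewrite !g0; apply => t; ring.
exists ((c j - (rho v)%:C%C * xi 0 j) / v 0 j) => i.
have -> : (rho v)%:C%C * xi 0 i + (c j - (rho v)%:C%C * xi 0 j) / v 0 j * v 0 i = c i;
  last exact: Hc.
apply: (mulIf vj); apply/eqP; rewrite -subr_eq0; apply/eqP.
rewrite -[RHS]oppr0 -(cross i); field.
by [].
Qed.

End Curve.

Lemma imag_orth : real_orth v ('i%C *: v).
Proof.
have iJ : Num.conj ('i%C : K) = - 'i%C by apply/eqP; rewrite eq_complex /= oppr0 !eqxx.
rewrite /real_orth big1 // => k _; rewrite mxE.
have -> : Num.conj ('i%C * v 0 k) = - 'i%C * Num.conj (v 0 k) by rewrite -iJ; exact: rmorphM.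
ring.
Qed.

(** The unit circle through v in the complex line of v, with velocity i v. *)
Definition rotation_curve t : 'rV[K]_n := sphere_curve v ('i%C *: v) t.

Let rot_sph t : sph (rotation_curve t). Proof. exact: sphere_curve_sphere vs imag_orth. Qed.
Let rot0 : rotation_curve 0 = v. Proof. exact: sphere_curve0. Qed.
Let rot_deriv : rderiv0 rotation_curve ('i%C *: v). Proof. exact: sphere_curve_deriv. Qed.

Lemma rot_expi t : exists theta, rotation_curve t = expi theta *: v.
Proof.
have [c E] : exists c : K, rotation_curve t = c *: v.
  rewrite /rotation_curve /sphere_curve; eexists (_ * (_ + _ * 'i%C)).
  by rewrite -scalerA scalerDl -scalerA.
have /unit_expi[theta ct] : mag c = 1.
  have := rot_sph t; rewrite /sphere /= E.
  have -> : \sum_(i < n) `|(c *: v) 0 i| ^+ 2 = `|c| ^+ 2.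
    rewrite -[RHS]mulr1 -vs mulr_sumr; apply: eq_bigr => i _.
    by rewrite mxE normrM exprMn.
  rewrite -magE -rmorphXn -[X in _ = X](rmorph1 (real_complex R)) => /complexI/eqP.
  by rewrite sqrp_eq1 ?mag_ge0// => /eqP.
by exists theta; rewrite E ct.
Qed.

Lemma rot_leaf t z : disc z -> exists c : K, rotation_curve t =
  c *: v /\ disc (c * z) /\ h (z, rotation_curve t) = h (c * z, v).
Proof.
move=> zd; have [theta E] := rot_expi t; exists (expi theta); split => //.
split; first by apply/discP; rewrite magM mag_expi mul1r; apply/discP.
by rewrite E (foliation_rotation h_foliation).
Qed.

Definition rotation_field z := LH z v (0, 'i%C *: v).

(** The rotation identity makes rho constant along the curve. *)
Lemma rotation_field_lead i :
  lead r 1 ((rho v)%:C%C * ('i%C * v 0 i)) (fun z => rotation_field z 0 i : K).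
Proof.
have [c Hc] := vord_lead r0 (field_vord rot_sph rot0 rot_deriv i).
have D := lead_deriv rot_sph rot0 rot_deriv Hc.
have E t : (rho (rotation_curve t))%:C%C * rotation_curve t 0 i =
  (rho v)%:C%C * rotation_curve t 0 i.
  have [theta Et] := rot_expi t.
  apply: lead_unique r0 (h_coord_lead i (rot_sph t)) _.
  have m2 : mag (expi theta : K) * r <= r by rewrite mag_expi mul1r.
  apply: vord_ext (vord_dilate m2 (h_coord_lead i vs)) => z zr.
  have zd : disc z by apply/discP; exact: le_lt_trans zr r1.
  by rewrite Et (foliation_rotation h_foliation)// mxE; ring.
have D2 := rderiv0Z ((rho v)%:C%C : K) (rderiv0_coord i rot_deriv).
have -> : (rho v)%:C%C * ('i%C * v 0 i) = c :> K; last exact: Hc.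
rewrite (rderiv0_unique (rderiv0_ext (h := fun t => (rho v)%:C%C * rotation_curve t 0 i : K) E D)
  D2).
by rewrite mxE.
Qed.

(** The paths (z, c v) and (c z, v), with c = c(t) on the unit circle, have the same image under h.
    Their velocities are (0, i v) and (i z, 0). *)
Lemma rotation_field_leaf z : disc z -> rotation_field z = LH z v ('i%C * z, 0).
Proof.
move=> zd; apply/rowP => i.
have [j vj] := sphere_neq0 vs.
have H1 := strict_on_path (p := fun t => (z, rotation_curve t)) frP (LHP zd vs)
  (fun t => conj zd (rot_sph t)).
have P1 := H1 _ (congr1 (pair z) rot0) (rderiv0_pair (rderiv0_const z) rot_deriv).
pose c t : K := z / v 0 j * rotation_curve t 0 j.
have cE t : exists c', rotation_curve t = c' *: v /\ disc (c' * z) /\ h (z, rotation_curve t) =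
  h (c' * z, v) /\ c t = c' * z.
  have [c' [E1 [E2 E3]]] := rot_leaf t zd; exists c'; split => //; split => //; split => //.
  by rewrite /c E1 mxE; field.
have cd t : disc (c t) by have [c' [_ [E [_ ->]]]] := cE t.
have hc t : h (z, rotation_curve t) = h (c t, v) by have [c' [_ [_ [-> ->]]]] := cE t.
have c_deriv : rderiv0 c ('i%C * z).
  have := rderiv0Z (z / v 0 j) (rderiv0_coord j rot_deriv).
  by rewrite mxE (_ : z / v 0 j * ('i%C * v 0 j) = 'i%C * z)//; field.
have c0 : (c 0, v) = (z, v) by congr pair; rewrite /c rot0 divfK.
have H2 := strict_on_path (p := fun t => (c t, v)) frP (LHP zd vs) (fun t => conj (cd t) vs) c0.
have P2 := H2 _ (rderiv0_pair c_deriv (rderiv0_const v)).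
apply: rderiv0_unique (rderiv0_coord i P1) _.
by apply: rderiv0_ext (rderiv0_coord i P2) => t; rewrite hc.
Qed.

Lemma f_rotation_clinear z (c : K) : disc z ->
  real_diff f (h (z, v)) (c *: rotation_field z) = c * real_diff f (h (z, v)) (rotation_field z).
Proof. by move=> zd; rewrite rotation_field_leaf// f_leaf_clinear. Qed.

(** G z is the gradient at h(z, v) of a polynomial that approximates f to order k at the origin.  The
    same G must serve for all fields, hence this definition. *)
Definition jet_of k (G : K -> 'rV[K]_n) := exists P, [/\ holpoly P, agree k f P,
  (forall x, exists G, strict_on setT P x (grad_form G)) &
  (forall z, strict_on setT P (h (z, v)) (grad_form (G z)))].

Lemma jet_exists k : exists G, jet_of k.+1 G.
Proof.
have [P [HP fP]] := holomorphic_jet k.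
have PG x := holpoly_strict x HP.
have [G HG] := choice (fun z => PG (h (z, v))).
by exists G, P; split.
Qed.

(** Split w = xi + a v with a real and xi tangent to the sphere.  The field of xi has the leading
    vector rho xi + s v; a complex multiple of the rotation field, whose leading vector is i rho v,
    corrects the component along v. *)
Lemma field_exists (w : 'rV[K]_n) : exists X : K -> 'rV[K]_n,
  (forall i, lead r 1 ((rho v)%:C%C * w 0 i) (fun z => X z 0 i : K)) /\
  (forall k G, jet_of k G ->
        vord r k.+1 (fun z => real_diff f (h (z, v)) (X z) - grad_form (G z) (X z))).
Proof.
have rv : (rho v)%:C%C != 0 :> K.
  by apply/eqP => /complexI/eqP; rewrite (gt_eqF (rhoP vs).1).
have i0 : 'i%C != 0 :> K by rewrite eq_complex /= oner_eq0 andbF.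
pose a : K := (\sum_k (w 0 k * Num.conj (v 0 k) + Num.conj (w 0 k) * v 0 k)) / 2.
have aJ : Num.conj a = a.
  rewrite /a rmorphM rmorph_sum fmorphV rmorph_nat; congr (_ / _).
  by apply: eq_bigr => k _; rewrite /= rmorphD !rmorphM /= !conjCK addrC mulrC [X in _ + X]mulrC.
pose xi := w - a *: v.
have orth : real_orth v xi.
  rewrite /real_orth /xi.
  transitivity (\sum_k (w 0 k * Num.conj (v 0 k) + Num.conj (w 0 k) * v 0 k) - 2 * a *
    \sum_k `|v 0 k| ^+ 2).
    rewrite mulr_sumr -sumrB; apply: eq_bigr => k _.
    have -> : (w - a *: v) 0 k = w 0 k - a * v 0 k by rewrite !mxE.
    have -> : Num.conj (w 0 k - a * v 0 k) = Num.conj (w 0 k) - a * Num.conj (v 0 k).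
      by rewrite -[in RHS]aJ rmorphB rmorphM.
    by rewrite normCK; ring.
  by rewrite vs /a; field.
have g_sph t := sphere_curve_sphere t vs orth.
have g0 := sphere_curve0 v xi; have g_deriv := @sphere_curve_deriv _ _ v xi.
have [s Hs] := field_lead g_sph g0 g_deriv.
(* kap solves s + kap * i * rho v = rho v * a, the v-component of the leading vector of X. *)
pose kap : K := ((rho v)%:C%C * a - s) / ('i%C * (rho v)%:C%C).
pose X z := LH z v (0, xi) + kap *: rotation_field z.
have DX z : disc z -> real_diff f (h (z, v)) (X z) =
    real_diff f (h (z, v)) (LH z v (0, xi)) + kap * real_diff f (h (z, v)) (rotation_field z).
  by move=> zd; rewrite real_diffD f_rotation_clinear.
have dr z : mag z <= r -> disc z by move=> zr; apply/discP; exact: le_lt_trans zr r1.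
exists X; split.
- move=> i; have -> : (rho v)%:C%C * w 0 i =
  (rho v)%:C%C * xi 0 i + s * v 0 i + kap * ((rho v)%:C%C * ('i%C * v 0 i)).
    by rewrite /kap /xi !mxE; field; rewrite rv.
  have H2 := leadM (lead_cst r kap) (rotation_field_lead i).
  by apply: lead_ext (leadD (Hs i) H2) => z _; rewrite /X !mxE.
move=> k G [P [HP fP PG HG]].
have V1 := jet_field_vord g_sph g0 g_deriv HP fP PG HG.
have V2 := jet_field_vord rot_sph rot0 rot_deriv HP fP PG HG.
apply: vord_ext (vordD V1 (vordZ kap V2)) => z /dr zd.
rewrite DX// /X /grad_form /rotation_field mulrBr mulr_sumr.
rewrite addrACA -opprD -big_split /=; congr (_ - _).
by apply: eq_bigr => i _; rewrite !mxE; ring.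
Qed.

Hypothesis n0 : (0 < n)%N.

Lemma dzbar_dense (y : K) (c eta : R) : y != 0 -> mag y < r -> 0 <= c -> c <= 1 -> 0 < eta ->
  exists t : R, [/\ c < t, t < c + eta, mag (y * (t%:C)%C) < r & dzbar f (h (y * (t%:C)%C, v)) = 0].
Proof.
have [X HX] := choice field_exists.
have [G HG] := choice jet_exists.
have rv : (rho v)%:C%C != 0 :> K.
  by apply/eqP => /complexI/eqP; rewrite (gt_eqF (rhoP vs).1).
pose Fm (w : 'I_n -> 'rV[K]_n) z : 'M[K]_n := \matrix_(i, j) X (w i) z 0 j.
pose dm (w : 'I_n -> 'rV[K]_n) z : 'cV[K]_n := \col_i real_diff f (h (z, v)) (X (w i) z).
have dj w k : mvord r k (fun z => dm w z - Fm w z *m (G k z)^T).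
  move=> i j; have [_ H] := HX (w i); have := H _ _ (HG k).
  move=> /(vord_le (leq_trans (leqnSn k) (leqnSn k.+1))); apply: vord_ext => z _.
  rewrite !mxE; congr (_ - _); apply: eq_bigr => l _; rewrite !mxE (ord1 j).
  exact: mulrC.
have dE w z : dm w z = Fm w z *m dz f (h (z, v)) + map_mx Num.conj (Fm w z) *m dzbar f (h (z, v)).
  apply/colP => i; rewrite !mxE real_diff_dbar big_split /=.
  by congr (_ + _); apply: eq_bigr => l _; rewrite !mxE.
have ML : mlead r 1 (((rho v)%:C%C : K)%:M) (Fm (fun i => delta_mx 0 i)).
  move=> i j; have [H _] := HX (delta_mx 0 i); have := H j.
  by rewrite !mxE eqxx /= eq_sym mulr_natr; apply: lead_ext => z _; rewrite mxE.
have NL : mlead r 1 (('i%C * (rho v)%:C%C : K)%:M) (Fm (fun i => 'i%C *: delta_mx 0 i)).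
  move=> i j; have [H _] := HX ('i%C *: delta_mx 0 i); have := H j.
  rewrite !mxE eqxx /= eq_sym mulrA mulr_natr [_ * 'i%C]mulrC.
  by apply: lead_ext => z _; rewrite mxE.
apply (dbar_zeros_dense (A := fun k z => (G k z)^T) (a := fun z => dz f (h (z, v)))
  (b := fun z => dzbar f (h (z, v))) n0 r0 rv ML NL (dj _) (dj _)
  (fun z _ => dE _ z) (fun z _ => dE _ z)).
Qed.

End Radius.

Hypothesis n0 : (0 < n)%N.

Lemma dzbar_continuous x l : Omega x -> forall e : R, 0 < e -> exists d : R, 0 < d /\
  forall y, mag (y - x) < d -> mag (dzbar f y l 0 - dzbar f x l 0) < e.
Proof.
move=> Ox e e0; pose W : R :=
  mag (delta_mx 0 l : 'rV[K]_n) + mag ('i%C *: delta_mx 0 l : 'rV[K]_n) + 1.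
have m1 := mag_ge0 (delta_mx 0 l : 'rV[K]_n); have m2 := mag_ge0 ('i%C *: delta_mx 0 l : 'rV[K]_n).
have W0 : 0 < W by rewrite /W; lra.
have e1 : 0 < e / W by rewrite divr_gt0.
have [d [d0 H]] := real_diff_opnorm_continuous frV f_C1 Ox e1.
exists d; split => // y /H yx.
have h1 := yx (delta_mx 0 l); have h2 := yx ('i%C *: delta_mx 0 l).
have alg (s t s' t' : K) : (s + 'i%C * s') / 2 - (t + 'i%C * t') / 2 =
  (s - t + 'i%C * (s' - t')) / 2.
  by field.
have -> := congr2 (fun s t : K => s - t) (dzbarE f y l) (dzbarE f x l).
rewrite alg magM.
have -> : mag (2^-1 : K) = 2^-1.
  have -> : 2^-1 = ((2^-1 : R)%:C)%C :> K by rewrite fmorphV rmorph_nat.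
  by rewrite mag_real ger0_norm// invr_ge0.
have iM : mag ('i%C : K) = 1.
  apply/eqP; rewrite -(@sqrp_eq1 _ (mag ('i%C : K))) ?mag_ge0//; apply/eqP.
  by rewrite mag_sqr /= expr0n expr1n add0r.
rewrite ltr_pdivrMr//; apply: le_lt_trans (magD _ _) _; rewrite magM iM mul1r.
apply: le_lt_trans (lerD h1 h2) _; rewrite -mulrDr mulrAC ltr_pdivrMr//.
by rewrite -mulrA ltr_pM2l// /W; lra.
Qed.

(** The point z0 is written y c with y nonzero and c in [0, 1]: for z0 = 0 one takes c = 0.  The zeros
    provided by [dzbar_dense] lie on the ray of y beyond c and accumulate at z0. *)
Lemma dzbar_eq0 x : Omega x -> dzbar f x = 0.
Proof.
move=> Ox; have := Ox; rewrite -(foliation_image h_foliation) => -[[z0 v] [/= z0d vs] hx].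
have [rho rhoP] := choice radius_exists.
have [LH LHP] := h_strict.
have z01 : mag z0 < 1 by apply/discP.
have [y [c [y0 y1 c01 yc]]] : exists (y : K) (c : R),
  [/\ y != 0, mag y < 1, 0 <= c <= 1 & y * (c%:C)%C = z0].
  have [->|z00] := eqVneq z0 0.
    exists ((2^-1 : R)%:C)%C, 0; rewrite mulr0 lexx ler01; split => //.
      by apply/eqP => /complexI/eqP; rewrite invr_eq0 pnatr_eq0.
    by rewrite mag_real ger0_norm ?invr_ge0//; lra.
  by exists z0, 1; rewrite mulr1 lexx ler01.
have my := mag_gt0 y0; have /andP[c0 c1] := c01.
pose r := (1 + mag y) / 2.
have r0 : 0 < r by rewrite /r; lra.
have r1 : r < 1 by rewrite /r; lra.
have yr : mag y < r by rewrite /r; lra.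
apply/colP => l; rewrite [RHS]mxE; pose b : K := dzbar f x l 0.
suff b0 : mag b = 0 by exact: (mag_eq0 b0).
apply/eqP; rewrite eq_le mag_ge0 andbT.
apply/ler_addgt0Pr => e e0; rewrite add0r.
have [d1 [d10 H1]] := dzbar_continuous l Ox e0.
have [d2 [d20 H2]] := strict_on_continuous (x := (z0, v)) frP (conj z0d vs) (LHP _ _ z0d vs) d10.
have [t [ct td tr bt]] := dzbar_dense rhoP LHP r0 r1 vs n0 y0 yr c0 c1 d20.
have td' : disc (y * (t%:C)%C) by apply/discP; exact: lt_trans tr r1.
have := H1 (h (y * (t%:C)%C, v)); rewrite bt mxE sub0r magN => H; apply/ltW/H.
rewrite -hx; apply: H2; first by split.
apply/mag_pair_lt => /=; rewrite subrr mag0; split => //.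
rewrite -yc -mulrBr -rmorphB magM mag_real ger0_norm; last lra.
by apply: le_lt_trans (_ : t - c < d2); [rewrite ler_piMl ?ltW//; lra|lra].
Qed.

Lemma holomorphic_of_leaves : holomorphic_on Omega f.
Proof.
move=> x Ox.
have E w : real_diff f x w = \sum_l w 0 l * dz f x l 0.
  rewrite real_diff_dbar; apply: eq_bigr => l _.
  by have -> : dzbar f x l 0 = 0; [rewrite dzbar_eq0// mxE|rewrite mulr0 addr0].
have Dlin : linear (real_diff f x : 'rV[K]_n -> K).
  move=> c u w; rewrite !E scaler_sumr -big_split /=; apply: eq_bigr => l _.
  by have -> : (c *: u + w) 0 l = c * u 0 l + w 0 l; [rewrite !mxE|rewrite mulrDl -mulrA].
pose D := HB.pack_for {linear 'rV[K]_n -> K} (real_diff f x : 'rV[K]_n -> K)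
  (GRing.isLinear.Build _ _ _ _ _ Dlin).
have [C [C0 HC]] := rlinear_bounded frV (real_diff_rlinear f x).
apply: (@near_diff _ _ _ f x D).
  move=> u; apply/continuous_mag => e e0; exists (e / C); split; first exact: divr_gt0.
  move=> y; rewrite -[D y - D u]real_diffB ltr_pdivlMr// mulrC => yu.
  by apply: le_lt_trans yu; exact: HC.
move=> e /Re_gt0[e0 ->]; apply/near0_mag.
have [d [d0 H]] := rdiff_mag (f_C1 Ox).1 e0.
exists d; split => // w wd; rewrite -!magE -rmorphM lecR; exact: H.
Qed.

End Main.

Theorem corollary2p6 (R : realType) (n : nat) (n_ge1 : (1 <= n)%N)
    (Omega : set 'rV[CC R]_n)
    (Omega_open : open Omega) (Omega_connected : connected Omega)
    (Omega0 : Omega 0)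
    (h : CC R * 'rV[CC R]_n -> 'rV[CC R]_n)
    (h_foliation : C1_singular_foliation Omega h)
    (f : 'rV[CC R]_n -> CC R)
    (f_Cinfty0 : Cinfty_at0 f)
    (f_C1 : C1_open Omega f)
    (f_leaves : forall v, sphere v ->
      holomorphic_on (@unit_disc R) (fun z => f (h (z, v)))) :
  holomorphic_on Omega f.
Proof.
exact: (holomorphic_of_leaves Omega_open h_foliation f_Cinfty0 f_C1 f_leaves n_ge1).
Qed.
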